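(* There exists a group $G$ generated by a finite set $S$ such that: (i) $G$ has decidable Word Problem; (ii) $G$ has undecidable Conjugacy Problem; and (iii) the language $\mathrm{ConjGeo}(G,S)$ is an unambiguous context-free language.
   Context: For a group $G$ with finite generating set $S$, a word $w\in S^*$ is a conjugacy geodesic if its length equals $\min\{\|h\|_S : h \text{ conjugate in } G \text{ to the element } \bar w \text{ represented by } w\}$, where $\|h\|_S$ is the word length of $h$ with respect to $S$. $\mathrm{ConjGeo}(G,S)\subseteq S^*$ is the language of all conjugacy geodesics. *)

(* Defs.v *)
From mathcomp Require Import all_boot.
Set Implicit Arguments. Unset Strict Implicit. Unset Printing Implicit Defensive.

Inductive rcode : Type :=
  | RZero : rcode
  | RSucc : rcode
  | RProj : nat -> rcode
  | RComp : rcode -> seq rcode -> rcode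
  | RRec  : rcode -> rcode -> rcode
  | RMu   : rcode -> rcode.

Inductive reval : rcode -> seq nat -> nat -> Prop :=
  | ev_zero xs : reval RZero xs 0
  | ev_succ x xs : reval RSucc (x :: xs) x.+1
  | ev_proj i xs : i < size xs -> reval (RProj i) xs (nth 0 xs i)
  | ev_comp f gs xs ys y :
      revals gs xs ys -> reval f ys y -> reval (RComp f gs) xs y
  | ev_rec0 f g xs y : reval f xs y -> reval (RRec f g) (0 :: xs) y
  | ev_recS f g n xs r y :
      reval (RRec f g) (n :: xs) r -> reval g (n :: r :: xs) y ->
      reval (RRec f g) (n.+1 :: xs) y
  | ev_mu f xs n :
      reval f (n :: xs) 0 ->
      (forall m, m < n -> exists2 r, reval f (m :: xs) r & r <> 0) ->
      reval (RMu f) xs n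
with revals : seq rcode -> seq nat -> seq nat -> Prop :=
  | evs_nil xs : revals [::] xs [::]
  | evs_cons g gs xs y ys :
      reval g xs y -> revals gs xs ys -> revals (g :: gs) xs (y :: ys).

(* A predicate on a countable type is decidable if some total recursive
   function computes its characteristic function on the (computable)
   standard encoding [pickle]. *)
Definition decidable_pred (T : countType) (P : T -> Prop) : Prop :=
  exists c : rcode, forall x : T,
    (P x /\ reval c [:: pickle x] 1) \/ (~ P x /\ reval c [:: pickle x] 0).

Record group := Group {
  gcar :> Type;
  gone : gcar;
  gmul : gcar -> gcar -> gcar;
  ginv : gcar -> gcar;
  gmulA : forall x y z, gmul x (gmul y z) = gmul (gmul x y) z;
  gmul1 : forall x, gmul gone x = x;
  gmulV : forall x, gmul (ginv x) x = gone }.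

Section Words.
Variables (G : group) (k : nat) (s : 'I_k -> G).

Definition eval_word (w : seq 'I_k) : G := foldr (fun a g => gmul (s a) g) (gone G) w.

Definition conjugate (g h : G) : Prop := exists x : G, gmul (ginv x) (gmul g x) = h.

Definition generates : Prop := forall g : G, exists w, eval_word w = g.
Definition symmetric_gens : Prop := forall a, exists b, s b = ginv (s a).

Definition word_problem (w : seq 'I_k) : Prop := eval_word w = gone G.
Definition conj_problem (uv : seq 'I_k * seq 'I_k) : Prop :=
  conjugate (eval_word uv.1) (eval_word uv.2).

(* |w| = min{ ||h||_S : h conjugate to w-bar }; since w-bar is itself conjugate
   to w-bar, this is equivalent to |w| <= |v| for every word v whose value is
   conjugate to w-bar (the literal unfolding of the min). *)
Definition conj_geodesic (w : seq 'I_k) : Prop :=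
  forall v : seq 'I_k, conjugate (eval_word v) (eval_word w) -> size w <= size v.
End Words.

Inductive ptree (m k : nat) : Type :=
  | PLeaf : 'I_k -> ptree m k
  | PNode : 'I_m -> seq (ptree m k) -> ptree m k.
Arguments PLeaf {m k}.
Arguments PNode {m k}.

Definition proot m k (t : ptree m k) : 'I_m + 'I_k :=
  match t with PLeaf a => inr a | PNode A _ => inl A end.

Fixpoint pyield m k (t : ptree m k) : seq 'I_k :=
  match t with
  | PLeaf a => [:: a]
  | PNode _ ts => (fix yl (ts : seq (ptree m k)) : seq 'I_k :=
                    match ts with [::] => [::] | t :: ts => pyield t ++ yl ts end) ts
  end.

Record cfg (m k : nat) := CFG {
  cfg_start : 'I_m;
  cfg_rules : seq ('I_m * seq ('I_m + 'I_k)) }.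

Fixpoint pvalid m k (R : seq ('I_m * seq ('I_m + 'I_k))) (t : ptree m k) : bool :=
  match t with
  | PLeaf _ => true
  | PNode A ts => ((A, map (@proot m k) ts) \in R) &&
      (fix vl (ts : seq (ptree m k)) : bool :=
         match ts with [::] => true | t :: ts => pvalid R t && vl ts end) ts
  end.

Definition parse_tree m k (g : cfg m k) (w : seq 'I_k) (t : ptree m k) : Prop :=
  [/\ proot t = inl (cfg_start g), pvalid (cfg_rules g) t & pyield t = w].

Definition cfg_language m k (g : cfg m k) (w : seq 'I_k) : Prop :=
  exists t, parse_tree g w t.

Definition cfg_unambiguous m k (g : cfg m k) : Prop :=
  forall w t1 t2, parse_tree g w t1 -> parse_tree g w t2 -> t1 = t2.

Definition unambiguous_cfl (k : nat) (L : seq 'I_k -> Prop) : Prop :=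
  exists (m : nat) (g : cfg m k),
    cfg_unambiguous g /\ forall w, L w <-> cfg_language g w.

(* Main.v *)
From HB Require Import structures.
Require Import Defs.
From mathcomp Require Import all_boot zify.
Set Implicit Arguments. Unset Strict Implicit. Unset Printing Implicit Defensive.

(** Let T be the Cayley tree of the free group H on a, b, and let Q = E >| H, where E is the
    group of finite sets of edges of T under symmetric difference. The group G is a central
    extension of Q by z of order 2 in which the switch of the a-edge at g and the switch of the
    b-edge at h have commutator z^f(g^-1 h), for a computable f : H -> {0, 1}. Its generators
    are all letters "cross an edge, possibly switching its lamp, possibly multiplying by z".

    Since the generating set is invariant under multiplication by z, lengths do not see z:
    except for words of length 2 with value z, a word is a conjugacy geodesic of G iff its
    image is one of Q. In Q these are shortest tours: when the H-part is trivial, closed walks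
    crossing every oriented edge of a finite subtree once; otherwise walks going once around
    the quotient of T by the H-part. Both kinds are described by an unambiguous grammar,
    whatever f is.

    With c_n = a^n b a^-n, the product x_n of the switches of the a-edges at 1 and c_n^-1 is
    conjugate to x_n z iff f(g) <> f(c_n g) for some g. For g with total a-exponent t, take
    f(g) to be the parity of the number of letters b^+-1 of g, counted when the a-exponent p of
    the prefix before it satisfies phi(p, t). Then f(c_n g) = phi(n, t) + f(g), so
    x_n ~ x_n z iff phi(n, t) holds for some t, which is undecidable for a suitable decidable
    phi. *)

(** * Functions computed by codes *)

Definition computable n (F : seq nat -> nat) : Prop :=
  exists c, forall xs, size xs = n -> reval c xs (F xs).

Definition computable1 f := computable 1 (fun xs => f (nth 0 xs 0)).
Definition computable2 f := computable 2 (fun xs => f (nth 0 xs 0) (nth 0 xs 1)).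
Definition computable3 f :=
  computable 3 (fun xs => f (nth 0 xs 0) (nth 0 xs 1) (nth 0 xs 2)).

Lemma computable_ext n F F' :
  (forall xs, size xs = n -> F xs = F' xs) -> computable n F -> computable n F'.
Proof. by move=> e [c hc]; exists c => xs sx; rewrite -e //; apply: hc. Qed.

Lemma computable_proj n i : i < n -> computable n (fun xs => nth 0 xs i).
Proof. by move=> lt; exists (RProj i) => xs sx; apply: ev_proj; rewrite sx. Qed.

(** Under a binder of [bsum], [bhas], [ball] or [iter] the bound variable is entry 0 and the outer
    variables are read from the [behead]. Nested binders pile up [behead]s; all environments so
    obtained are drops, hence variables compile to projections. *)
Definition suffix_env (E : seq nat -> seq nat) k := forall xs, E xs = drop k xs.

Lemma suffix_env_id : suffix_env (fun xs => xs) 0.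
Proof. by move=> xs; rewrite drop0. Qed.

Lemma suffix_env_behead E k : suffix_env E k -> suffix_env (fun xs => behead (E xs)) k.+1.
Proof. by move=> h xs; rewrite h -drop1 drop_drop. Qed.

Lemma suffix_env_comp E k : suffix_env E k -> suffix_env (fun xs => E (behead xs)) k.+1.
Proof. by move=> h xs; rewrite h -drop1 drop_drop addn1. Qed.

Lemma computable_nth n E k i :
  suffix_env E k -> k + i < n -> computable n (fun xs => nth 0 (E xs) i).
Proof.
move=> h lt; apply: (computable_ext (F := fun xs => nth 0 xs (k + i))).
  by move=> xs _; rewrite h nth_drop.
exact: computable_proj.
Qed.

Lemma computable_comp n m F (Gs : seq (seq nat -> nat)) : size Gs = m ->
  computable m F -> (forall i, i < m -> computable n (nth (fun=> 0) Gs i)) ->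
  computable n (fun xs => F [seq G xs | G <- Gs]).
Proof.
move=> sG [c hc] hG.
have [gs hgs] : exists gs, forall xs, size xs = n -> revals gs xs [seq G xs | G <- Gs].
  elim: Gs m sG hG {F c hc} => [|G Gs IH] m sG hG.
    by exists [::] => xs _; apply: evs_nil.
  case: m sG hG => // m [sG] hG.
  have [gs hgs] := IH m sG (fun i lt => hG i.+1 lt).
  have [g hg] := hG 0 isT.
  by exists (g :: gs) => xs sx; apply: evs_cons; [apply: hg | apply: hgs].
exists (RComp c gs) => xs sx; apply: ev_comp (hgs _ sx) _.
by apply: hc; rewrite size_map.
Qed.

Lemma computable_app1 n f A : computable1 f -> computable n A ->
  computable n (fun xs => f (A xs)).
Proof. by move=> hf hA; apply: (@computable_comp n 1 _ [:: A]) hf _ => // -[]. Qed.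

Lemma computable_app2 n f A B : computable2 f -> computable n A -> computable n B ->
  computable n (fun xs => f (A xs) (B xs)).
Proof.
move=> hf hA hB.
by apply: (@computable_comp n 2 _ [:: A; B]) hf _ => // -[|[]].
Qed.

Lemma computable_app3 n f A B C : computable3 f ->
  computable n A -> computable n B -> computable n C ->
  computable n (fun xs => f (A xs) (B xs) (C xs)).
Proof.
move=> hf hA hB hC.
by apply: (@computable_comp n 3 _ [:: A; B; C]) hf _ => // -[|[|[]]].
Qed.

Lemma computable_succ : computable1 succn.
Proof. by exists RSucc => -[|x [|y s]] //= _; apply: ev_succ. Qed.

Lemma computable_const n k : computable n (fun=> k).
Proof.
elim: k => [|k IH]; first by exists RZero => xs _; apply: ev_zero.
exact: computable_app1 computable_succ IH.
Qed.

Lemma computable_rec n K B S :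
  computable n K -> computable n B ->
  computable n.+2 (fun ys => S (behead (behead ys)) (nth 0 ys 0) (nth 0 ys 1)) ->
  computable n (fun xs => nat_rect (fun=> nat) (B xs) (S xs) (K xs)).
Proof.
move=> hK [b hb] [s hs].
have h : computable n.+1 (fun ys => nat_rect (fun=> nat) (B (behead ys))
    (S (behead ys)) (nth 0 ys 0)).
  exists (RRec b s) => -[|k xs] //= [sx]; elim: k => [|k IH] /=.
    by apply: ev_rec0; apply: hb.
  by apply: ev_recS IH _; apply: hs; rewrite /= sx.
have hp i : i < n.+1 ->
    computable n (nth (fun=> 0) (K :: [seq nth 0 ^~ i | i <- iota 0 n]) i).
  case: i => [|i] //= lt.
  by rewrite (nth_map 0) ?size_iota // nth_iota //; apply: computable_proj.
apply: computable_ext (computable_comp _ h hp).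
  move=> xs sx /=; set ys := map _ _; suff -> : ys = xs by [].
  rewrite /ys -map_comp -[RHS](mkseq_nth 0) sx /mkseq.
  by apply: eq_map.
by rewrite /= size_map size_iota.
Qed.

Lemma computable_iter n K f B :
  computable n K -> computable n B ->
  computable n.+1 (fun ys => f (behead ys) (nth 0 ys 0)) ->
  computable n (fun xs => iter (K xs) (f xs) (B xs)).
Proof.
move=> hK hB hf.
apply: (computable_ext (F := fun xs => nat_rect (fun=> nat) (B xs) (fun _ r => f xs r) (K xs))).
  by move=> xs _; elim: (K xs) => //= k ->.
apply: computable_rec => //.
have hp i : i < n.+1 -> computable n.+2 (nth (fun=> 0) [seq nth 0 ^~ i | i <- iota 1 n.+1] i).
  by move=> lt; rewrite (nth_map 0) ?size_iota // nth_iota //; apply: computable_proj.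
apply: computable_ext (computable_comp _ hf hp); last by rewrite size_map size_iota.
move=> xs sx; set ys := map _ _; suff -> : ys = behead xs by rewrite nth_behead.
rewrite /ys -map_comp; apply: (@eq_from_nth _ 0).
  by rewrite size_map size_iota size_behead sx.
move=> i; rewrite size_map size_iota => lt.
by rewrite (nth_map 0) ?size_iota // nth_iota // nth_behead.
Qed.

Lemma computable_add : computable2 addn.
Proof.
apply: (computable_ext (F := fun xs => iter (nth 0 xs 0) succn (nth 0 xs 1))).
  by move=> xs _; rewrite iter_succn addnC.
apply: computable_iter; try exact: computable_proj.
by apply: computable_app1 computable_succ _; apply: computable_proj.
Qed.

Lemma computable_pred : computable1 predn.
Proof.
apply: (computable_ext (F := fun xs => nat_rect (fun=> nat) 0 (fun m _ => m) (nth 0 xs 0))).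
  by move=> xs _; case: (nth 0 xs 0).
by apply: (computable_rec (B := fun=> 0) (S := fun _ m _ => m));
  rewrite ?/computable1; [exact: computable_proj | exact: computable_const | exact: computable_proj].
Qed.

Lemma computable_sub : computable2 subn.
Proof.
apply: (computable_ext (F := fun xs => iter (nth 0 xs 1) predn (nth 0 xs 0))).
  by move=> xs _; elim: (nth 0 xs 1) => [|k IH]; rewrite ?subn0 //= IH subnS.
apply: computable_iter; try exact: computable_proj.
by apply: computable_app1 computable_pred _; apply: computable_proj.
Qed.

Lemma computable_mul : computable2 muln.
Proof.
apply: (computable_ext (F := fun xs => iter (nth 0 xs 0) (addn (nth 0 xs 1)) 0)).
  by move=> xs _; rewrite iter_addn_0 mulnC.
apply: computable_iter; try exact: computable_proj; first exact: computable_const.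
apply: computable_app2 computable_add _ _; last exact: computable_proj.
by apply: (computable_nth (k := 1)) => // xs; rewrite drop1.
Qed.

Lemma computable_leq : computable2 (fun m n => m <= n : nat).
Proof.
apply: (computable_ext (F := fun xs => 1 - (nth 0 xs 0 - nth 0 xs 1))).
  by move=> xs _; rewrite /leq; case: (nth 0 xs 0 - nth 0 xs 1).
apply: computable_app2 computable_sub (computable_const _ _) _.
by apply: computable_app2 computable_sub _ _; apply: computable_proj.
Qed.

Lemma computable_neg n (P : pred (seq nat)) : computable n (fun xs => P xs : nat) ->
  computable n (fun xs => ~~ P xs : nat).
Proof.
move=> h; apply: (computable_ext (F := fun xs => 1 - P xs)).
  by move=> xs _; case: (P xs).
exact: computable_app2 computable_sub (computable_const _ _) h.
Qed.

Lemma computable_and n (P Q : pred (seq nat)) : computable n (fun xs => P xs : nat) ->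
  computable n (fun xs => Q xs : nat) -> computable n (fun xs => P xs && Q xs : nat).
Proof.
move=> hP hQ; apply: (computable_ext (F := fun xs => P xs * Q xs)).
  by move=> xs _; rewrite mulnb.
exact: computable_app2 computable_mul hP hQ.
Qed.

Lemma computable_or n (P Q : pred (seq nat)) : computable n (fun xs => P xs : nat) ->
  computable n (fun xs => Q xs : nat) -> computable n (fun xs => P xs || Q xs : nat).
Proof.
move=> hP hQ; apply: (computable_ext (F := fun xs => ~~ (~~ P xs && ~~ Q xs))).
  by move=> xs _; rewrite negb_and !negbK.
by apply: computable_neg; apply: computable_and; apply: computable_neg.
Qed.

Lemma computable_eq : computable2 (fun m n => m == n : nat).
Proof.
apply: (computable_ext (F := fun xs =>
    (nth 0 xs 0 <= nth 0 xs 1) && (nth 0 xs 1 <= nth 0 xs 0))).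
  by move=> xs _; rewrite eqn_leq.
by apply: computable_and; apply: computable_app2 computable_leq _ _;
  apply: computable_proj.
Qed.

(** A conditional with a name, which the tactic [comp] can recognise syntactically. *)
Definition ifn (b : bool) (m n : nat) := if b then m else n.

Lemma computable_if n (P : pred (seq nat)) A B : computable n (fun xs => P xs : nat) ->
  computable n A -> computable n B -> computable n (fun xs => ifn (P xs) (A xs) (B xs)).
Proof.
move=> hP hA hB.
apply: (computable_ext (F := fun xs => P xs * A xs + (~~ P xs) * B xs)).
  by move=> xs _; rewrite /ifn; case: (P xs); rewrite ?mul1n ?mul0n ?addn0.
apply: computable_app2 computable_add _ _; apply: computable_app2 computable_mul _ _ => //.
exact: computable_neg.
Qed.

Definition bsum n (f : nat -> nat) := nat_rect (fun=> nat) 0 (fun m r => r + f m) n.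
Definition bhas n (p : pred nat) := nat_rect (fun=> bool) false (fun m r => r || p m) n.
Definition ball n (p : pred nat) := nat_rect (fun=> bool) true (fun m r => r && p m) n.

Lemma bhasP n (p : pred nat) : reflect (exists2 i, i < n & p i) (bhas n p).
Proof.
elim: n => [|n IH] /=; first by right; case.
apply: (iffP orP) => [[/IH[i lt pi]|pn]|[i lt pi]]; first by exists i; rewrite // ltnW.
  by exists n.
move: lt; rewrite ltnS leq_eqVlt => /orP[/eqP ei|lt]; first by right; rewrite -ei.
by left; apply/IH; exists i.
Qed.

Lemma ballP n (p : pred nat) : reflect (forall i, i < n -> p i) (ball n p).
Proof.
elim: n => [|n IH] /=; first by left.
apply: (iffP andP) => [[/IH h pn] i|h].
  by rewrite ltnS leq_eqVlt => /orP[/eqP->|/h].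
by split; [apply/IH => i lt; apply: h; apply: ltnW | apply: h].
Qed.

Section BoundedQuantifiers.
Variables (n : nat) (K : seq nat -> nat).
Hypothesis hK : computable n K.

Let computable_skip1 (F : seq nat -> nat -> nat) :
  computable n.+1 (fun ys => F (behead ys) (nth 0 ys 0)) ->
  computable n.+2 (fun ys => F (behead (behead ys)) (nth 0 ys 0)).
Proof.
move=> hF; pose Gs := (fun ys => nth 0 ys 0) :: [seq nth 0 ^~ i | i <- iota 2 n].
have hp i : i < n.+1 -> computable n.+2 (nth (fun=> 0) Gs i).
  case: i => [|i] lt /=; first exact: computable_proj.
  by rewrite (nth_map 0) ?size_iota // nth_iota //; apply: computable_proj.
apply: computable_ext (computable_comp _ hF hp); last by rewrite /= size_map size_iota.
case=> [|x [|y ys]] //= [sx]; congr F; rewrite -map_comp -[RHS](mkseq_nth 0) sx /mkseq.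
rewrite -[2]/(0 + 2) (addnC 0) iotaDl -map_comp.
by apply: eq_map => i.
Qed.

Lemma computable_bsum f : computable n.+1 (fun ys => f (behead ys) (nth 0 ys 0)) ->
  computable n (fun xs => bsum (K xs) (f xs)).
Proof.
move=> hf; apply: (computable_rec (S := fun xs m r => r + f xs m)) => //.
  exact: computable_const.
by apply: computable_app2 computable_add _ _; [apply: computable_proj | apply: computable_skip1].
Qed.

Lemma computable_bhas (p : seq nat -> pred nat) :
  computable n.+1 (fun ys => p (behead ys) (nth 0 ys 0) : nat) ->
  computable n (fun xs => bhas (K xs) (p xs) : nat).
Proof.
move=> hp; apply: (computable_ext (F := fun xs => 0 < bsum (K xs) (fun i => p xs i))).
  move=> xs _; congr nat_of_bool; elim: (K xs) => //= k IH.
  by rewrite -IH addn_gt0; case: (p xs k).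
by apply: computable_app2 computable_leq (computable_const _ _) _; apply: computable_bsum.
Qed.

Lemma computable_ball (p : seq nat -> pred nat) :
  computable n.+1 (fun ys => p (behead ys) (nth 0 ys 0) : nat) ->
  computable n (fun xs => ball (K xs) (p xs) : nat).
Proof.
move=> hp; apply: (computable_ext (F := fun xs => ~~ bhas (K xs) (fun i => ~~ p xs i))).
  move=> xs _; congr nat_of_bool; elim: (K xs) => //= k IH.
  by rewrite negb_or IH negbK.
by apply: computable_neg; apply: computable_bhas; apply: computable_neg.
Qed.
End BoundedQuantifiers.

(* Automatic proofs of computability *)
Create HintDb compdb.
#[global] Hint Resolve computable_succ computable_add computable_pred computable_sub
  computable_mul computable_leq computable_eq : compdb.

Ltac suffix_env := first [exact: suffix_env_id
  | apply: suffix_env_behead; suffix_env | apply: suffix_env_comp; suffix_env ].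

Ltac comp := lazymatch goal with
  | |- computable1 _ => rewrite /computable1; cbv beta; comp
  | |- computable2 _ => rewrite /computable2; cbv beta; comp
  | |- computable3 _ => rewrite /computable3; cbv beta; comp
  | |- computable _ (fun _ => ?k) => apply: computable_const
  | |- computable _ (fun xs => nth 0 (@?E xs) ?i) =>
      eapply computable_nth; [suffix_env | done]
  | |- computable _ (fun xs => bsum (@?K xs) (@?f xs)) =>
      apply: (@computable_bsum _ K _ f); comp
  | |- computable _ (fun xs => iter (@?K xs) (@?f xs) (@?B xs)) =>
      apply: (computable_iter (K := K) (f := f) (B := B)); comp
  | |- computable _ (fun xs => nat_of_bool (bhas (@?K xs) (@?p xs))) =>
      apply: (@computable_bhas _ K _ p); comp
  | |- computable _ (fun xs => nat_of_bool (ball (@?K xs) (@?p xs))) =>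
      apply: (@computable_ball _ K _ p); comp
  | |- computable _ (fun xs => nat_of_bool (~~ (@?P xs))) =>
      apply: (computable_neg (P := P)); comp
  | |- computable _ (fun xs => nat_of_bool (@?P xs && @?Q xs)) =>
      apply: (computable_and (P := P) (Q := Q)); comp
  | |- computable _ (fun xs => nat_of_bool (@?P xs || @?Q xs)) =>
      apply: (computable_or (P := P) (Q := Q)); comp
  | |- computable _ (fun xs => ifn (@?P xs) (@?A xs) (@?B xs)) =>
      apply: (computable_if (P := P) (A := A) (B := B)); comp
  | |- computable _ (fun xs => nat_of_bool (@?A xs == @?B xs)) =>
      apply: (@computable_app2 _ (fun a b => nat_of_bool (a == b)) A B computable_eq); comp
  | |- computable _ (fun xs => nat_of_bool (?f (@?A xs) (@?B xs) (@?C xs))) =>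
      apply: (@computable_app3 _ (fun a b c => nat_of_bool (f a b c)) A B C); [solve [eauto with compdb] | comp ..]
  | |- computable _ (fun xs => nat_of_bool (?f (@?A xs) (@?B xs))) =>
      apply: (@computable_app2 _ (fun a b => nat_of_bool (f a b)) A B); [solve [eauto with compdb] | comp ..]
  | |- computable _ (fun xs => nat_of_bool (?f (@?A xs))) =>
      apply: (@computable_app1 _ (fun a => nat_of_bool (f a)) A); [solve [eauto with compdb] | comp ]
  | |- computable _ (fun xs => ?f (@?A xs) (@?B xs) (@?C xs)) =>
      apply: (@computable_app3 _ f A B C); [solve [eauto with compdb] | comp ..]
  | |- computable _ (fun xs => ?f (@?A xs) (@?B xs)) =>
      apply: (@computable_app2 _ f A B); [solve [eauto with compdb] | comp ..]
  | |- computable _ (fun xs => ?f (@?A xs)) =>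
      apply: (@computable_app1 _ f A); [solve [eauto with compdb] | comp ]
  end.

Lemma computable_odd : computable1 (fun n => odd n : nat).
Proof.
apply: (computable_ext (F := fun xs => iter (nth 0 xs 0) (fun b => 1 - b) 0)).
  by move=> xs _; elim: (nth 0 xs 0) => //= k ->; case: (odd k).
comp.
Qed.

Lemma computable_exp : computable2 expn.
Proof.
apply: (computable_ext (F := fun xs => iter (nth 0 xs 1) (muln (nth 0 xs 0)) 1)).
  by move=> xs _; elim: (nth 0 xs 1) => //= k ->; rewrite expnS.
comp.
Qed.

(** Division, 2-adic valuation and the length of a coded sequence are computed by counting the
    indices below the sought value; a bound [k] on that value makes the count exact. *)
Lemma bsum_lt k q : bsum k (fun i => i < q) = minn k q.
Proof.
by elim: k => [|k /= ->]; [rewrite min0n | case: (ltnP k q) => /=; lia].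
Qed.

Lemma computable_div : computable2 divn.
Proof.
apply: (computable_ext (F := fun xs => ifn (nth 0 xs 1 == 0) 0
    (bsum (nth 0 xs 0) (fun i => i.+1 * nth 0 xs 1 <= nth 0 xs 0)))).
  move=> xs _; rewrite /ifn; case: eqP => [->|/eqP]; first by rewrite divn0.
  rewrite -lt0n; set m := nth 0 xs 0; move: (nth 0 xs 1) => d d0.
  rewrite -[RHS](minn_idPr (leq_div m d)) -bsum_lt.
  by elim: {1 3}m => //= k ->; rewrite leq_divRL.
comp.
Qed.

#[global] Hint Resolve computable_odd computable_exp computable_div : compdb.

(** * Computing with coded sequences *)

Notation code := CodeSeq.code.
(** List operations on the codes behind [pickle]: 0 is the empty list, the head of a nonempty one is
    its 2-adic valuation. On 0 both [chd] and [ctl] return 0, in agreement with [nth 0] and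
    [behead]. *)
Definition ccons x m := 2 ^ x * (2 * m).+1.
Definition chd n := logn 2 n.
Definition ctl n := n %/ 2 ^ chd n %/ 2.
Definition cdrop i n := iter i ctl n.
Definition cnth n i := chd (cdrop i n).
Definition csize n := bsum n (fun i => cdrop i n != 0).
Arguments ccons : simpl never.
Arguments chd : simpl never.
Arguments ctl : simpl never.
Arguments cdrop : simpl never.
Arguments cnth : simpl never.
Arguments csize : simpl never.

Lemma code_cons x s : code (x :: s) = ccons x (code s).
Proof. by rewrite /= /ccons mul2n. Qed.

Lemma chd_ccons x m : chd (ccons x m) = x.
Proof.
rewrite /chd /ccons lognM ?expn_gt0 // pfactorK // (@lognE 2 _.+1) /=.
by rewrite dvdn2 /= mul2n odd_double addn0.
Qed.

Lemma ctl_ccons x m : ctl (ccons x m) = m.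
Proof.
by rewrite /ctl chd_ccons /ccons mulKn ?expn_gt0 // -addn1 mulnC divnMDl // addn0.
Qed.

Lemma cdrop_code s i : cdrop i (code s) = code (drop i s).
Proof.
elim: i s => [|i IH] s; first by rewrite drop0.
rewrite /cdrop iterSr; case: s => [|x s]; last by rewrite code_cons ctl_ccons; apply: IH.
by have /= := IH [::].
Qed.

Lemma cnth_code s i : cnth (code s) i = nth 0 s i.
Proof.
rewrite /cnth cdrop_code -[in RHS](addn0 i) -nth_drop; case: (drop i s) => // x t.
by rewrite code_cons chd_ccons.
Qed.

Lemma code_eq0 s : (code s == 0) = (s == [::]).
Proof. by case: s => //= x s; rewrite muln_eq0 expn_eq0. Qed.

Lemma size_leq_code s : size s <= code s.
Proof.
elim: s => //= x s IH; apply: leq_trans (leq_pmull _ _); last by rewrite expn_gt0.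
by rewrite ltnS -addnn (leq_trans IH) ?leq_addr.
Qed.

Lemma csize_code s : csize (code s) = size s.
Proof.
rewrite /csize -[RHS](minn_idPr (size_leq_code s)) -bsum_lt.
elim: {1 3}(code s) => //= k ->; rewrite cdrop_code code_eq0.
by rewrite -size_eq0 size_drop subn_eq0 -ltnNge.
Qed.

Lemma code_surj n : exists s, n = code s.
Proof. by exists (CodeSeq.decode n); rewrite CodeSeq.decodeK. Qed.

Lemma code_inj : injective code.
Proof. exact: can_inj CodeSeq.codeK. Qed.

Lemma computable_ccons : computable2 ccons.
Proof. rewrite /ccons; comp. Qed.

Lemma computable_chd : computable1 chd.
Proof.
apply: (computable_ext (F := fun xs => bsum (nth 0 xs 0)
   (fun e => nth 0 xs 0 %/ 2 ^ e.+1 * 2 ^ e.+1 == nth 0 xs 0))).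
  move=> xs _; move: (nth 0 xs 0) => [|n]; first by rewrite /chd logn0.
  have le : chd n.+1 <= n.+1.
    rewrite /chd; have := dvdn_leq _ (pfactor_dvdnn 2 n.+1) => /(_ isT) h.
    exact: leq_trans (ltnW (ltn_expl _ _)) h.
  suff h k : bsum k (fun e => n.+1 %/ 2 ^ e.+1 * 2 ^ e.+1 == n.+1) = bsum k (fun i => i < chd n.+1).
    by rewrite h bsum_lt; apply/minn_idPr.
  elim: k => // k; rewrite /bsum /= => ->.
  by congr (_ + nat_of_bool _); rewrite -dvdn_eq pfactor_dvdn.
comp.
Qed.
#[global] Hint Resolve computable_ccons computable_chd : compdb.

Lemma computable_ctl : computable1 ctl.
Proof. rewrite /ctl; comp. Qed.
#[global] Hint Resolve computable_ctl : compdb.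

Lemma computable_cdrop : computable2 cdrop.
Proof. rewrite /cdrop; comp. Qed.
#[global] Hint Resolve computable_cdrop : compdb.

Lemma computable_cnth : computable2 cnth.
Proof. rewrite /cnth; comp. Qed.

Lemma computable_csize : computable1 csize.
Proof. rewrite /csize; comp. Qed.
#[global] Hint Resolve computable_cnth computable_csize : compdb.

(** * Induction on evaluations, and their determinism *)

Section RevalInd.
Variable P : rcode -> seq nat -> nat -> Prop.
Variable Ps : seq rcode -> seq nat -> seq nat -> Prop.
Hypothesis Pzero : forall xs, P RZero xs 0.
Hypothesis Psucc : forall x xs, P RSucc (x :: xs) x.+1.
Hypothesis Pproj : forall i xs, i < size xs -> P (RProj i) xs (nth 0 xs i).
Hypothesis Pcomp : forall f gs xs ys y, revals gs xs ys -> Ps gs xs ys -> reval f ys y ->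
  P f ys y -> P (RComp f gs) xs y.
Hypothesis Prec0 : forall f g xs y, reval f xs y -> P f xs y -> P (RRec f g) (0 :: xs) y.
Hypothesis PrecS : forall f g n xs r y,
  reval (RRec f g) (n :: xs) r -> P (RRec f g) (n :: xs) r ->
  reval g (n :: r :: xs) y -> P g (n :: r :: xs) y -> P (RRec f g) (n.+1 :: xs) y.
Hypothesis Pmu : forall f xs n, reval f (n :: xs) 0 -> P f (n :: xs) 0 ->
  (forall m, m < n -> exists r, [/\ reval f (m :: xs) r, P f (m :: xs) r & r <> 0]) ->
  P (RMu f) xs n.
Hypothesis Pnil : forall xs, Ps [::] xs [::].
Hypothesis Pcons : forall g gs xs y ys, reval g xs y -> P g xs y ->
  revals gs xs ys -> Ps gs xs ys -> Ps (g :: gs) xs (y :: ys).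

(* The automatically generated principle has no induction hypothesis below
   the existential of [ev_mu]. *)
Fixpoint reval_nested_ind c xs y (h : reval c xs y) : P c xs y :=
  match h with
  | ev_zero xs => Pzero xs
  | ev_succ x xs => Psucc x xs
  | ev_proj i xs lt => Pproj lt
  | ev_comp f gs xs ys y h1 h2 =>
      Pcomp h1 (revals_nested_ind h1) h2 (reval_nested_ind h2)
  | ev_rec0 f g xs y h1 => Prec0 g h1 (reval_nested_ind h1)
  | ev_recS f g n xs r y h1 h2 =>
      PrecS h1 (reval_nested_ind h1) h2 (reval_nested_ind h2)
  | ev_mu f xs n h1 h2 => Pmu h1 (reval_nested_ind h1) (fun m lt =>
      match h2 m lt with
      | ex_intro2 r h3 h4 => ex_intro _ r (And3 h3 (reval_nested_ind h3) h4)
      end)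
  end
with revals_nested_ind gs xs ys (h : revals gs xs ys) : Ps gs xs ys :=
  match h with
  | evs_nil xs => Pnil xs
  | evs_cons g gs xs y ys h1 h2 =>
      Pcons h1 (reval_nested_ind h1) h2 (revals_nested_ind h2)
  end.
End RevalInd.

Lemma reval_det c xs y y' : reval c xs y -> reval c xs y' -> y = y'.
Proof.
move=> h; move: c xs y h y'.
apply: (reval_nested_ind (P := fun c xs y => forall y', reval c xs y' -> y = y')
  (Ps := fun gs xs ys => forall ys', revals gs xs ys' -> ys = ys')).
- by move=> xs y' h; inversion h.
- by move=> x xs y' h; inversion h.
- by move=> i xs lt y' h; inversion h.
- move=> f gs xs ys y _ IHs _ IH y' h; inversion_clear h as [| | |? ? ? ys' ? h1 h2| | |].
  by apply: IH; rewrite (IHs _ h1).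
- move=> f g xs y _ IH y' h; inversion_clear h as [| | | |? ? ? ? h1| |].
  exact: IH.
- move=> f g n xs r y _ IHr _ IH y' h.
  inversion_clear h as [| | | | |? ? ? ? r' ? h1 h2|].
  by apply: IH; rewrite (IHr _ h1).
- move=> f xs n _ IH0 IHm n' h; inversion_clear h as [| | | | | |? ? ? h1 h2].
  case: (ltngtP n n') => // lt; first by have [r /IH0 <-] := h2 _ lt.
  by have [r [_ /(_ _ h1)]] := IHm _ lt.
- by move=> xs ys h; inversion h.
- move=> g gs xs y ys _ IH _ IHs ys' h; inversion_clear h as [|? ? ? ? ? h1 h2].
  by rewrite (IH _ h1) (IHs _ h2).
Qed.

(** * A recursively enumerable set without decision procedure *)

Fixpoint enc (c : rcode) : nat :=
  match c with
  | RZero => code [:: 0]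
  | RSucc => code [:: 1]
  | RProj i => code [:: 2; i]
  | RComp f gs => code (3 :: enc f :: map enc gs)
  | RRec f g => code [:: 4; enc f; enc g]
  | RMu f => code [:: 5; enc f]
  end.

Definition judg c xs y := code (enc c :: y :: xs).

(** Evaluation with its recursion cut open: one rule is applied, and its premises are only required
    to lie in [S]. With the earlier entries of a list for [S], evaluations become finite
    certificates. *)
Inductive just (S : nat -> Prop) : rcode -> seq nat -> nat -> Prop :=
  | just_zero xs : just S RZero xs 0
  | just_succ x xs : just S RSucc (x :: xs) x.+1
  | just_proj i xs : i < size xs -> just S (RProj i) xs (nth 0 xs i)
  | just_comp f gs xs ys y : S (judg f ys y) -> size ys = size gs ->
      (forall b, b < size gs -> S (judg (nth RZero gs b) xs (nth 0 ys b))) ->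
      just S (RComp f gs) xs y
  | just_rec0 f g xs y : S (judg f xs y) -> just S (RRec f g) (0 :: xs) y
  | just_recS f g n xs r y : S (judg (RRec f g) (n :: xs) r) ->
      S (judg g (n :: r :: xs) y) -> just S (RRec f g) (n.+1 :: xs) y
  | just_mu f xs n : S (judg f (n :: xs) 0) ->
      (forall m, m < n -> exists2 r, S (judg f (m :: xs) r) & r != 0) ->
      just S (RMu f) xs n.

Lemma just_mono (S S' : nat -> Prop) c xs y : (forall j, S j -> S' j) -> just S c xs y -> just S' c xs y.
Proof.
move=> SS' [].
- by constructor.
- by constructor.
- by constructor.
- by move=> f gs xs' ys y' h sy h'; apply: just_comp sy _ => [|b lt]; apply: SS'; [|apply: h'].
- by move=> f g xs' y' h; apply: just_rec0; apply: SS'.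
- by move=> f g n xs' r y' h h'; apply: (@just_recS _ f g n xs' r); apply: SS'.
move=> f xs' n h h'; apply: just_mu => [|m /h'[r hr r0]]; first exact: SS'.
by exists r => //; apply: SS'.
Qed.

Lemma just_reval (S : nat -> Prop) c xs y : just S c xs y ->
  (forall c xs y, S (judg c xs y) -> reval c xs y) -> reval c xs y.
Proof.
case=> [*|*|*|f gs xs' ys y' h sy h' SR|f g xs' y' h SR|f g n xs' r y' h h' SR|f xs' n h h' SR].
- exact: ev_zero.
- exact: ev_succ.
- exact: ev_proj.
- apply: ev_comp (SR _ _ _ h); elim: gs ys sy h' {h} => [|g gs IH] [|z ys] //= => [_ _|[sy] h'].
    exact: evs_nil.
  by apply: evs_cons; [apply: SR; apply: (h' 0) | apply: IH => // b; apply: (h' b.+1)].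
- by apply: ev_rec0; apply: SR.
- by apply: (ev_recS (SR _ _ _ h)); apply: SR.
apply: ev_mu => [|m /h'[r hr r0]]; first exact: SR.
by exists r; [apply: SR | apply/eqP].
Qed.

Definition derivation (T : seq nat) := forall i, i < size T ->
  exists c xs y, nth 0 T i = judg c xs y /\ just (fun j => j \in take i T) c xs y.

Lemma derivation_rcons T c xs y : derivation T -> just (fun j => j \in T) c xs y ->
  derivation (rcons T (judg c xs y)).
Proof.
move=> dT h i; rewrite size_rcons ltnS leq_eqVlt => /orP[/eqP->|lt].
  exists c, xs, y; rewrite nth_rcons ltnn eqxx; split=> //.
  by rewrite -cats1 take_size_cat.
have [c' [xs' [y' [e h']]]] := dT _ lt; exists c', xs', y'.
by rewrite nth_rcons lt -cats1 takel_cat // ltnW.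
Qed.

(** Quantifying over all starting derivations, not just the empty one, makes the notion composable:
    the premises of a rule are appended one after another. *)
Definition derives (S : nat -> Prop) := forall T, derivation T ->
  exists T', derivation (T ++ T') /\ forall j, S j -> j \in T ++ T'.

Lemma derives0 (S : nat -> Prop) : (forall j, ~ S j) -> derives S.
Proof. by move=> h T dT; exists [::]; rewrite cats0; split => // j /h. Qed.

Lemma derivesU (S S' : nat -> Prop) : derives S -> derives S' -> derives (fun j => S j \/ S' j).
Proof.
move=> dS dS' T /dS[T1 [d1 h1]]; have [T2 [d2 h2]] := dS' _ d1.
exists (T1 ++ T2); rewrite catA; split=> // j [/h1|/h2 //].
by rewrite [in X in _ -> X]mem_cat => ->.
Qed.

Lemma derives_just (S : nat -> Prop) c xs y : derives S -> just S c xs y ->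
  derives (eq (judg c xs y)).
Proof.
move=> dS h T dT; have [T' [dT' hS]] := dS _ dT.
exists (rcons T' (judg c xs y)); rewrite -rcons_cat; split.
  by apply: derivation_rcons => //; apply: just_mono h.
by move=> _ <-; rewrite mem_rcons inE eqxx.
Qed.

(** The minimisation rule has one premise for each [m < n], each with a value of its own; finitely
    many such premises are gathered here into one set. *)
Lemma derives_bounded n (R : nat -> nat -> Prop) :
  (forall m, m < n -> exists2 j, derives (eq j) & R m j) ->
  exists2 S : nat -> Prop, derives S & forall m, m < n -> exists2 j, S j & R m j.
Proof.
elim: n => [_|n IH h]; first by exists (fun=> False) => //; apply: derives0 => j [].
have [S dS hS] := IH (fun m lt => h m (ltnW lt)); have [j dj Rj] := h n (leqnn _).
exists (fun j' => S j' \/ j = j'); first exact: derivesU.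
move=> m; rewrite ltnS leq_eqVlt => /orP[/eqP->|/hS[j' Sj' Rj']].
  by exists j => //; right.
by exists j' => //; left.
Qed.

Lemma reval_derives c xs y : reval c xs y -> derives (eq (judg c xs y)).
Proof.
move: c xs y; apply: (reval_nested_ind (P := fun c xs y => derives (eq (judg c xs y)))
  (Ps := fun gs xs ys => size ys = size gs /\ forall b, b < size gs ->
     derives (eq (judg (nth RZero gs b) xs (nth 0 ys b))))).
- move=> xs; apply: (@derives_just (fun=> False)); first by apply: derives0 => j [].
  exact: just_zero.
- move=> x xs; apply: (@derives_just (fun=> False)); first by apply: derives0 => j [].
  exact: just_succ.
- move=> i xs lt; apply: (@derives_just (fun=> False)); first by apply: derives0 => j [].
  exact: just_proj.
- move=> f gs xs ys y _ [sy dgs] _ df.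
  have [|S dS hS] := @derives_bounded (size gs)
    (fun b j => j = judg (nth RZero gs b) xs (nth 0 ys b)).
    by move=> b lt; exists (judg (nth RZero gs b) xs (nth 0 ys b)) => //; apply: dgs.
  apply: derives_just (derivesU df dS) _.
  by apply: just_comp sy _ => [|b /hS[j Sj ej]]; [left | right; rewrite -ej].
- move=> f g xs y _ d; apply: derives_just d _; exact: just_rec0.
- move=> f g n xs r y _ d _ d'; apply: derives_just (derivesU d d') _.
  by apply: just_recS; [left | right].
- move=> f xs n _ d h.
  have [|S dS hS] := @derives_bounded n
    (fun m j => exists2 r, j = judg f (m :: xs) r & r != 0).
    move=> m /h[r [_ dr /eqP r0]]; exists (judg f (m :: xs) r) => //.
    by exists r.
  apply: derives_just (derivesU d dS) _; apply: just_mu; first by left.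
  by move=> m /hS[j Sj [r ej r0]]; exists r => //; right; rewrite -ej.
- by [].
- move=> g gs xs y ys _ d _ [sy IH]; split; first by rewrite /= sy.
  by case=> [|b] //= lt; apply: IH.
Qed.

(** * A computable test for derivations *)

Section Checker.
Variables (T i p y m : nat).

(** A judgment is split into the program code [p], the value [y] and the argument code [m].
    Intermediate results of a rule are read off an earlier entry of [T], where [cdrop 2] gives the
    arguments and [cnth _ 1] the value. So the existentials of the rules become searches over
    positions below [i]. *)
Definition check_zero := (chd p == 0) && (y == 0).
Definition check_succ := (chd p == 1) && (m != 0) && (y == (chd m).+1).
Definition check_proj := (chd p == 2) && (cnth p 1 < csize m) && (y == cnth m (cnth p 1)).
Definition check_comp := (chd p == 3) && bhas i (fun a =>
  (cnth T a == ccons (cnth p 1) (ccons y (cdrop 2 (cnth T a)))) &&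
  (csize (cdrop 2 (cnth T a)) == csize (cdrop 2 p)) &&
  ball (csize (cdrop 2 p)) (fun b => bhas i (fun a' =>
    cnth T a' == ccons (cnth p b.+2) (ccons (cnth (cnth T a) b.+2) m)))).
Definition check_rec0 := (chd p == 4) && (m != 0) && (chd m == 0) &&
  bhas i (fun a => cnth T a == ccons (cnth p 1) (ccons y (ctl m))).
Definition check_recS := (chd p == 4) && (m != 0) && (chd m != 0) && bhas i (fun a =>
  (cnth T a == ccons p (ccons (cnth (cnth T a) 1) (ccons (chd m).-1 (ctl m)))) &&
  bhas i (fun a' => cnth T a' ==
    ccons (cnth p 2) (ccons y (ccons (chd m).-1 (ccons (cnth (cnth T a) 1) (ctl m)))))).
Definition check_mu := (chd p == 5) &&
  bhas i (fun a => cnth T a == ccons (cnth p 1) (ccons 0 (ccons y m))) &&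
  ball y (fun k => bhas i (fun a => (cnth (cnth T a) 1 != 0) &&
    (cnth T a == ccons (cnth p 1) (ccons (cnth (cnth T a) 1) (ccons k m))))).
End Checker.

Definition check_rule T i p y m := check_zero p y || (check_succ p y m || (check_proj p y m ||
  (check_comp T i p y m || (check_rec0 T i p y m || (check_recS T i p y m || check_mu T i p y m))))).

Definition check T i :=
  check_rule T i (chd (cnth T i)) (cnth (cnth T i) 1) (cdrop 2 (cnth T i)).

(** The judgment looked for says that the program with code [n], applied to [n] itself, returns
    0. *)
Definition halts n T := bhas (csize T) (fun a => cnth T a == ccons n (ccons 0 (ccons n 0)))
  && ball (csize T) (check T).

Lemma computable_check : computable2 (fun T i => check T i : nat).
Proof.
rewrite /check /check_rule /check_zero /check_succ /check_proj /check_comp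
  /check_rec0 /check_recS /check_mu.
comp.
Qed.
#[global] Hint Resolve computable_check : compdb.

Lemma computable_halts : computable2 (fun n T => halts n T : nat).
Proof. rewrite /halts; comp. Qed.

Definition entry T i j := exists2 a, a < i & cnth T a = j.

Lemma entryP T i j : reflect (entry T i j) (bhas i (fun a => cnth T a == j)).
Proof. by apply: (iffP (bhasP _ _)) => -[a lt /eqP e]; exists a => //; apply/eqP. Qed.

Lemma chd_code s : chd (code s) = nth 0 s 0.
Proof. exact: cnth_code s 0. Qed.

Lemma ctl_code s : ctl (code s) = code (behead s).
Proof. by rewrite -drop1 -cdrop_code. Qed.

Lemma judgE c xs y : judg c xs y = ccons (enc c) (ccons y (code xs)).
Proof. by rewrite -!code_cons. Qed.

Arguments CodeSeq.code : simpl never.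
Arguments enc : simpl nomatch.


(** The tag at the head of the program code refutes all disjuncts but one, or but two for [RRec],
    and these are told apart by the first argument being zero or a successor. *)
Lemma check_rule_just T i c xs y :
  check_rule T i (enc c) y (code xs) <-> just (entry T i) c xs y.
Proof.
rewrite /check_rule /check_zero /check_succ /check_proj /check_comp
  /check_rec0 /check_recS /check_mu code_eq0.
have tag l : chd (code l) = nth 0 l 0 := chd_code l.
case: c => [||k|f gs|f g|f].
- rewrite (tag [:: 0]) /= ?orbF; split=> [/eqP->|h]; first exact: just_zero.
  by inversion h.
- rewrite (tag [:: 1]) /= ?orbF; split=> [|h]; last by inversion h; rewrite chd_code /=.
  by case: xs => //= x xs; rewrite chd_code => /eqP->; apply: just_succ.
- rewrite (tag [:: 2; k]) /= ?orbF (cnth_code [:: 2; k]) csize_code cnth_code.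
  split=> [/andP[lt /eqP->]|h]; first exact: just_proj.
  by inversion h; rewrite H0 /=.
- set p := enc _; have p0 : chd p = 3 := chd_code (3 :: enc f :: map enc gs).
  have p1 : cnth p 1 = enc f := cnth_code (3 :: enc f :: map enc gs) 1.
  have p2 : cdrop 2 p = code (map enc gs).
    by have := cdrop_code (3 :: enc f :: map enc gs) 2; rewrite /= drop0.
  have pn b : b < size gs -> cnth p b.+2 = enc (nth RZero gs b).
    by move=> lt; have := cnth_code (3 :: enc f :: map enc gs) b.+2; rewrite /= (nth_map RZero).
  clearbody p; rewrite p0 /= ?orbF p1 p2 (csize_code (map enc gs)) size_map; split.
    case/bhasP => a lt /andP[/andP[/eqP ea /eqP sa] /ballP h].
    have [ys eys] := code_surj (cdrop 2 (cnth T a)).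
    rewrite eys csize_code in ea sa; apply: (just_comp (ys := ys)) => //.
      by exists a => //; rewrite ea judgE.
    move=> b lb; have /entryP[a' lt' e'] := h b lb; exists a' => //.
    rewrite e' pn // judgE ea -!code_cons (cnth_code _ b.+2).
    by [].
  move=> h; inversion h as [| | |f' gs' xs' ys y' [a lt ea] sy hb| | |]; subst.
  apply/bhasP; exists a => //.
  have d2 : cdrop 2 (cnth T a) = code ys by rewrite ea cdrop_code /= drop0.
  rewrite d2 csize_code sy eqxx ea -judgE eqxx /=.
  apply/ballP => b lb; apply/entryP; have [a' lt' e'] := hb b lb.
  exists a' => //; rewrite e' pn // judgE (cnth_code _ b.+2).
  by [].
- set p := enc _; have p0 : chd p = 4 := chd_code [:: 4; enc f; enc g].
  have p1 : cnth p 1 = enc f := cnth_code [:: 4; enc f; enc g] 1.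
  have p2 : cnth p 2 = enc g := cnth_code [:: 4; enc f; enc g] 2.
  rewrite p0 /= ?orbF p1 p2; case: xs => [|[|n] xs] /=.
  + by split=> // h; inversion h.
  + rewrite chd_code ctl_code /= orbF -judgE; split=> [/entryP|h]; first exact: just_rec0.
    by apply/entryP; inversion h.
  rewrite chd_code ctl_code /=; split.
    case/bhasP => a lt /andP[/eqP ea /entryP e2].
    apply: (@just_recS _ f g n xs (cnth (cnth T a) 1)).
      by exists a => //; rewrite {1}ea judgE code_cons.
    by move: e2; rewrite -!code_cons.
  move=> h; inversion h as [| | | | |f' g' n' xs' r y' [a lt ea] e2|]; subst.
  apply/bhasP; exists a => //.
  have -> : cnth (cnth T a) 1 = r by rewrite ea cnth_code.
  by rewrite ea judgE code_cons eqxx /=; apply/entryP; move: e2; rewrite judgE !code_cons.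
- set p := enc _; have p0 : chd p = 5 := chd_code [:: 5; enc f].
  have p1 : cnth p 1 = enc f := cnth_code [:: 5; enc f] 1.
  rewrite p0 /= p1; split.
    case/andP => /entryP h1 /ballP h2; apply: just_mu; first by rewrite judgE code_cons.
    move=> k /h2 /bhasP[a lt /andP[r0 /eqP ea]]; exists (cnth (cnth T a) 1) => //.
    by exists a => //; rewrite {1}ea judgE code_cons.
  move=> h; inversion h as [| | | | | |f' xs' n h1 h2]; subst.
  apply/andP; split; first by apply/entryP; move: h1; rewrite judgE code_cons.
  apply/ballP => k /h2[r [a lt ea] r0]; apply/bhasP; exists a => //.
  have -> : cnth (cnth T a) 1 = r by rewrite ea cnth_code.
  by rewrite r0 ea judgE code_cons eqxx.
Qed.

Lemma check_just T i c xs y : cnth T i = judg c xs y ->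
  check T i <-> just (entry T i) c xs y.
Proof.
move=> e; rewrite -check_rule_just /check e chd_code cnth_code cdrop_code /=.
by rewrite drop0.
Qed.

Lemma halts_reval c T : halts (enc c) T -> reval c [:: enc c] 0.
Proof.
case/andP => /entryP[a lt e] /ballP h.
have {}e : cnth T a = judg c [:: enc c] 0 by rewrite e judgE code_cons.
(* Premises sit at smaller positions, hence the induction on the position, for all judgments at
   once. *)
move: c [:: enc c] 0 lt e; elim/ltn_ind: a => a IH c xs y lt e.
apply: just_reval (proj1 (check_just e) (h _ lt)) _ => c' xs' y' [a' lt' e'].
by apply: IH e' => //; apply: ltn_trans lt.
Qed.

Lemma reval_halts c : reval c [:: enc c] 0 -> exists T, halts (enc c) T.
Proof.
move=> /reval_derives/(_ [::])[]// T [/= dT /(_ _ erefl) jT].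
exists (code T); apply/andP; rewrite csize_code; split.
  apply/bhasP; exists (index (judg c [:: enc c] 0) T); first by rewrite index_mem.
  by rewrite cnth_code nth_index // judgE code_cons.
apply/ballP => i lt; have [c' [xs' [y' [e h]]]] := dT i lt.
apply/(check_just (c := c') (xs := xs') (y := y')); first by rewrite cnth_code.
apply: just_mono h => j /(nthP 0)[a]; rewrite size_take lt => la <-.
by exists a => //; rewrite cnth_code nth_take.
Qed.

(** Diagonal argument: on its own code, [c] returns 0 iff some [T] certifies this, and precisely
    then a decision procedure would have to return 1. *)
Theorem halting_undecidable c :
  ~ forall n, ((exists T, halts n T) /\ reval c [:: n] 1) \/
              (~ (exists T, halts n T) /\ reval c [:: n] 0).
Proof.
move=> /(_ (enc c)) [[[T /halts_reval h0] h1]|[nh /reval_halts//]].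
by have := reval_det h0 h1.
Qed.

(** * Unambiguous grammars from deterministic rules *)

Section TreeInd.
Variables (m k : nat) (P : ptree m k -> Prop).
Hypothesis Pleaf : forall a, P (PLeaf a).
Hypothesis Pnode : forall A ts, foldr (fun t Q => P t /\ Q) True ts -> P (PNode A ts).

Fixpoint ptree_nested_ind t : P t :=
  match t with
  | PLeaf a => Pleaf a
  | PNode A ts => Pnode A
      ((fix go ts : foldr (fun t Q => P t /\ Q) True ts :=
          match ts with
          | [::] => I
          | t :: ts => conj (ptree_nested_ind t) (go ts)
          end) ts)
  end.
End TreeInd.

Lemma pyield_node m k A (ts : seq (ptree m k)) :
  pyield (PNode A ts) = flatten (map (@pyield m k) ts).
Proof. by rewrite /=; elim: ts => //= t ts ->. Qed.

Lemma pvalid_node m k R A (ts : seq (ptree m k)) :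
  pvalid R (PNode A ts) = ((A, map (@proot m k) ts) \in R) && all (pvalid R) ts.
Proof. by rewrite /=; congr (_ && _); elim: ts => //= t ts ->. Qed.

Fixpoint matches X Y (P : X -> Y -> Prop) (rhs : seq X) (ws : seq Y) : Prop :=
  match rhs, ws with
  | [::], [::] => True
  | x :: rhs, w :: ws => P x w /\ matches P rhs ws
  | _, _ => False
  end.

Section Grammar.
Variables (N S : finType) (start : N) (rules : seq (N * seq (N + S))).
Variable L : N -> seq S -> Prop.

Definition symL (x : N + S) (w : seq S) : Prop :=
  match x with inl A => L A w | inr a => w = [:: a] end.

Hypothesis rule_sound : forall A rhs ws,
  (A, rhs) \in rules -> matches symL rhs ws -> L A (flatten ws).
(** Ambiguity is excluded on the level of languages: [L] is the intended language of each
    nonterminal, and a word is cut in at most one way, by at most one rule, into words of the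
    languages of the symbols. *)
Hypothesis rule_det : forall A rhs1 rhs2 ws1 ws2,
  (A, rhs1) \in rules -> (A, rhs2) \in rules ->
  matches symL rhs1 ws1 -> matches symL rhs2 ws2 ->
  flatten ws1 = flatten ws2 -> rhs1 = rhs2 /\ ws1 = ws2.

Local Notation m := #|{: N}|.
Local Notation k := #|{: S}|.

Definition rank_sym (x : N + S) : 'I_m + 'I_k :=
  match x with inl A => inl (enum_rank A) | inr a => inr (enum_rank a) end.
Definition val_sym (x : 'I_m + 'I_k) : N + S :=
  match x with inl A => inl (enum_val A) | inr a => inr (enum_val a) end.

Lemma rank_symK : cancel rank_sym val_sym.
Proof. by case=> x /=; rewrite enum_rankK. Qed.
Lemma val_symK : cancel val_sym rank_sym.
Proof. by case=> x /=; rewrite enum_valK. Qed.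

Definition rank_rule (r : N * seq (N + S)) := (enum_rank r.1, map rank_sym r.2).
Definition grammar : cfg m k := CFG (enum_rank start) (map rank_rule rules).

Lemma mem_rank_rules A rhs :
  ((A, rhs) \in map rank_rule rules) = ((enum_val A, map val_sym rhs) \in rules).
Proof.
have inj : injective rank_rule.
  by move=> [A1 r1] [A2 r2] [/enum_rank_inj-> /(inj_map (can_inj rank_symK))->].
rewrite -(mem_map inj) /rank_rule /= enum_valK -map_comp (eq_map (g := id)) ?map_id //.
exact: val_symK.
Qed.

Definition tree_of (x : N + S) (w : seq S) := exists t : ptree m k,
  [/\ proot t = rank_sym x, pvalid (cfg_rules grammar) t & pyield t = map enum_rank w].

Lemma tree_of_letter a : tree_of (inr a) [:: a].
Proof. by exists (PLeaf (enum_rank a)). Qed.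

Lemma tree_of_rule A rhs ws : (A, rhs) \in rules -> matches tree_of rhs ws ->
  tree_of (inl A) (flatten ws).
Proof.
move=> hr hm.
have [ts [e1 e2 e3]] : exists ts : seq (ptree m k),
    [/\ map (@proot m k) ts = map rank_sym rhs, all (pvalid (cfg_rules grammar)) ts &
        flatten (map (@pyield m k) ts) = map enum_rank (flatten ws)].
  elim: rhs ws hm {hr} => [|x rhs IH] [|w ws] //=; first by exists [::].
  case=> -[t [e1 e2 e3]] /IH[ts [h1 h2 h3]]; exists (t :: ts) => /=.
  by rewrite e1 h1 e2 h2 e3 h3 map_cat.
exists (PNode (enum_rank A) ts); split; rewrite ?pyield_node //.
by rewrite pvalid_node e1 e2 andbT mem_rank_rules enum_rankK (mapK rank_symK).
Qed.

Lemma tree_sound t : pvalid (cfg_rules grammar) t ->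
  symL (val_sym (proot t)) (map enum_val (pyield t)).
Proof.
elim/ptree_nested_ind: t => [a _ //|A ts IH]; rewrite pvalid_node pyield_node.
case/andP; rewrite mem_rank_rules => hr hv /=.
rewrite map_flatten; apply: rule_sound hr _.
elim: ts IH hv => //= t ts IH [h1 /IH h2] /andP[/h1 v1 /h2 v2].
by split.
Qed.

(** By soundness the yields of the children lie in the languages of their roots, so [rule_det]
    forces two trees with the same yield to use the same rule and the same cuts; the children then
    agree by induction. *)
Lemma grammar_unambiguous : cfg_unambiguous grammar.
Proof.
suff uniq_tree t1 t2 : proot t1 = proot t2 -> pvalid (cfg_rules grammar) t1 ->
    pvalid (cfg_rules grammar) t2 -> pyield t1 = pyield t2 -> t1 = t2.
  by move=> w t1 t2 [r1 v1 y1] [r2 v2 y2]; apply: uniq_tree; rewrite ?r1 ?r2 ?y1 ?y2.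
elim/ptree_nested_ind: t1 t2 => [a|A ts IH] [b|B us] //; first by case=> ->.
case=> <-; rewrite !pvalid_node !pyield_node.
case/andP => r1 v1 /andP[r2 v2] ey.
have hm (ts' : seq (ptree m k)) : all (pvalid (cfg_rules grammar)) ts' ->
    matches symL (map val_sym (map (@proot m k) ts')) (map (map enum_val) (map (@pyield m k) ts')).
  by elim: ts' => //= t ts' IHt /andP[/tree_sound ht /IHt].
rewrite !mem_rank_rules in r1 r2.
have ef : flatten (map (map enum_val) (map (@pyield m k) ts)) =
          flatten (map (map enum_val) (map (@pyield m k) us)) by rewrite -!map_flatten ey.
have [/(inj_map (can_inj val_symK)) er ew] := rule_det r1 r2 (hm _ v1) (hm _ v2) ef.
have {}ew := inj_map (inj_map (@enum_val_inj _ _)) ew.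
congr PNode; elim: ts us IH v1 v2 er ew {ey r1 r2 ef} => [|t ts IHt] [|u us] //=.
move=> [ht hts] /andP[v1 v1s] /andP[v2 v2s] [e1 e2] [y1 y2].
by rewrite (ht u) // (IHt us).
Qed.

Lemma grammar_language w : (forall A w, L A w -> tree_of (inl A) w) ->
  L start (map enum_val w) <-> cfg_language grammar w.
Proof.
move=> complete; split=> [/complete[t [rt vt yt]]|[t [rt vt yt]]].
  by exists t; split=> //; rewrite yt mapK //; apply: enum_valK.
by have := tree_sound vt; rewrite rt yt /= enum_rankK.
Qed.
End Grammar.

(** * The free group and its tree *)

(* [(c, o)]: the generator [c] (with [false] for a, [true] for b), inverted when [o]. *)
Definition dir := (bool * bool)%type.
Definition dinv (s : dir) : dir := (s.1, ~~ s.2).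

Lemma dinvK : involutive dinv. Proof. by case=> c o; rewrite /dinv negbK. Qed.
Lemma dinv_neq s : dinv s != s. Proof. by case: s => [[] []]. Qed.
Lemma dinv_inj : injective dinv. Proof. exact: inv_inj dinvK. Qed.

Definition reduced (u : seq dir) := sorted (fun s t => t != dinv s) u.

Definition push s (u : seq dir) :=
  if u is t :: u' then if t == dinv s then u' else s :: u else [:: s].
Definition fmul (u v : seq dir) := foldr push v u.
Definition rinv (u : seq dir) := rev (map dinv u).

Lemma reduced_push s u : reduced u -> reduced (push s u).
Proof.
case: u => //= t u hu; case: eqP => [_|/eqP ne] /=; last by rewrite ne.
exact: path_sorted hu.
Qed.

Lemma push_cons s u : reduced (s :: u) -> push s u = s :: u.
Proof. by case: u => //= t u /andP[/negPf->]. Qed.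

Lemma pushK s u : reduced u -> push (dinv s) (push s u) = u.
Proof.
case: u => [|t u] hu /=; first by rewrite dinvK eqxx.
case: eqP hu => [->|_] hu; first exact: push_cons.
by rewrite /= dinvK eqxx.
Qed.

Lemma reduced_fmul u v : reduced v -> reduced (fmul u v).
Proof. by move=> hv; elim: u => //= s u; apply: reduced_push. Qed.

Lemma fmul_push s u v : reduced v -> fmul (push s u) v = push s (fmul u v).
Proof.
move=> hv; case: u => //= t u; case: eqP => //= ->.
by rewrite -{1}(dinvK s) pushK //; apply: reduced_fmul.
Qed.

Lemma fmulA u v w : reduced w -> fmul (fmul u v) w = fmul u (fmul v w).
Proof. by move=> hw; elim: u => //= s u IH; rewrite fmul_push // IH. Qed.

Lemma fmul_cat u v : reduced (u ++ v) -> fmul u v = u ++ v.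
Proof.
elim: u => //= s u IH h; rewrite IH; first by rewrite push_cons.
exact: path_sorted h.
Qed.

Lemma fmul_nil u : reduced u -> fmul u [::] = u.
Proof. by move=> hu; rewrite fmul_cat cats0. Qed.

Lemma fmul_rinv u w : reduced w -> fmul (rinv u) (fmul u w) = w.
Proof.
move=> hw; elim: u => //= s u IH; rewrite /rinv /= rev_cons -cats1 /fmul foldr_cat /=.
by rewrite pushK ?IH //; apply: reduced_fmul.
Qed.

Lemma reduced_rinv u : reduced u -> reduced (rinv u).
Proof.
rewrite /reduced /rinv rev_sorted sorted_map; apply: sub_sorted => s t /=.
by apply: contraNneq => /dinv_inj ->; rewrite dinvK.
Qed.

Definition fgrp := {u : seq dir | reduced u}.
HB.instance Definition _ := Countable.on fgrp.

Definition fgrp_one : fgrp := exist _ [::] isT.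
Definition fgrp_mul (g h : fgrp) : fgrp := exist _ (fmul (val g) (val h)) (reduced_fmul (val g) (valP h)).
Definition fgrp_inv (g : fgrp) : fgrp := exist _ (rinv (val g)) (reduced_rinv (valP g)).

Lemma fgrp_mulA : associative fgrp_mul.
Proof. by move=> f g h; apply: val_inj; rewrite /= fmulA //; apply: valP h. Qed.
Lemma fgrp_mul1 : left_id fgrp_one fgrp_mul.
Proof. by move=> g; apply: val_inj. Qed.
Lemma fgrp_mulr1 : right_id fgrp_one fgrp_mul.
Proof. by move=> g; apply: val_inj; rewrite /= fmul_nil //; apply: valP g. Qed.
Lemma fgrp_mulV : left_inverse fgrp_one fgrp_inv fgrp_mul.
Proof.
move=> g; apply: val_inj; have := fmul_rinv (val g) (isT : reduced [::]).
by rewrite /= fmul_nil //; apply: valP g.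
Qed.
Lemma fgrp_mulVr : right_inverse fgrp_one fgrp_inv fgrp_mul.
Proof.
move=> g; rewrite -[LHS]fgrp_mul1 -{1}(fgrp_mulV (fgrp_inv g)).
by rewrite -fgrp_mulA [X in fgrp_mul _ X]fgrp_mulA fgrp_mulV fgrp_mul1 fgrp_mulV.
Qed.
HB.instance Definition _ := isGroup.Build fgrp fgrp_mulA fgrp_mul1 fgrp_mulr1 fgrp_mulV fgrp_mulVr.

Local Open Scope group_scope.

Definition ltr (s : dir) : fgrp := exist _ [:: s] isT.
(** The branch at the vertex 1 that contains [g]. After translation, [hd (k^-1 * g) = Some s] says
    that [g] lies beyond the edge leaving [k] in direction [s]; with [g = 1] this locates the base
    point. *)
Definition hd (g : fgrp) : option dir := ohead (val g).

Lemma ltrV s : (ltr s)^-1 = ltr (dinv s).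
Proof. exact: val_inj. Qed.

Lemma hd1 : hd 1 = None. Proof. by []. Qed.
Lemma hd_ltr s : hd (ltr s) = Some s. Proof. by []. Qed.

(** The letter [hd g^-1] is the inverse of the last letter of [g], so the hypothesis says that
    nothing cancels between [g] and [h]. *)
Lemma hd_mul g h : g != 1 -> hd g^-1 != hd h -> hd (g * h) = hd g.
Proof.
move=> g1 ne; rewrite /hd /=.
have {g1} : val g != [::] by apply: contraNneq g1 => e; apply/eqP/val_inj.
move: ne (valP g) (valP h); rewrite /hd /= /rinv.
case: (val g) / lastP => // u s; rewrite map_rcons rev_rcons /= => ne hu hv _.
rewrite fmul_cat; first by case: (u).
move: ne hu hv; rewrite /reduced; case: u => [|r u] /=.
  by case: (val h) => //= t v; rewrite (inj_eq Some_inj) eq_sym => ->.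
rewrite cat_path last_rcons => ne ->; case: (val h) ne => //= t v.
by rewrite (inj_eq Some_inj) eq_sym => ->.
Qed.

Lemma hd_tail g s : hd g = Some s -> hd (ltr (dinv s) * g) != Some (dinv s).
Proof.
case: g => [[|t u] hu] //; rewrite /hd /= => -[<-]; rewrite dinvK eqxx.
by case: u hu => //= r u /andP[]; rewrite (inj_eq Some_inj).
Qed.

Lemma hd_ltrM s g : hd g != Some (dinv s) -> hd (ltr s * g) = Some s.
Proof. by move=> ne; rewrite hd_mul // ltrV hd_ltr eq_sym. Qed.

(* Two vertices joined by an edge lie on the same side of every other edge. *)
Lemma hd_cross g t s : hd g != Some s -> hd (g * ltr t) = Some s -> g = 1 /\ t = s.
Proof.
have [->|g1] := eqVneq g 1; first by rewrite mul1g hd_ltr => _ [].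
have [e|ne] := eqVneq (hd g^-1) (Some t); last first.
  by rewrite hd_mul // => /eqP.
set g' := g * ltr t => ng eg'; have g'1 : g' != 1 by apply: contraTneq isT => e'; rewrite e' in eg'.
have eg : g = g' * ltr (dinv t) by rewrite /g' -ltrV mulgK.
move: ng; rewrite eg hd_mul ?eg' ?eqxx // hd_ltr.
by rewrite /g' invgM ltrV hd_tail.
Qed.

(** * Walks and tours *)

(* [(s, l, e)]: switch the lamp of the edge leaving in direction [s] when [l],
   multiply by the central involution when [e], and move along [s]. *)
Definition letter := (dir * bool * bool)%type.
Definition dr (x : letter) := x.1.1.
Definition lp (x : letter) := x.1.2.
Definition ep (x : letter) := x.2.

Definition pos (w : seq letter) : fgrp := foldr (fun x g => ltr (dr x) * g) 1 w.

Lemma pos_cons x w : pos (x :: w) = ltr (dr x) * pos w. Proof. by []. Qed.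

Lemma pos_cat v w : pos (v ++ w) = pos v * pos w.
Proof. by elim: v => [|x v IH]; rewrite ?mul1g //= IH mulgA. Qed.

(** An unoriented edge is named by its generator and its origin in the positive orientation, so that
    crossings in both directions switch the same lamp. *)
Definition edge_of (g : fgrp) (s : dir) : fgrp * bool :=
  (if s.2 then g * ltr s else g, s.1).
Definition shift (k : fgrp) (e : fgrp * bool) : fgrp * bool := (k * e.1, e.2).

Lemma shift_edge k g s : shift k (edge_of g s) = edge_of (k * g) s.
Proof. by rewrite /shift /edge_of; case: s.2; rewrite /= ?mulgA. Qed.
Lemma shift1 e : shift 1 e = e. Proof. by case: e => g c; rewrite /shift mul1g. Qed.
Lemma shiftM k l e : shift (k * l) e = shift k (shift l e).
Proof. by rewrite /shift /= mulgA. Qed.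
Lemma shiftK k : cancel (shift k) (shift k^-1).
Proof. by move=> e; rewrite -shiftM mulVg shift1. Qed.
Lemma shiftVK k : cancel (shift k^-1) (shift k).
Proof. by move=> e; rewrite -shiftM mulgV shift1. Qed.

Lemma edge_flip g s : edge_of (g * ltr s) (dinv s) = edge_of g s.
Proof.
have e c : ltr (c, true) = (ltr (c, false))^-1 by rewrite ltrV.
by case: s => c [] //; rewrite /edge_of /dinv /= e mulgK.
Qed.

Lemma edge_surj e : exists g s, e = edge_of g s.
Proof. by case: e => g c; exists g, (c, false). Qed.

Lemma edge_eq g s g' s' : edge_of g s = edge_of g' s' ->
  g = g' /\ s = s' \/ g' = g * ltr s /\ s' = dinv s.
Proof.
case: s s' => [c o] [c' o'] e; have /= ec := congr1 snd e; subst c'.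
have /= {e} := congr1 fst e; case: o; case: o'.
- by move/mulIg => ->; left.
- by move=> <-; right.
- by move=> ->; right; rewrite -mulgA -[ltr (c, false)]/(ltr (dinv (c, true))) -ltrV mulgV mulg1.
- by move=> ->; left.
Qed.

(** State of the lamp of [e] after the walk, as a parity of switches. The recursion keeps the walker
    at 1 and moves the edge instead. *)
Fixpoint lit (w : seq letter) (e : fgrp * bool) : bool :=
  if w is x :: w' then (lp x && (e == edge_of 1 (dr x))) (+) lit w' (shift (ltr (dr x))^-1 e)
  else false.

Lemma lit_cat v w e : lit (v ++ w) e = lit v e (+) lit w (shift (pos v)^-1 e).
Proof.
elim: v e => [|x v IH] e /=; first by rewrite invg1 shift1.
by rewrite IH addbA -shiftM invgM.
Qed.

Lemma lit_split w u t : lit w (edge_of u t) -> exists p x q,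
  w = p ++ x :: q /\ edge_of u t = edge_of (pos p) (dr x).
Proof.
elim: w u => //= x w IH u; case: (boolP (lp x && _)) => [/andP[_ /eqP->] _|_ /=].
  by exists [::], x, w.
rewrite shift_edge => /IH[p [y [q [-> e]]]]; exists (x :: p), y, q; split=> //=.
by rewrite -[LHS](shiftVK (ltr (dr x))) shift_edge e shift_edge.
Qed.

Lemma lit_visit w u t : lit w (edge_of u t) -> exists p q, w = p ++ q /\ pos p = u.
Proof.
move=> /lit_split[p [x [q [-> /esym/edge_eq[[<- _]|[-> _]]]]]].
  by exists p, (x :: q).
exists (rcons p x), q; rewrite cat_rcons; split=> //.
by rewrite -cats1 pos_cat /= mulg1.
Qed.

Fixpoint dedges (g : fgrp) (w : seq letter) : seq (fgrp * dir) :=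
  if w is x :: w' then (g, dr x) :: dedges (g * ltr (dr x)) w' else [::].

Lemma size_dedges g w : size (dedges g w) = size w.
Proof. by elim: w g => //= x w IH g; rewrite IH. Qed.

Lemma dedges_cat g v w : dedges g (v ++ w) = dedges g v ++ dedges (g * pos v) w.
Proof. by elim: v g => [|x v IH] g /=; rewrite ?mulg1 // IH mulgA. Qed.

Definition dshift (k : fgrp) (e : fgrp * dir) : fgrp * dir := (k * e.1, e.2).

Lemma dshift_inj k : injective (dshift k).
Proof.
move=> [g s] [g' s'] e; have /= /mulgI-> := congr1 fst e.
by have /= -> := congr1 snd e.
Qed.

Lemma dedges_shift k g w : dedges (k * g) w = map (dshift k) (dedges g w).
Proof. by elim: w g => //= x w IH g; rewrite -mulgA IH. Qed.

Lemma mem_dedges k s w : (k, s) \in dedges 1 w -> exists p x q,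
  [/\ w = p ++ x :: q, k = pos p & s = dr x].
Proof.
elim: w k s => //= x w IH k s; rewrite inE => /orP[/eqP[-> ->]|].
  by exists [::], x, w.
rewrite mul1g -[ltr _]mulg1 dedges_shift => /mapP[[k' s'] /IH[p [y [q [-> -> ->]]]] [-> ->]].
by exists (x :: p), y, q.
Qed.

(** Discrete continuity: passing to the far side of an edge takes a crossing in that direction,
    since by [hd_cross] no other single step changes sides. *)
Lemma cross k s g w : hd (k^-1 * g) != Some s -> hd (k^-1 * (g * pos w)) = Some s ->
  (k, s) \in dedges g w.
Proof.
elim: w g => [|x w IH] g h0.
  by rewrite -[pos _]/(1 : fgrp) mulg1 => h1; rewrite h1 eqxx in h0.
rewrite pos_cons => h1; rewrite inE; have [e|ne] := eqVneq (hd (k^-1 * (g * ltr (dr x)))) (Some s).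
  rewrite mulgA in e; have [/eqP + <-] := hd_cross h0 e.
  by rewrite mulg_eq1 (inj_eq (@invg_inj _)) => /eqP ->; rewrite eqxx.
by rewrite (IH _ ne) ?orbT // -mulgA.
Qed.

Definition avoids d (w : seq letter) := forall n, hd (pos (take n w)) != Some d.

Lemma avoids_prefix d p q : avoids d (p ++ q) -> hd (pos p) != Some d.
Proof. by move/(_ (size p)); rewrite take_size_cat. Qed.

Lemma avoids_nil d : avoids d [::]. Proof. by []. Qed.

Lemma avoids_catr d v w : pos v = 1 -> avoids d (v ++ w) -> avoids d w.
Proof.
by move=> v1 h n; have := h (size v + n); rewrite take_cat ltnNge leq_addr addKn pos_cat v1 mul1g.
Qed.

Lemma avoids_cons d x w : dr x != d -> avoids (dinv (dr x)) w -> avoids d (x :: w).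
Proof. by move=> ne h [|n] //=; rewrite hd_ltrM. Qed.

Lemma pos_exc x U y V : pos U = 1 -> dr y = dinv (dr x) -> pos (x :: U ++ y :: V) = pos V.
Proof. by move=> U1 e; rewrite /= pos_cat U1 mul1g /= e -ltrV mulVKg. Qed.

Lemma avoids_exc d x U y V : dr x != d -> pos U = 1 -> avoids (dinv (dr x)) U ->
  dr y = dinv (dr x) -> avoids d V -> avoids d (x :: U ++ y :: V).
Proof.
move=> ne U1 aU e aV [|n] //.
rewrite -[take n.+1 _]/(x :: take n (U ++ y :: V)) take_cat; case: ltnP => _.
  by rewrite pos_cons hd_ltrM.
case: (n - size U) => [|m]; last by rewrite -[take _ _]/(y :: take m V) pos_exc.
by rewrite take0 cats0 pos_cons U1 mulg1.
Qed.

(** An excursion that turns back at the far end of its edge achieves something only by toggling the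
    lamp of that edge; any other is justified by what it does beyond. *)
Definition leaf (D : {set dir}) x y := (D != set0) || (lp x != lp y).

(* A tour is a closed walk crossing every oriented edge at most once and making no
   useless excursion; [D] is the set of the directions it takes from its base point. *)
Inductive tour : {set dir} -> seq letter -> Prop :=
  | tour0 : tour set0 [::]
  | tourS x U y V D D' : dr y = dinv (dr x) -> tour D U -> dinv (dr x) \notin D ->
      leaf D x y -> tour D' V -> dr x \notin D' -> tour (dr x |: D') (x :: U ++ y :: V).

Definition exc x D U y :=
  [/\ dr y = dinv (dr x), tour D U, dinv (dr x) \notin D & leaf D x y].

Lemma tour_pos D w : tour D w -> pos w = 1.
Proof. by elim=> // x U y V D1 D2 e _ U1 _ _ _ V1 _; rewrite pos_exc. Qed.

Lemma tour_avoids D w d : tour D w -> d \notin D -> avoids d w.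
Proof.
move=> h; elim: h d => {D w} [d _|x U y V D D' e tU IHU nD _ _ IHV nD' d].
  exact: avoids_nil.
rewrite in_setU1 negb_or eq_sym => /andP[ne nd].
by apply: avoids_exc => //; [apply: tour_pos tU | apply: IHU | apply: IHV].
Qed.

Lemma tour_hd D w d : tour D w -> d \in D -> exists n, hd (pos (take n w)) = Some d.
Proof.
move=> h; elim: h d => {D w} [d|x U y V D D' e tU _ _ _ _ IHV _ d]; first by rewrite inE.
rewrite in_setU1 => /orP[/eqP->|/IHV[n hn]].
  by exists 1%N; rewrite /= take0.
exists (size U + n).+2; rewrite -hn -[take _ _]/(x :: take (size U + n).+1 (U ++ y :: V)).
have -> : take (size U + n).+1 (U ++ y :: V) = U ++ y :: take n V.
  by rewrite -addnS take_cat ltnNge leq_addr /= addKn.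
by rewrite pos_exc // (tour_pos tU).
Qed.

(** The set of directions can be recovered from the word: it consists of the branches that the walk
    enters. *)
Lemma tour_exact D D' w : tour D w -> tour D' w -> D = D'.
Proof.
move=> h h'; apply/setP => d; apply/idP/idP => hd_.
  apply: contraT => nd; have [n e] := tour_hd h hd_.
  by have := tour_avoids h' nd n; rewrite e eqxx.
apply: contraT => nd; have [n e] := tour_hd h' hd_.
by have := tour_avoids h nd n; rewrite e eqxx.
Qed.

Lemma tour_nil D w : tour D w -> (D == set0) = (w == [::]).
Proof.
case=> [|x U y V D1 D2 *]; first by rewrite !eqxx.
by apply/negbTE/set0Pn; exists (dr x); rewrite setU11.
Qed.

Lemma exc_avoids x D U y : exc x D U y -> avoids (dinv (dr x)) U.
Proof. by case=> _ tU nD _; apply: tour_avoids nD. Qed.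

Lemma exc_pos x D U y : exc x D U y -> pos U = 1.
Proof. by case=> _ tU _ _; apply: tour_pos tU. Qed.

Lemma return_leq U1 U2 y1 y2 V1 V2 d : U1 ++ y1 :: V1 = U2 ++ y2 :: V2 ->
  pos U1 = 1 -> dr y1 = d -> avoids d U2 -> size U2 <= size U1.
Proof.
move=> e U11 ed aU; rewrite leqNgt; apply/negP => lt.
have := aU (size U1).+1; rewrite -(takel_cat (y2 :: V2)) // -e take_cat ltnNge leqnSn /=.
by rewrite subSnn /= take0 pos_cat U11 mul1g /= mulg1 hd_ltr ed eqxx.
Qed.

(** [U] stops right before the first entry into the branch [d], a moment that depends on the whole
    word only. *)
Lemma return_uniq U1 U2 y1 y2 V1 V2 d : U1 ++ y1 :: V1 = U2 ++ y2 :: V2 ->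
  pos U1 = 1 -> pos U2 = 1 -> dr y1 = d -> dr y2 = d -> avoids d U1 -> avoids d U2 ->
  [/\ U1 = U2, y1 = y2 & V1 = V2].
Proof.
move=> e p1 p2 d1 d2 a1 a2; have /eqP es : size U1 == size U2.
  by rewrite eqn_leq (return_leq (esym e) p2 d2 a1) (return_leq e p1 d1 a2).
by move/eqP: e; rewrite eqseq_cat // => /andP[/eqP-> /eqP[-> ->]].
Qed.

Lemma exc_uniq x D1 U1 y1 V1 D2 U2 y2 V2 : U1 ++ y1 :: V1 = U2 ++ y2 :: V2 ->
  exc x D1 U1 y1 -> exc x D2 U2 y2 -> [/\ D1 = D2, U1 = U2, y1 = y2 & V1 = V2].
Proof.
move=> e h1 h2.
have [eU -> ->] := return_uniq e (exc_pos h1) (exc_pos h2)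
  (let: And4 d _ _ _ := h1 in d) (let: And4 d _ _ _ := h2 in d) (exc_avoids h1) (exc_avoids h2).
case: h1 h2 => _ t1 _ _ [_ t2 _ _]; rewrite -eU in t2 *.
by split=> //; apply: tour_exact t1 t2.
Qed.

(** * Geodesic words *)

Lemma lit_exc x U y V e : pos U = 1 -> dr y = dinv (dr x) ->
  lit (x :: U ++ y :: V) e =
    ((lp x (+) lp y) && (e == edge_of 1 (dr x))) (+) (lit U (shift (ltr (dr x))^-1 e) (+) lit V e).
Proof.
move=> U1 ey; rewrite /= lit_cat U1 invg1 shift1 /= ey -ltrV invgK shiftVK.
rewrite (can2_eq (shiftVK (ltr (dr x))) (shiftK _)) shift_edge mulg1.
have -> : edge_of (ltr (dr x)) (dinv (dr x)) = edge_of 1 (dr x) by rewrite -[RHS]edge_flip mul1g.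
by rewrite (addbCA (lit U _)) addbA -andb_addl.
Qed.

Lemma lit_avoids d w u t : avoids d w -> lit w (edge_of u t) ->
  hd u != Some d /\ hd (u * ltr t) != Some d.
Proof.
move=> aw h; split.
  by have [p [q [e <-]]] := lit_visit h; rewrite e in aw; apply: avoids_prefix aw.
move: h; rewrite -edge_flip => /lit_visit[p [q [e <-]]].
by rewrite e in aw; apply: avoids_prefix aw.
Qed.

Lemma edge_inner s u t : hd u != Some (dinv s) -> hd (u * ltr t) != Some (dinv s) ->
  edge_of (ltr s * u) t != edge_of 1 s.
Proof.
move=> h1 h2; apply/negP => /eqP /edge_eq[[e _]|[e _]].
  by move: h1; rewrite -(mulg1_eq e) ltrV hd_ltr eqxx.
by move: h2; rewrite -mulgA in e; rewrite -(mulg1_eq (esym e)) ltrV hd_ltr eqxx.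
Qed.

(** A lamp lit by one piece of the walk stays lit in the whole, because the inside of an excursion
    and the rest of the walk live in disjoint parts of the tree. The next two lemmas have the same
    reason. *)
Lemma lit_inner x U y V u t : pos U = 1 -> dr y = dinv (dr x) ->
  avoids (dinv (dr x)) U -> avoids (dr x) V ->
  lit U (edge_of u t) -> lit (x :: U ++ y :: V) (edge_of (ltr (dr x) * u) t).
Proof.
move=> U1 ey aU aV h; have [h1 h2] := lit_avoids aU h.
rewrite lit_exc // (negPf (edge_inner _ _)) // andbF /= shift_edge mulKg h.
apply/negP => /(lit_avoids aV)[]; by rewrite hd_ltrM ?eqxx.
Qed.

Lemma lit_outer x U y V u t : pos U = 1 -> dr y = dinv (dr x) ->
  avoids (dinv (dr x)) U -> avoids (dr x) V ->
  lit V (edge_of u t) -> lit (x :: U ++ y :: V) (edge_of u t).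
Proof.
move=> U1 ey aU aV h; have [h1 h2] := lit_avoids aV h.
rewrite lit_exc // h; case: eqP => [/edge_eq[[eu et]|[eu et]]|_].
- by move: h2; rewrite eu et mul1g hd_ltr eqxx.
- have e : u = ltr (dr x) by rewrite et -ltrV -[LHS](mulgK (ltr t)) -eu mul1g.
  by move: h1; rewrite e hd_ltr eqxx.
rewrite andbF /= shift_edge addbT; apply/negP => /(lit_avoids aU)[h3 _].
by move: h1; rewrite -(mulVKg (ltr (dr x)) u) hd_ltrM ?eqxx.
Qed.

Lemma lit_step x W u t : avoids (dinv (dr x)) W ->
  lit W (edge_of u t) -> lit (x :: W) (edge_of (ltr (dr x) * u) t).
Proof.
move=> aW h; have [h1 h2] := lit_avoids aW h.
by rewrite /= (negPf (edge_inner _ _)) // andbF /= shift_edge mulKg h.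
Qed.

Lemma exc_lit_or x U y V : pos U = 1 -> dr y = dinv (dr x) ->
  avoids (dinv (dr x)) U -> avoids (dr x) V ->
  (U = [::] /\ lp x != lp y) \/ (exists u t, lit U (edge_of u t)) ->
  exists u t, hd u = Some (dr x) /\ lit (x :: U ++ y :: V) (edge_of u t).
Proof.
move=> U1 ey aU aV [[-> ne]|[u [t h]]].
  (* When the walk turns back at once, the lamp is that of the crossed edge itself, named from its
     far end so that [u] lies in the branch. *)
  exists (ltr (dr x)), (dinv (dr x)); split=> //.
  rewrite lit_exc // -[ltr (dr x)]mul1g edge_flip eqxx andbT /=.
  have -> : lp x (+) lp y by case: (lp x) (lp y) ne => [] [].
  apply/negP => h; have [_ /negP[]] := lit_avoids aV h.
  by rewrite mul1g hd_ltr.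
have [h1 _] := lit_avoids aU h.
exists (ltr (dr x) * u), t; rewrite hd_ltrM //; split=> //.
exact: lit_inner.
Qed.

Lemma tour_lit D w : tour D w -> w = [::] \/ exists u t, lit w (edge_of u t).
Proof.
elim=> [|x U y V D1 D2 ey tU IHU nD lf tV _ nD']; [by left | right].
have [|||||u [t [_ h]]] := @exc_lit_or x U y V; rewrite ?(tour_pos tU) //.
- exact: tour_avoids tU nD.
- exact: tour_avoids tV nD'.
- case: IHU => [eU|]; [left; split=> // | by right].
  by move: lf; rewrite /leaf (tour_nil tU) eU.
by exists u, t.
Qed.

Lemma exc_lit x D U y V : exc x D U y -> avoids (dr x) V ->
  exists u t, hd u = Some (dr x) /\ lit (x :: U ++ y :: V) (edge_of u t).
Proof.
move=> hx aV; apply: exc_lit_or => //.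
- exact: exc_pos hx.
- by case: hx.
- exact: exc_avoids hx.
case: hx => ey tU nD lf; case: (tour_lit tU) => [eU|]; [left; split=> // | by right].
by move: lf; rewrite /leaf (tour_nil tU) eU.
Qed.

(* If the edge from [k] in direction [s] is not in the branch [d], that branch lies
   on the same side of it as the root. *)
Lemma hd_side k s g d : hd k != Some d -> hd (k * ltr s) != Some d -> hd g = Some d ->
  (hd (k^-1 * g) == Some s) = (hd k^-1 == Some s).
Proof.
have [->|k1] := eqVneq k 1.
  rewrite invg1 !mul1g => _ ns ->; rewrite hd1.
  by apply/negbTE; rewrite eq_sym.
move=> nk _ eg; rewrite hd_mul ?invg_eq1 // invgK eg //.
Qed.

(* [U] is the set of directions already used at the current vertex, including the one
   leading back; [F] is the set of directions forbidden at the end point. *)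
Inductive lin (F : {set dir}) : {set dir} -> seq letter -> Prop :=
  | lin0 (U : {set dir}) : [disjoint F & U] -> lin F U [::]
  | linE (U : {set dir}) x D X y W : exc x D X y -> dr x \notin U -> lin F (dr x |: U) W ->
      lin F U (x :: X ++ y :: W)
  | linS (U : {set dir}) x W : dr x \notin U -> lin F [set dinv (dr x)] W -> lin F U (x :: W).

Lemma lin_avoids F (U : {set dir}) w d : lin F U w -> d \in U -> avoids d w.
Proof.
move=> h; elim: h d => {U w} [U _ d _|U x D X y W hx nU _ IH d dU|U x W nU _ IH d dU].
- exact: avoids_nil.
- apply: avoids_exc; [|exact: exc_pos hx|exact: exc_avoids hx|by case: hx|].
    by apply: contraNneq nU => ->.
  by apply: IH; rewrite in_setU1 dU orbT.
- by apply: avoids_cons; [apply: contraNneq nU => -> | apply: IH; rewrite inE].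
Qed.

Lemma disjointsU (A B C : {set dir}) :
  [disjoint A :|: B & C] = [disjoint A & C] && [disjoint B & C].
Proof. by rewrite -!setI_eq0 setIUl setU_eq0. Qed.

Lemma disjointsU1 (A C : {set dir}) d :
  [disjoint d |: A & C] = (d \notin C) && [disjoint A & C].
Proof. by rewrite disjointsU disjoints1. Qed.

Lemma tour_lin (F D U : {set dir}) w : tour D w -> [disjoint D & U] -> [disjoint F & U :|: D] -> lin F U w.
Proof.
move=> h; elim: h U => {D w} [U _|x X y V D D' ey tX _ nD lf tV IH nD' U dU dF].
  by rewrite setU0; apply: lin0.
have [sU dU'] : dr x \notin U /\ [disjoint D' & U].
  by move: dU; rewrite disjointsU1; case/andP.
apply: (@linE _ _ _ D) => //; apply: IH.
  by rewrite disjoint_sym disjointsU1 nD' disjoint_sym.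
by rewrite -setUA setUCA.
Qed.

(* Conditions under which every walk from 1 to [h] switching the lamps in [X] crosses [e]. *)
Definition forced (h : fgrp) (X : fgrp * bool -> bool) (e : fgrp * dir) : Prop :=
  let: (k, s) := e in
  [\/ hd k^-1 != Some s /\ hd (k^-1 * h) = Some s,
      hd k^-1 != Some s /\ (exists u t, X (edge_of u t) /\ hd (k^-1 * u) = Some s)
    | hd (k^-1 * h) = Some s /\ (exists u t, X (edge_of u t) /\ hd (k^-1 * u) != Some s)].

Lemma forced_cross v e : forced (pos v) (lit v) e -> e \in dedges 1 v.
Proof.
case: e => k s [[h1 h2]|[h1 [u [t [h2 h3]]]]|[h1 [u [t [h2 h3]]]]].
- by apply: cross; rewrite ?mulg1 ?mul1g.
- have [p [q [ev eu]]] := lit_visit h2; rewrite ev dedges_cat mem_cat cross //.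
    by rewrite mulg1.
  by rewrite mul1g eu.
have [p [q [ev eu]]] := lit_visit h2; rewrite ev dedges_cat mem_cat (@cross k s _ q) ?orbT //.
  by rewrite mul1g eu.
by rewrite mul1g -pos_cat -ev.
Qed.

Lemma forced_ext h (X X' : fgrp * bool -> bool) e : X =1 X' -> forced h X e -> forced h X' e.
Proof.
case: e => k s eX [h1|[h1 [u [t [h2 h3]]]]|[h1 [u [t [h2 h3]]]]]; [exact: Or31 | |].
  by apply: Or32; split=> //; exists u, t; rewrite -eX.
by apply: Or33; split=> //; exists u, t; rewrite -eX.
Qed.

Lemma dedges_avoids d w k s : avoids d w -> (k, s) \in dedges 1 w ->
  hd k != Some d /\ hd (k * ltr s) != Some d.
Proof.
move=> aw /mem_dedges[p [x [q [ew -> ->]]]]; rewrite ew in aw; split.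
  exact: avoids_prefix aw.
by have := aw; rewrite -cat_rcons => /avoids_prefix; rewrite -cats1 pos_cat /= mulg1.
Qed.

(** Every excursion lights a lamp beyond its edge, and the pieces of the walk do not interfere, so
    what is forced for a piece remains forced for the whole. The induction is on length because the
    inside of an excursion is a tour, which is a [lin] word only through [tour_lin]. *)
Lemma lin_forced n F (U : {set dir}) w : size w < n -> lin F U w ->
  uniq (dedges 1 w) /\ forall e, e \in dedges 1 w -> forced (pos w) (lit w) e.
Proof.
elim: n F U w => // n IH F U w; rewrite ltnS => sz lw.
case: lw sz => {U w} [U _ _//|U x D X y W hx nU lW sz|U x W nU lW sz].
  have [ey tX nD lf] := hx; have X1 := exc_pos hx; have aX := exc_avoids hx.
  have aW : avoids (dr x) W by apply: lin_avoids lW _; rewrite setU11.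
  have hs : hd (ltr (dr x))^-1 = Some (dinv (dr x)) by rewrite ltrV.
  have hW : hd ((ltr (dr x))^-1 * pos W) = Some (dinv (dr x)).
    rewrite ltrV hd_ltrM // dinvK.
    by have := aW (size W); rewrite take_size.
  have lX : lin set0 [set dinv (dr x)] X.
    apply: tour_lin tX _ _; last by rewrite -setI_eq0 set0I.
    by rewrite disjoint_sym disjoints1.
  have [|uX fX] := IH _ _ _ _ lX.
    by apply: leq_trans sz; rewrite /= size_cat ltnS leq_addr.
  have [|uW fW] := IH _ _ _ _ lW.
    by apply: leq_trans sz; rewrite /= size_cat ltnS /= addnS leqW // leq_addl.
  have eE : dedges 1 (x :: X ++ y :: W) =
      (1, dr x) :: map (dshift (ltr (dr x))) (dedges 1 X) ++
      (ltr (dr x), dinv (dr x)) :: dedges 1 W.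
    rewrite /= mul1g dedges_cat /= X1 mulg1 ey -ltrV mulgV -dedges_shift mulg1 //.
  have ix k s : (k, s) \in map (dshift (ltr (dr x))) (dedges 1 X) -> exists k',
      [/\ k = ltr (dr x) * k', (k', s) \in dedges 1 X, hd k' != Some (dinv (dr x)) &
          hd (k' * ltr s) != Some (dinv (dr x))].
    case/mapP=> -[k' s'] h [-> ->]; exists k'.
    by have [] := dedges_avoids aX h.
  rewrite pos_exc //; split.
    have nW k s : hd k = Some (dr x) \/ hd (k * ltr s) = Some (dr x) -> (k, s) \notin dedges 1 W.
      by move=> h; apply/negP => /(dedges_avoids aW)[]; case: h => ->; rewrite eqxx.
    rewrite eE cons_uniq mem_cat inE !negb_or cat_uniq cons_uniq uW andbT.
    rewrite map_inj_uniq ?uX; last exact: dshift_inj.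
    apply/andP; split; apply/and3P; split=> //.
    - apply/negP => /ix[k' [e _ h _]].
      by move: h; rewrite -(mulg1_eq (esym e)) hs eqxx.
    - by apply: nW; right; rewrite mul1g.
    - apply/hasPn => -[k s]; rewrite inE => /orP[/eqP[-> ->]|h]; apply/negP => /ix[k' [e _ h1 h2]].
        by move: h2; rewrite -[k'](mulKg (ltr (dr x))) -e mulVg mul1g hd_ltr eqxx.
      by have [/negP[]] := dedges_avoids aW h; rewrite e hd_ltrM.
    by apply: nW; left.
  (* A lamp beyond the edge of the excursion forces this edge both ways: on the way to the lamp, and
     back from it since the walk ends on the near side. *)
  have [u0 [t0 [hu0 lu0]]] := exc_lit hx aW.
  have sideX k' s : hd k' != Some (dinv (dr x)) -> hd (k' * ltr s) != Some (dinv (dr x)) ->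
      (hd (ltr (dr x) * k')^-1 == Some s) = (hd k'^-1 == Some s).
    by move=> h1 h2; rewrite invgM (hd_side h1 h2 hs).
  case=> k s; rewrite eE inE mem_cat inE => /or3P[/eqP[-> ->]|/ix[k' [-> h h1 h2]]|/orP[/eqP[-> ->]|h]].
  - by apply: Or32; rewrite invg1; split=> //; exists u0, t0; rewrite mul1g.
  - case: (fX _ h) => [[g1 g2]|[g1 [u [t [g2 g3]]]]|[g1 [u [t [g2 g3]]]]].
    + by move: g1; rewrite -g2 X1 mulg1 eqxx.
    + apply: Or32; rewrite sideX //; split=> //; exists (ltr (dr x) * u), t.
      by rewrite invgM -mulgA mulKg; split=> //; apply: lit_inner.
    apply: Or33; rewrite X1 mulg1 in g1; split.
      by apply/eqP; rewrite invgM -mulgA (hd_side h1 h2 hW) g1.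
    exists (ltr (dr x) * u), t; rewrite invgM -mulgA mulKg; split=> //.
    exact: lit_inner.
  - apply: Or33; split=> //; exists u0, t0; split=> //.
    by rewrite ltrV hd_tail.
  case: (fW _ h) => [g|[g1 [u [t [g2 g3]]]]|[g1 [u [t [g2 g3]]]]]; first exact: Or31.
    by apply: Or32; split=> //; exists u, t; split=> //; apply: lit_outer.
  by apply: Or33; split=> //; exists u, t; split=> //; apply: lit_outer.
have aW : avoids (dinv (dr x)) W by apply: lin_avoids lW _; rewrite inE.
have hs : hd (ltr (dr x))^-1 = Some (dinv (dr x)) by rewrite ltrV.
have [//|uW fW] := IH _ _ _ _ lW.
have eE : dedges 1 (x :: W) = (1, dr x) :: map (dshift (ltr (dr x))) (dedges 1 W).
  by rewrite /= mul1g -dedges_shift mulg1.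
have ix k s : (k, s) \in map (dshift (ltr (dr x))) (dedges 1 W) -> exists k',
    [/\ k = ltr (dr x) * k', (k', s) \in dedges 1 W, hd k' != Some (dinv (dr x)) &
        hd (k' * ltr s) != Some (dinv (dr x))].
  case/mapP=> -[k' s'] h [-> ->]; exists k'.
  by have [] := dedges_avoids aW h.
rewrite pos_cons eE; split.
  rewrite cons_uniq map_inj_uniq ?uW ?andbT; last exact: dshift_inj.
  apply/negP => /ix[k' [e _ h _]].
  by move: h; rewrite -(mulg1_eq (esym e)) hs eqxx.
case=> k s; rewrite inE => /orP[/eqP[-> ->]|/ix[k' [-> h h1 h2]]].
  apply: Or31; rewrite invg1 mul1g; split=> //.
  by apply: hd_ltrM; have := aW (size W); rewrite take_size.
have side : (hd (ltr (dr x) * k')^-1 == Some s) = (hd k'^-1 == Some s).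
  by rewrite invgM (hd_side h1 h2 hs).
case: (fW _ h) => [[g1 g2]|[g1 [u [t [g2 g3]]]]|[g1 [u [t [g2 g3]]]]].
- by apply: Or31; rewrite side invgM -mulgA mulKg.
- apply: Or32; rewrite side; split=> //; exists (ltr (dr x) * u), t.
  by rewrite invgM -mulgA mulKg; split=> //; apply: lit_step.
apply: Or33; rewrite invgM -mulgA mulKg; split=> //; exists (ltr (dr x) * u), t.
by rewrite -mulgA mulKg; split=> //; apply: lit_step.
Qed.

Theorem lin_geodesic F (U : {set dir}) w v : lin F U w -> pos v = pos w -> lit v =1 lit w ->
  size w <= size v.
Proof.
move=> /(lin_forced (leqnn _))[uw fw] ep el; rewrite -(size_dedges 1 w) -(size_dedges 1 v).
apply: uniq_leq_size uw _ => e /fw f; apply: forced_cross; rewrite ep.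
by apply: forced_ext f => ?; rewrite el.
Qed.

(** * Words that are shortest in their conjugacy class *)

(** Equality, conjugacy and minimality in the quotient [Q], where the central component of letters
    is invisible. *)
Definition qeq v w := pos v = pos w /\ lit v =1 lit w.
Definition qconj v w := exists k, qeq (v ++ k) (k ++ w).
Definition qmin w := forall v, qconj v w -> size w <= size v.

Lemma qeq_trans u v w : qeq u v -> qeq v w -> qeq u w.
Proof. by move=> [e1 l1] [e2 l2]; split=> [|e]; rewrite ?e1 ?l1. Qed.

Lemma qeq_cat v v' w w' : qeq v v' -> qeq w w' -> qeq (v ++ w) (v' ++ w').
Proof.
by move=> [ev lv] [ew lw]; split=> [|e]; rewrite ?pos_cat ?lit_cat ?ev ?ew ?lv ?lw.
Qed.

Lemma qeq_catl u v w : qeq v w -> qeq (u ++ v) (u ++ w). Proof. exact: qeq_cat. Qed.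
Lemma qeq_catr u v w : qeq v w -> qeq (v ++ u) (w ++ u).
Proof. by move=> h; apply: qeq_cat. Qed.

Definition linv (x : letter) : letter := (dinv (dr x), lp x, ep x).
Definition winv (w : seq letter) := rev (map linv w).

Lemma qeq_winv w : qeq (winv w ++ w) [::].
Proof.
elim: w => [|x w IH] //; rewrite /winv map_cons rev_cons cat_rcons.
apply: qeq_trans IH; apply: qeq_catl; rewrite -[linv x :: _]/([:: linv x; x] ++ w).
apply: (qeq_cat (v' := [::])) => //; split=> [|e].
  by rewrite (@pos_exc _ [::]) //= dinvK.
by rewrite (@lit_exc _ [::]) //= ?dinvK // addbb.
Qed.

Lemma qconj_trans u v w : qconj u v -> qconj v w -> qconj u w.
Proof.
move=> [k h1] [l h2]; exists (k ++ l); rewrite catA.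
apply: qeq_trans (qeq_catr l h1) _; rewrite -!catA; exact: qeq_catl.
Qed.

Lemma qconj_eq v w : qeq v w -> qconj v w.
Proof. by move=> h; exists [::]; rewrite cats0. Qed.

Lemma qconj_rot p q : qconj (q ++ p) (p ++ q).
Proof. by exists q; rewrite -catA. Qed.

Lemma qmin_rot p q : qmin (p ++ q) -> qmin (q ++ p).
Proof.
move=> h v hv; rewrite size_cat addnC -size_cat; apply: h.
exact: qconj_trans hv (qconj_rot _ _).
Qed.

Lemma lit_rot p q e : pos p * pos q = 1 -> lit (q ++ p) e = lit (p ++ q) (shift (pos p) e).
Proof.
move=> h; rewrite !lit_cat shiftK addbC; congr (lit p (shift _ e) (+) _).
by rewrite -(mulg1_eq h) invgK.
Qed.

Lemma tour_cat D E v w : tour D v -> tour E w -> [disjoint D & E] -> tour (D :|: E) (v ++ w).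
Proof.
move=> tv tw; elim: tv => {D v} [_|x U y V D D' ey tU _ nD lf tV IH nD'].
  by rewrite set0U.
rewrite disjointsU1 => /andP[nE dE]; rewrite -cat_cons -catA -setUA cat_cons.
apply: (tourS ey tU nD lf); first exact: IH.
by rewrite inE negb_or nD'.
Qed.

Lemma exc_tour x D U y : exc x D U y -> tour [set dr x] (x :: U ++ [:: y]).
Proof.
case=> ey tU nD lf; rewrite -[[set _]]setU0.
by apply: tourS ey tU nD lf tour0 _; rewrite inE.
Qed.

(** Read cyclically, the edge of [x] has the walk [U] at one end and [V] at the other, so the lamp
    condition is symmetric: either end may be a leaf of the subtree. *)
Definition cyc_tour w := exists x U y V D D',
  [/\ w = x :: U ++ y :: V, dr y = dinv (dr x), tour D U /\ dinv (dr x) \notin D,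
      tour D' V /\ dr x \notin D' & U = [::] \/ V = [::] -> lp x != lp y].

Lemma cyc_tour_leaf x U y D (V : seq letter) :
  tour D U -> (U = [::] \/ V = [::] -> lp x != lp y) -> leaf D x y.
Proof.
move=> tU h; rewrite /leaf (tour_nil tU); case: eqP => //= eU.
by apply: h; left.
Qed.

(** The base point moves across the first edge, and [y :: V] followed by [x] becomes an excursion
    from the new one. *)
Lemma cyc_tour_rot1 x w : cyc_tour (x :: w) -> cyc_tour (rcons w x).
Proof.
move=> [_ [U [y [V [D [D' [[<- ->] ey [tU nD] [tV nD'] lf]]]]]]].
have lf' : V = [::] \/ U = [::] -> lp y != lp x by rewrite eq_sym => -[]; auto.
have yx : dr x = dinv (dr y) by rewrite ey dinvK.
have hy : exc y D' V x.
  split=> //; first by rewrite -yx.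
  exact: cyc_tour_leaf lf'.
case: tU nD lf lf' => {D U} [|x1 U1 y1 V1 D1 D2 ey1 tU1 nD1 lf1 tV1 nD2] nD lf lf'.
  exists y, V, x, [::], D', set0; split=> //; first by rewrite /= cats1.
  - by rewrite -yx.
  - by split; [exact: tour0 | rewrite inE].
move: nD; rewrite in_setU1 negb_or => /andP[nx1 nD2'].
exists x1, U1, y1, (V1 ++ y :: V ++ [:: x]), D1, (D2 :|: [set dr y]); split=> //.
- by rewrite -cats1 /= -!catA.
- split; last by rewrite !inE negb_or nD2 ey eq_sym.
  apply: tour_cat tV1 (exc_tour hy) _.
  by rewrite disjoint_sym disjoints1 ey.
case=> [e|]; last by case: (V1).
by move: lf1; rewrite /leaf (tour_nil tU1) e.
Qed.

Lemma cyc_tour_rot p q : cyc_tour (p ++ q) -> cyc_tour (q ++ p).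
Proof.
elim: p q => [|x p IH] q; first by rewrite cats0.
by rewrite -cat_rcons cat_cons => /cyc_tour_rot1; rewrite rcons_cat => /IH.
Qed.

Lemma cyc_tour_tour w : cyc_tour w -> exists D, tour D w.
Proof.
move=> [x [U [y [V [D [D' [-> ey [tU nD] [tV nD'] lf]]]]]]].
by exists (dr x |: D'); apply: tourS tV nD' => //; [exact: tU | exact: nD | exact: cyc_tour_leaf lf].
Qed.

Lemma cyc_tour_lit x w : cyc_tour (x :: w) ->
  (exists u t, lit (x :: w) (edge_of u t) /\ hd u = Some (dr x)) /\
  (exists u t, lit (x :: w) (edge_of u t) /\ hd u != Some (dr x)).
Proof.
move=> [_ [U [y [V [D [D' [[<- ->] ey [tU nD] [tV nD'] lf]]]]]]].
have lf' : V = [::] \/ U = [::] -> lp y != lp x by rewrite eq_sym => -[]; auto.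
have yx : dr x = dinv (dr y) by rewrite ey dinvK.
have hx : exc x D U y by split=> //; apply: cyc_tour_leaf lf.
have hy : exc y D' V x.
  split=> //; first by rewrite -yx.
  exact: cyc_tour_leaf lf'.
split.
  by have [u [t [h1 h2]]] := exc_lit hx (tour_avoids tV nD'); exists u, t.
have [|u [t [h1 h2]]] := exc_lit (V := U) hy.
  by rewrite ey; apply: tour_avoids tU nD.
exists (ltr (dr x) * u), t; split.
  have px : pos (x :: U) = ltr (dr x) by rewrite pos_cons (tour_pos tU) mulg1.
  have := h2; rewrite -cat_cons (@lit_rot (x :: U) (y :: V)) ?cat_cons ?px ?shift_edge //.
  by rewrite pos_cons (tour_pos tV) mulg1 ey -ltrV mulgV.
by rewrite yx hd_tail.
Qed.

(** As [w] is closed, conjugation by [K] merely translates its lamps by [pos K]. Each edge of the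
    tour has lit lamps on both sides, so the translated oriented edge is forced for [v] on whichever
    side the base point lies. *)
Lemma cyc_tour_min w : cyc_tour w -> qmin w.
Proof.
move=> cw v [K [ep el]]; have [D tw] := cyc_tour_tour cw; have w1 := tour_pos tw.
have v1 : pos v = 1.
  by apply: (mulIg (pos K)); move: ep; rewrite !pos_cat w1 mulg1 mul1g.
have lv e : lit v e = lit w (shift (pos K)^-1 e).
  have := el e; rewrite !lit_cat v1 invg1 shift1 addbC => /(congr1 (addb (lit K e))).
  by rewrite !addKb.
have lw : lin set0 set0 w by apply: tour_lin tw _ _; rewrite -setI_eq0 ?setI0 ?set0I.
have [uw _] := lin_forced (leqnn _) lw.
rewrite -(size_dedges 1 w) -(size_dedges 1 v) -(size_map (dshift (pos K))).
apply: uniq_leq_size => [|_ /mapP[[k s] h ->]]; first by rewrite map_inj_uniq //; apply: dshift_inj.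
apply: forced_cross; have [p [x [q [ew -> ->]]]] := mem_dedges h.
have := cw; rewrite ew => /cyc_tour_rot/cyc_tour_lit[[u1 [t1 [l1 h1]]] [u2 [t2 [l2 h2]]]].
have lvw u t : lit (x :: q ++ p) (edge_of u t) -> lit v (edge_of (pos K * pos p * u) t).
  rewrite lv shift_edge -mulgA mulKg ew -[x :: _]/((x :: q) ++ p) (lit_rot _ (p := p)).
    by rewrite shift_edge.
  by rewrite -pos_cat -ew.
rewrite /dshift /forced v1 mulg1.
have [e|ne] := eqVneq (hd (pos K * pos p)^-1) (Some (dr x)).
  by apply: Or33; split=> //; exists (pos K * pos p * u2), t2; rewrite mulKg; split=> //; apply: lvw.
by apply: Or32; split=> //; exists (pos K * pos p * u1), t1; rewrite mulKg; split=> //; apply: lvw.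
Qed.

(* The walks going once around the quotient of the tree by their end point, when the directions
   in [F] are used at the base point by the rest of the cyclic word. They may make an excursion
   first ([hypE]), start in a branch hanging off the axis ([hypH]), or start on the axis
   ([hypA]). *)
Inductive hyp : {set dir} -> seq letter -> Prop :=
  | hypE (F : {set dir}) x D X y W : exc x D X y -> dr x \notin F -> hyp (dr x |: F) W ->
      hyp F (x :: X ++ y :: W)
  | hypH (F D : {set dir}) x W y V : dr y = dinv (dr x) -> dr x \notin F -> dr x \notin D ->
      [disjoint D & F] -> leaf (D :|: F) x y -> hyp [set dinv (dr x)] W -> tour D V ->
      hyp F (x :: W ++ y :: V)
  | hypA (F : {set dir}) x W : dr x \notin F -> lin (dr x |: F) [set dinv (dr x)] W ->
      hyp F (x :: W).

Lemma lin_subset (F F' : {set dir}) U w : F' \subset F -> lin F U w -> lin F' U w.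
Proof.
move=> sF; elim=> {U w} [U dF|U x D X y W hx nU _ IH|U x W nU _ IH].
- by apply: lin0; apply: disjointWl dF.
- exact: linE hx nU IH.
exact: linS nU IH.
Qed.

Lemma lin_cat_step F x U v w : lin [set dr x] U v -> lin F [set dinv (dr x)] w ->
  lin F U (v ++ x :: w).
Proof.
move=> lv lw; elim: lv => {U v} [U|U z D X y W hz nU _ IH|U z W nU _ IH].
- by rewrite disjoints1 => nU; apply: linS nU lw.
- by rewrite -cat_cons -catA; apply: linE hz nU IH.
exact: linS nU IH.
Qed.

Lemma lin_cat_tour (F G U : {set dir}) v w : [disjoint G & F] -> lin (G :|: F) U v -> tour F w ->
  lin G U (v ++ w).
Proof.
move=> dGF lv tw; elim: lv => {U v} [U|U z D X y W hz nU _ IH|U z W nU _ IH].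
- rewrite disjointsU => /andP[dG dF]; apply: tour_lin tw dF _.
  by rewrite disjoint_sym disjointsU disjoint_sym dG disjoint_sym.
- by rewrite -cat_cons -catA; apply: linE hz nU IH.
exact: linS nU IH.
Qed.

Definition wpow (w : seq letter) n := flatten (nseq n w).

Lemma qeq_wpow v k w n : qeq (v ++ k) (k ++ w) -> qeq (wpow v n ++ k) (k ++ wpow w n).
Proof.
move=> h; elim: n => [|n IH]; first by rewrite /= cats0.
rewrite /wpow /= -!catA; apply: qeq_trans (qeq_catl v IH) _.
by rewrite !catA; apply: qeq_catr.
Qed.

Lemma size_wpow w n : size (wpow w n) = (n * size w)%N.
Proof. by rewrite size_flatten /shape map_nseq sumn_nseq mulnC. Qed.

(* The powers of a cyclically reduced word are geodesic, so its length is the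
   translation length, which is a conjugacy invariant. *)
Lemma cyc_lin_min x w : lin [set dr x] [set dinv (dr x)] w -> qmin (x :: w).
Proof.
move=> lw v [k h]; rewrite leqNgt; apply/negP => lt.
have lp n : lin set0 [set dinv (dr x)] (w ++ wpow (x :: w) n).
  elim: n => [|n IH]; first by rewrite cats0; apply: lin_subset (sub0set _) lw.
  exact: lin_cat_step.
(* Conjugating costs [2 * size k] letters in total; saving one letter in each of more than
   [2 * size k] periods would beat a geodesic. *)
pose n := (size k + size k).+1.
have lpow : lin set0 set0 (wpow (x :: w) n) by apply: linS (lp _); rewrite inE.
have q : qeq (winv k ++ wpow v n ++ k) (wpow (x :: w) n).
  apply: qeq_trans (qeq_catl _ (qeq_wpow _ h)) _; rewrite catA.
  exact: (qeq_cat (qeq_winv k)).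
have := lin_geodesic lpow (proj1 q) (proj2 q).
rewrite !size_cat !size_wpow size_rev size_map => /(leq_trans (leq_mul (leqnn n) lt)).
by rewrite mulnS (addnC (n * size v)%N) addnA leq_add2r ltnn.
Qed.

(** The tour [E] stores what has been rotated to the end of the cyclic word, and [F] its directions.
    Excursions, and the edges leading from the base point to the axis together with everything
    hanging behind them, are rotated into [E] until the word starts on the axis, where [cyc_lin_min]
    applies. *)
Lemma hyp_min F v E : hyp F v -> tour F E -> qmin (v ++ E).
Proof.
move=> h; elim: h E => {F v} [F x D X y W hx nF _ IH|F D x W y V ey nF nD dD lf _ IH tV|
  F x W nF lW] E tE.
- rewrite -cat_cons -[y :: W]cat1s !catA -catA; apply: qmin_rot; rewrite -catA; apply: IH.
  rewrite setUC; apply: tour_cat tE _ _; first by rewrite cat_cons; apply: exc_tour hx.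
  by rewrite disjoint_sym disjoints1.
- rewrite -cat1s -!catA; apply: qmin_rot; rewrite -!catA; apply: IH.
  have ty : exc y (D :|: F) (V ++ E) x.
    split; rewrite ?ey ?dinvK //; first exact: tour_cat.
      by rewrite inE negb_or nD.
    by move: lf; rewrite /leaf (eq_sym (lp x)).
  by move: (exc_tour ty); rewrite ey catA.
apply: cyc_lin_min; apply: (@lin_cat_tour F) => //.
by rewrite disjoints1.
Qed.

(** * Shortening *)

(* A nonempty word can absorb the central involution of the extension, the empty one cannot. *)
Definition qmin1 w := forall v, v != [::] -> qconj v w -> size w <= size v.

Lemma qmin1_rot p q : qmin1 (p ++ q) -> qmin1 (q ++ p).
Proof.
move=> h v nv hv; rewrite size_cat addnC -size_cat; apply: h => //.
exact: qconj_trans hv (qconj_rot _ _).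
Qed.

Lemma qmin1_rotE p q v w : qmin1 v -> v = p ++ q -> w = q ++ p -> qmin1 w.
Proof. by move=> h ev ->; rewrite ev in h; apply: qmin1_rot. Qed.

Ltac catnorm := do ?[rewrite -catA | progress rewrite /=]; done.

(** The word is cut at the first entry into the branch; by [hd_cross] this entry happens from the
    vertex 1 along [d]. *)
Lemma crossP d w : avoids d w \/ exists U y V,
  [/\ w = U ++ y :: V, pos U = 1, dr y = d & avoids d U].
Proof.
case: (boolP [exists n : 'I_(size w).+1, hd (pos (take n w)) == Some d]) => [|nx]; last first.
  left=> n; have [le|lt] := leqP n (size w).
    by apply: contraNN nx => e; apply/existsP; exists (Ordinal (le : n < (size w).+1)).
  rewrite take_oversize 1?ltnW // -[w]take_size.
  by apply: contraNN nx => e; apply/existsP; exists ord_max.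
case/existsP=> -[m /= lm] hm; right.
have ex : exists n, hd (pos (take n w)) == Some d by exists m.
case: (ex_minnP ex) => -[|n] hn mn; first by rewrite take0 in hn.
have lt : n < size w by apply: leq_trans (mn _ hm) _; rewrite -ltnS.
case: w lt hn mn {ex m lm hm} => // z0 w0; set w := z0 :: w0 => lt hn mn.
have ea : avoids d (take n w).
  move=> k; have [le|lk] := leqP k n.
    by rewrite take_takel //; apply/negP => /mn; rewrite ltnNge le.
  by rewrite take_oversize ?size_takel 1?ltnW //; apply/negP => /mn; rewrite ltnn.
move: hn; rewrite (take_nth z0) // -cats1 pos_cat /= mulg1 => /eqP hn.
have [|p1 e1] := hd_cross _ hn; first by have := ea n; rewrite take_takel.
exists (take n w), (nth z0 w n), (drop n.+1 w); split=> //.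
by rewrite -drop_nth // cat_take_drop.
Qed.

Lemma tour_split D w d : tour D w -> d \in D -> exists A x U y B,
  [/\ w = A ++ x :: U ++ y :: B, dr x = d, dr y = dinv d & [/\ pos A = 1, pos U = 1 & pos B = 1]].
Proof.
elim=> {D w} [|x U y V D D' ey tU _ nD lf tV IH nD']; first by rewrite inE.
rewrite in_setU1 => /orP[/eqP->|/IH[A [x1 [U1 [y1 [B [-> e1 e2 [A1 U11 B1]]]]]]]].
  by exists [::], x, U, y, V; rewrite (tour_pos tU) (tour_pos tV).
exists (x :: U ++ y :: A), x1, U1, y1, B; split=> //; first by catnorm.
by rewrite pos_exc // (tour_pos tU).
Qed.

Lemma exc_of_tour D x U y V : tour D (x :: U ++ y :: V) -> pos U = 1 -> dr y = dinv (dr x) ->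
  avoids (dinv (dr x)) U -> exists D1 D2,
  [/\ exc x D1 U y, tour D2 V, dr x \notin D2 & D = dr x |: D2].
Proof.
move=> h U1 ey aU; inversion h as [|x' U' y' V' D1 D2 ey' tU' nD1 lf tV' nD2 eD [ex eUV]]; subst x'.
have [e1 e2 e3] := return_uniq eUV (tour_pos tU') U1 ey' ey (tour_avoids tU' nD1) aU.
by subst; exists D1, D2.
Qed.

Lemma tour_cat_inv D D1 D2 v w : tour D (v ++ w) -> tour D1 v -> tour D2 w ->
  D = D1 :|: D2 /\ [disjoint D1 & D2].
Proof.
move=> h tv tw; elim: tv D h => {D1 v} [|x U y V E E' ey tU _ nE lf tV IH nE'] D h.
  by rewrite set0U -setI_eq0 set0I; split=> //; apply: tour_exact tw.
rewrite cat_cons -catA in h.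
have [_ [D2' [_ /IH[-> dE] n2 ->]]] := exc_of_tour h (tour_pos tU) ey (tour_avoids tU nE).
by rewrite setUA disjointsU1 dE andbT; split=> //; move: n2; rewrite inE negb_or => /andP[].
Qed.

(** A closed walk fails to be a tour through a dead end without effect or through two excursions in
    the same direction; in both situations two letters can be saved. *)
Lemma tour_or_shorten w : pos w = 1 ->
  (exists D, tour D w) \/ exists2 w', qeq w' w & size w' < size w.
Proof.
have [n] := ubnP (size w); elim: n w => // n IH [|x w]; first by left; exists set0; apply: tour0.
rewrite ltnS => sz w1.
have [aw|[U [y [V [ew U1 ey aU]]]]] := crossP (dinv (dr x)) w.
  have /hd_ltrM : hd (pos w) != Some (dinv (dr x)) by have := aw (size w); rewrite take_size.
  by rewrite -pos_cons w1.
have V1 : pos V = 1 by move: w1; rewrite ew pos_exc.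
have sU : size U < n by apply: leq_trans sz; rewrite /= ltnS ew size_cat leq_addr.
have sV : size V < n by apply: leq_trans sz; rewrite /= ltnS ew size_cat /= addnS leqW // leq_addl.
have [[D' tV]|[V' qV lV]] := IH V sV V1; last first.
  right; exists (x :: U ++ y :: V'); last by rewrite /= ew !size_cat /= ltnS ltn_add2l ltnS.
  rewrite ew -[x :: _ ++ y :: V']/((x :: U) ++ [:: y] ++ V') -[x :: _ ++ y :: V]/((x :: U) ++ [:: y] ++ V).
  by apply: qeq_catl; apply: qeq_catl.
have [[D tU]|[U' qU lU]] := IH U sU U1; last first.
  right; exists (x :: U' ++ y :: V); last by rewrite /= ew !size_cat ltnS ltn_add2r.
  rewrite ew -[x :: U' ++ _]/([:: x] ++ U' ++ y :: V) -[x :: U ++ _]/([:: x] ++ U ++ y :: V).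
  by apply: qeq_catl; apply: qeq_catr.
have nD : dinv (dr x) \notin D.
  by apply/negP => /(tour_hd tU)[m e]; have := aU m; rewrite e eqxx.
have [lf|] := boolP (leaf D x y); last first.
  rewrite negb_or !negbK (tour_nil tU) => /andP[/eqP eU /eqP elp].
  right; exists V; last by rewrite /= ew eU /= ltnW.
  by rewrite ew eU; split=> [|e]; rewrite ?pos_exc ?lit_exc //= elp addbb.
have [|nD'] := boolP (dr x \in D'); last by left; exists (dr x |: D'); rewrite ew; apply: (tourS ey tU).
case/(tour_split tV) => A [x1 [U' [y1 [B [eV ex1 ey1 [A1 U'1 B1]]]]]].
(* Two excursions through one edge are merged; the new outgoing letter collects the switches of [x],
   [y] and [x1]. *)
right; exists ((dr x, lp x (+) lp y (+) lp x1, ep x) :: (U ++ U') ++ y1 :: A ++ B); last first.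
  by rewrite /= ew eV; do ?rewrite size_cat /=; lia.
have UU1 : pos (U ++ U') = 1 by rewrite pos_cat U1 U'1 mulg1.
have ey1' : dr y1 = dinv (dr x1) by rewrite ex1.
rewrite ew eV; split=> [|e].
  by rewrite !pos_exc // !pos_cat A1 !mul1g pos_exc.
rewrite !lit_exc // !lit_cat U1 A1 invg1 !shift1 lit_exc // ex1 [dr _]/= [lp (_, _, _)]/=.
case: (e == _); rewrite ?andbT ?andbF; case: (lp x); case: (lp y); case: (lp x1);
case: (lp y1); case: (lit U _); case: (lit U' _); case: (lit A _); case: (lit B _) => //.
Qed.

Lemma qmin1_closed u v : qmin1 (u ++ v) -> v != [::] -> pos u = 1 -> exists D, tour D u.
Proof.
move=> h nv /tour_or_shorten[//|[u' qu lt]].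
suff : size (u ++ v) <= size (u' ++ v) by rewrite !size_cat leq_add2r leqNgt lt.
apply: h; first by case: (u') => //; rewrite cat0s.
by apply: qconj_eq; apply: qeq_catr.
Qed.

(** Leaving twice through an edge with a return in between wastes two letters: [V] can be done
    before, and the edge crossed once with the three switches combined. Applied to rotations, this
    gives most of the structure of minimal words. *)
Lemma qmin1_norep x U y V x' W : qmin1 (x :: U ++ y :: V ++ x' :: W) -> pos U = 1 -> pos V = 1 ->
  dr y = dinv (dr x) -> dr x' = dr x -> False.
Proof.
move=> h U1 V1 ey ex'.
suff : size (x :: U ++ y :: V ++ x' :: W) <=
    size (V ++ (dr x, lp x (+) lp y (+) lp x', ep x) :: U ++ W).
  by do ?rewrite size_cat /=; lia.
apply: h; first by case: (V).
apply: qconj_eq; split=> [|e].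
  by rewrite pos_exc // !pos_cat V1 !mul1g !pos_cons pos_cat U1 mul1g ex'.
rewrite lit_cat lit_exc // lit_cat V1 invg1 shift1 /= lit_cat U1 invg1 shift1 ex'.
by case: (e == _); case: (lp x); case: (lp y); case: (lp x') => //=;
  case: (lit U _); case: (lit V _); case: (lit W _).
Qed.

Lemma qmin1_exc x U y V : qmin1 (x :: U ++ y :: V) -> V != [::] -> pos U = 1 ->
  dr y = dinv (dr x) -> avoids (dinv (dr x)) U -> exists D, exc x D U y.
Proof.
move=> h nV U1 ey aU; have [||D tD] := @qmin1_closed (x :: U ++ [:: y]) V _ nV.
- by rewrite cat_cons -catA.
- by rewrite pos_exc.
by have [D1 [_ [h1 _ _ _]]] := exc_of_tour tD U1 ey aU; exists D1.
Qed.

Lemma qmin1_tour_disjoint D E u v w : qmin1 (u ++ v ++ w) -> w != [::] ->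
  tour D u -> tour E v -> [disjoint D & E].
Proof.
rewrite catA => h nw tu tv; have [|F tuv] := qmin1_closed h nw.
  by rewrite pos_cat (tour_pos tu) (tour_pos tv) mulg1.
by have [] := tour_cat_inv tuv tu tv.
Qed.

(** * Minimal words with nontrivial end point *)

Section Axis.
Variables (F : {set dir}) (E : seq letter) (s0 : dir).
Hypotheses (tE : tour F E) (nF : s0 \notin F).

(** In the cyclic word [P x Z W E], [Z] is the tour already made at the vertex reached by [x], [W]
    remains to be parsed, and [E] is the tour at the base point. A step of [W] violating [lin] would
    reuse a direction at its vertex; a suitable rotation turns this into a case of [qmin1_norep] or
    [qmin1_tour_disjoint]. *)
Lemma axis_lin n P x Z W (D : {set dir}) : size W < n ->
  qmin1 (P ++ x :: Z ++ W ++ E) -> tour D Z -> dinv (dr x) \notin D -> avoids (dinv (dr x)) W ->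
  (exists x0 R, P ++ [:: x] = x0 :: R /\ dr x0 = s0) ->
  hd (pos (P ++ [:: x]))^-1 = Some (dinv (dr x)) ->
  hd (pos (P ++ x :: Z ++ W))^-1 != Some s0 ->
  lin (s0 |: F) (dinv (dr x) |: D) W.
Proof.
elim: n P x Z W D => // n IH P x Z W D sz qm tZ nD aW [x0 [R [eP ex0]]] hP hh.
have Z1 := tour_pos tZ; have E1 := tour_pos tE.
case: W sz qm aW hh => [|x' W] sz qm aW hh.
  (* The last vertex is also the base point of the next period, so the directions used at both must
     be disjoint, the two directions of the axis included. *)
  rewrite cat0s in qm; apply: lin0; rewrite disjointsU1 in_setU1 !negb_or.
  rewrite (disjoint_sym (mem F)) disjointsU1 -andbA; apply/and4P; split.
  - apply/negP => /eqP e; move: hh; rewrite e -cat1s catA pos_cat cats0 Z1 mulg1 hP.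
    by rewrite eqxx.
  - apply/negP => /(tour_split tZ)[A [x1 [U1 [y1 [B [eZ ex1 ey1 [A1 U11 B1]]]]]]].
    apply: (@qmin1_norep x1 U1 y1 (B ++ E) x0 (R ++ A)) => //.
    + apply: (qmin1_rotE (p := P ++ x :: A) (q := x1 :: U1 ++ y1 :: B ++ E)) qm _ _.
        by rewrite eZ; catnorm.
      by rewrite -[P ++ x :: A]/(P ++ [:: x] ++ A) [P ++ _ ++ A]catA eP; catnorm.
    + by rewrite pos_cat B1 E1 mulg1.
    + by rewrite ex1.
    by rewrite ex1.
  - apply/negP => /(tour_split tE)[A [x1 [U1 [y1 [B [eE ex1 ey1 [A1 U11 B1]]]]]]].
    apply: (@qmin1_norep x (Z ++ A) x1 U1 y1 (B ++ P)) => //.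
    + apply: (qmin1_rotE (p := P) (q := x :: Z ++ E)) qm _ _ => //.
      by rewrite eE; catnorm.
    + by rewrite pos_cat Z1 A1 mulg1.
    by rewrite ey1 dinvK.
  apply: (@qmin1_tour_disjoint D F Z E (P ++ [:: x])) => //.
  - by apply: (qmin1_rotE (p := P ++ [:: x]) (q := Z ++ E)) qm _ _; catnorm.
  by rewrite eP.
have nx' : dr x' != dinv (dr x) by have := aW 1%N; rewrite /= take0 /= mulg1 hd_ltr.
have [aW'|[U [y' [W' [eW U1 ey' aU]]]]] := crossP (dinv (dr x')) W.
  apply: linS.
    rewrite in_setU1 negb_or nx'; apply/negP => /(tour_split tZ).
    move=> [A [x1 [U1 [y1 [B [eZ ex1 ey1 [A1 U11 B1]]]]]]].
    apply: (@qmin1_norep x1 U1 y1 B x' (W ++ E ++ P ++ x :: A)) => //; last by rewrite ex1.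
    apply: (qmin1_rotE (p := P ++ x :: A) (q := x1 :: U1 ++ y1 :: B ++ x' :: W ++ E)) qm _ _.
      by rewrite eZ; catnorm.
    by catnorm.
  rewrite -[[set dinv (dr x')]]setU0; apply: (IH (P ++ x :: Z) x' [::]) => //.
  - by move: qm; do ?[rewrite -catA | progress rewrite /=].
  - exact: tour0.
  - by rewrite inE.
  - exists x0, (R ++ Z ++ [:: x']); split=> //.
    by rewrite -cat_cons -eP; catnorm.
  - rewrite pos_cat invgM [pos [:: _]]/= mulg1 ltrV hd_ltrM //.
    rewrite -cat1s catA pos_cat Z1 mulg1 hP dinvK (inj_eq Some_inj) eq_sym.
    exact: nx'.
  by move: hh; do ?[rewrite -catA | progress rewrite /=].
have [||D' hx'] := qmin1_exc (V := W' ++ E ++ P ++ x :: Z) _ _ U1 ey' aU.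
- apply: (qmin1_rotE (p := P ++ x :: Z) (q := x' :: W ++ E)) qm _ _; first by catnorm.
  by rewrite eW; catnorm.
- by case: (W') => //; case: (E) => //; case: (P).
have tx' := exc_tour hx'.
have dx' : [disjoint D & [set dr x']].
  apply: (@qmin1_tour_disjoint _ _ Z _ (W' ++ E ++ P ++ [:: x])) tZ tx'.
    apply: (qmin1_rotE (p := P ++ [:: x]) (q := Z ++ (x' :: W) ++ E)) qm _ _; first by catnorm.
    by rewrite eW; catnorm.
  by rewrite eP; case: (W') => //; case: (E).
rewrite eW; apply: (linE hx').
  by rewrite in_setU1 negb_or nx' /=; move: dx'; rewrite disjoint_sym disjoints1.
rewrite setUCA (setUC [set dr x']); apply: (IH P x (Z ++ x' :: U ++ [:: y'])) => //.
- by move: sz; rewrite eW /= size_cat /=; lia.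
- by move: qm; rewrite eW; do ?[rewrite -catA | progress rewrite /=].
- exact: tour_cat.
- by rewrite !inE negb_or nD eq_sym.
- apply: (@avoids_catr _ (x' :: U ++ [:: y'])); first by rewrite pos_exc.
  by move: aW; rewrite eW cat_cons -catA.
- by exists x0, R.
by move: hh; rewrite eW; do ?[rewrite -catA | progress rewrite /=].
Qed.
End Axis.

(** The rule of [hyp] is read off the start: a return through the first edge is an excursion.
    Otherwise the end point begins with [dr x], and the base point hangs off the axis or lies on it
    according to whether the end point finishes with the inverse of [dr x]. *)
Lemma qmin1_hyp n (F : {set dir}) Y E : size Y < n -> tour F E -> pos Y != 1 ->
  qmin1 (Y ++ E) -> hyp F Y.
Proof.
elim: n F Y E => // n IH F [|x Y] E; first by move=> _ _ /eqP.
rewrite ltnS => sz tE nY1 qm; have E1 := tour_pos tE.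
have [aY|[U [y [Y' [eY U1 ey aU]]]]] := crossP (dinv (dr x)) Y; last first.
  have nY' : Y' != [::].
    by apply: contraNneq nY1 => e; rewrite eY e pos_exc.
  have [||D hx] := qmin1_exc (V := Y' ++ E) _ _ U1 ey aU.
  - by move: qm; rewrite eY cat_cons -catA.
  - by case: (Y') nY'.
  have tx := exc_tour hx.
  have dx : [disjoint F & [set dr x]].
    apply: (@qmin1_tour_disjoint _ _ E (x :: U ++ [:: y]) Y') => //.
    by apply: (qmin1_rotE (p := x :: Y) (q := E)) qm _ _ => //; rewrite eY; catnorm.
  rewrite eY; apply: (hypE hx).
    by move: dx; rewrite disjoint_sym disjoints1.
  apply: (IH _ _ (E ++ x :: U ++ [:: y])).
  - by move: sz; rewrite eY /= size_cat /=; lia.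
  - by rewrite setUC; apply: tour_cat.
  - by move: nY1; rewrite eY pos_exc.
  apply: (qmin1_rotE (p := x :: U ++ [:: y]) (q := Y' ++ E)) qm _ _; last by catnorm.
  by rewrite eY; catnorm.
have nF : dr x \notin F.
  apply/negP => /(tour_split tE)[A [x1 [U1 [y1 [B [eE ex1 ey1 [A1 U11 B1]]]]]]].
  apply: (@qmin1_norep x1 U1 y1 B x (Y ++ A)) => //; last by rewrite ex1.
  apply: (qmin1_rotE (p := x :: Y ++ A) (q := x1 :: U1 ++ y1 :: B)) qm _ _; last by catnorm.
  by rewrite eE; catnorm.
have hY : hd (pos (x :: Y)) = Some (dr x).
  by rewrite pos_cons hd_ltrM //; have := aY (size Y); rewrite take_size.
have [hang|axis] := eqVneq (hd (pos (x :: Y))^-1) (Some (dr x)); last first.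
  apply: hypA => //; rewrite -[[set dinv (dr x)]]setU0.
  apply: (axis_lin (E := E) (n := (size Y).+1) tE nF (P := [::]) (Z := [::])) => //.
  - exact: tour0.
  - by rewrite inE.
  - by exists x, [::].
set h := pos (x :: Y) in hang hY nY1.
(* Since [h] finishes with the inverse of [dr x], the walk has to pass through the edge from
   [h * ltr (dr x)] to [h]; what follows this crossing is closed. *)
have /mem_dedges[P [y [T [eY eP ey]]]] : (h * ltr (dr x), dinv (dr x)) \in dedges 1 (x :: Y).
  apply: cross; rewrite ?mulg1 invgM ltrV ?mul1g -?mulgA; first exact: hd_tail.
  by rewrite -/h mulVg mulg1.
case: P eP eY => [|x' Y1] eP [ex' eY].
  by move: hY; rewrite -[h](mulgK (ltr (dr x))) eP mul1g ltrV hd_ltr => -[] /eqP; rewrite (negPf (dinv_neq _)).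
subst x'; move: eP; rewrite pos_cons => eP.
have T1 : pos T = 1.
  apply: (mulgI (pos Y1 * ltr (dr y))); apply: (mulgI (ltr (dr x))).
  rewrite mulg1 -mulgA -[_ * pos T]/(pos (y :: T)) -pos_cat -pos_cons -eY -/h.
  by rewrite mulgA -eP -ey -ltrV mulgK.
have nY1' : pos Y1 != 1.
  apply: contraNneq nY1 => e; apply/eqP; apply: (mulIg (ltr (dr x))).
  by rewrite eP e mulg1 mul1g.
have Y1n : Y1 != [::] by apply: contraNneq nY1' => ->.
have [||D tT] := @qmin1_closed T (E ++ x :: Y1 ++ [:: y]) _ _ T1.
- by apply: (qmin1_rotE (p := x :: Y1 ++ [:: y]) (q := T ++ E)) qm _ _; rewrite ?eY; catnorm.
- by case: (E).
have dD : [disjoint D & F].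
  apply: (@qmin1_tour_disjoint _ _ T E (x :: Y1 ++ [:: y])) => //.
  by apply: (qmin1_rotE (p := x :: Y1 ++ [:: y]) (q := T ++ E)) qm _ _; rewrite ?eY; catnorm.
have nD : dr x \notin D.
  apply/negP => /(tour_split tT)[A [x1 [U1 [y1 [B [eT ex1 ey1 [A1 U11 B1]]]]]]].
  apply: (@qmin1_norep x1 U1 y1 (B ++ E) x (Y1 ++ y :: A)) => //.
  - apply: (qmin1_rotE (p := x :: Y1 ++ y :: A) (q := x1 :: U1 ++ y1 :: B ++ E)) qm _ _; last by catnorm.
    by rewrite eY eT; catnorm.
  - by rewrite pos_cat B1 E1 mulg1.
  - by rewrite ex1.
have lf : leaf (D :|: F) x y.
  rewrite /leaf setU_eq0 (tour_nil tT) (tour_nil tE) -implybE; apply/implyP.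
  case/andP => /eqP eT /eqP eE; apply/negP => /eqP el.
  suff : size (x :: Y1 ++ [:: y]) <= size Y1 by rewrite /= size_cat addn1; lia.
  move: qm; rewrite eE cats0 eY eT => qm; apply: qm => //.
  apply: qconj_trans (qconj_rot [:: x] (Y1 ++ [:: y])); apply: qconj_eq.
  rewrite -catA -{1}[Y1]cats0; apply: qeq_catl.
  have ex : dr x = dinv (dr y) by rewrite -ey dinvK.
  by split=> [|e]; rewrite ?(@pos_exc y [::]) ?(@lit_exc y [::]) //= el addbb.
rewrite eY; apply: (hypH (D := D)) => //.
apply: (IH _ _ (y :: (T ++ E) ++ [:: x])) => //.
- by move: sz; rewrite eY /= size_cat /=; lia.
- have ty : exc y (D :|: F) (T ++ E) x.
    split; rewrite -?ey ?dinvK //; first exact: tour_cat.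
      by rewrite inE negb_or nD.
    by move: lf; rewrite /leaf (eq_sym (lp x)).
  by move: (exc_tour ty); rewrite -ey.
by apply: (qmin1_rotE (p := [:: x]) (q := Y ++ E)) qm _ _; rewrite ?eY; catnorm.
Qed.

Lemma qmin1_cyc_tour w D : qmin1 w -> tour D w -> w != [::] -> cyc_tour w.
Proof.
move=> qm tw; case: tw qm => // x U y V D1 D2 ey tU nD1 lf tV nD2 qm _.
exists x, U, y, V, D1, D2; split=> //.
have [eU _|nU] := eqVneq U [::].
  by move: lf; rewrite /leaf (tour_nil tU) eU.
case=> eV; first by rewrite eV in nU.
(* A single excursion without net switch of its edge: after a rotation [y] and [x] are adjacent and
   cancel. *)
apply/negP => /eqP el; move: qm; rewrite eV => qm.
suff : size (x :: U ++ [:: y]) <= size U by rewrite /= size_cat addn1; lia.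
apply: qm => //; apply: qconj_trans (qconj_rot [:: x] (U ++ [:: y])); apply: qconj_eq.
rewrite -catA -{1}[U]cats0; apply: qeq_catl.
have ex : dr x = dinv (dr y) by rewrite ey dinvK.
by split=> [|e]; rewrite ?(@pos_exc y [::]) ?(@lit_exc y [::]) //= el addbb.
Qed.

(** * The grammar *)

(** The invariant is that the edge by which the current vertex was reached leads back in a direction
    of [U]; at the end of the word [U] is disjoint from [F]. This controls the last letter of the
    end point and serves to tell the rules of [hyp] apart. *)
Lemma lin_hd F (U : {set dir}) w g d : lin F U w -> hd g^-1 = Some d -> d \in U ->
  exists2 d', hd (g * pos w)^-1 = Some d' & d' \notin F.
Proof.
move=> h; elim: h g d => {U w} [U dF|U x D X y W hx nU _ IH|U x W nU _ IH] g d hg dU.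
- exists d; first by rewrite mulg1.
  by rewrite disjoint_sym in dF; rewrite (disjointFr dF).
- have [ey _ _ _] := hx; rewrite pos_exc ?(exc_pos hx) //; apply: IH hg _.
  by rewrite in_setU1 dU orbT.
rewrite pos_cons mulgA; apply: (IH _ (dinv (dr x))); last by rewrite inE.
rewrite invgM ltrV hd_ltrM // hg dinvK (inj_eq Some_inj).
by apply: contraNneq nU => <-.
Qed.

Lemma hang_hd s g : g != 1 -> hd g != Some (dinv s) -> hd g^-1 != Some (dinv s) ->
  hd (ltr s * g * ltr (dinv s))^-1 = Some s.
Proof.
move=> g1 h1 h2; rewrite !invgM ltrV dinvK hd_ltrM // hd_mul ?invg_eq1 ?invgK ?ltrV //.
Qed.

Lemma hang_avoids W y V D d : pos W != 1 -> avoids d W -> hd (pos W)^-1 != Some d ->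
  dr y = d -> tour D V -> dinv d \notin D -> avoids d (W ++ y :: V).
Proof.
move=> W1 aW hW ey tV nD n; rewrite take_cat; case: ltnP => // _.
case: (n - size W) => [|m]; first by rewrite take0 cats0; have := aW (size W); rewrite take_size.
rewrite -[take m.+1 _]/(y :: take m V) pos_cat pos_cons ey hd_mul //.
  by have := aW (size W); rewrite take_size.
by rewrite hd_ltrM //; apply: tour_avoids tV nD _.
Qed.

Lemma hyp_hd F w : hyp F w -> [/\ pos w != 1,
  forall d, d \in F -> hd (pos w)^-1 != Some d & forall d, d \in F -> avoids d w].
Proof.
elim=> {F w} [F x D X y W hx nF _ [W1 hW aW]|F D x W y V ey nF nD dD lf _ [W1 hW aW] tV|
  F x W nF lW].
- have [ey _ _ _] := hx; rewrite pos_exc ?(exc_pos hx) //; split=> // d dF.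
    by apply: hW; rewrite in_setU1 dF orbT.
  apply: avoids_exc; [|exact: exc_pos hx|exact: exc_avoids hx|by []|].
    by apply: contraNneq nF => ->.
  by apply: aW; rewrite in_setU1 dF orbT.
- have ds : dinv (dr x) \in [set dinv (dr x)] by rewrite inE.
  have e : hd (pos (x :: W ++ y :: V))^-1 = Some (dr x).
    rewrite pos_cons pos_cat pos_cons (tour_pos tV) mulg1 mulgA ey; apply: hang_hd => //.
      by have := aW _ ds (size W); rewrite take_size.
    exact: hW.
  split=> [|d dF|d dF].
  + by apply/eqP => e1; rewrite e1 invg1 in e.
  + by rewrite e (inj_eq Some_inj); apply: contraNneq nF => ->.
  apply: avoids_cons; first by apply: contraNneq nF => ->.
  by apply: hang_avoids tV _ => //; rewrite ?dinvK //; [apply: aW | apply: hW].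
have [|d' e nd'] := lin_hd lW (g := ltr (dr x)) (d := dinv (dr x)) _ (set11 _); first by rewrite ltrV.
rewrite -pos_cons in e; move: nd'; rewrite in_setU1 negb_or => /andP[_ nd'].
split=> [|d dF|d dF].
- by apply/eqP => e1; rewrite e1 invg1 in e.
- by rewrite e (inj_eq Some_inj); apply: contraNneq nd' => ->.
apply: avoids_cons; first by apply: contraNneq nF => ->.
by apply: lin_avoids lW _; rewrite inE.
Qed.

(** The index sets of [tour], [hyp] and [lin] are stored in the nonterminals, which are finitely
    many as there are only four directions. *)
Inductive nterm := NStart | NTour of {set dir} | NHyp of {set dir} | NLin of {set dir} & {set dir}.

Definition nterm_enc (A : nterm) : unit + {set dir} + {set dir} + {set dir} * {set dir} :=
  match A with
  | NStart => inl (inl (inl tt))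
  | NTour D => inl (inl (inr D))
  | NHyp F => inl (inr F)
  | NLin F U => inr (F, U)
  end.
Definition nterm_dec (A : unit + {set dir} + {set dir} + {set dir} * {set dir}) : nterm :=
  match A with
  | inl (inl (inl tt)) => NStart
  | inl (inl (inr D)) => NTour D
  | inl (inr F) => NHyp F
  | inr (F, U) => NLin F U
  end.
Lemma nterm_encK : cancel nterm_enc nterm_dec. Proof. by case. Qed.
HB.instance Definition _ := Finite.copy nterm (can_type nterm_encK).

Definition excb x (D : {set dir}) y := [&& dr y == dinv (dr x), dinv (dr x) \notin D & leaf D x y].

Definition ruleb (A : nterm) (rhs : seq (nterm + letter)) : bool :=
  match A, rhs with
  | NStart, [::] => true
  | NStart, [:: inl (NHyp F)] => F == set0
  | NStart, [:: inr x; inr y] => [&& dr y == dinv (dr x), lp x == lp y & ep x != ep y]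
  | NStart, [:: inr x; inl (NTour D); inr y; inl (NTour D')] =>
      [&& dr y == dinv (dr x), dinv (dr x) \notin D, dr x \notin D' &
          ((D == set0) || (D' == set0)) ==> (lp x != lp y)]
  | NTour D, [::] => D == set0
  | NTour D0, [:: inr x; inl (NTour D); inr y; inl (NTour D')] =>
      [&& excb x D y, dr x \notin D' & D0 == dr x |: D']
  | NHyp F, [:: inr x; inl (NTour D); inr y; inl (NHyp F')] =>
      [&& excb x D y, dr x \notin F & F' == dr x |: F]
  | NHyp F, [:: inr x; inl (NHyp F'); inr y; inl (NTour D)] =>
      [&& dr y == dinv (dr x), dr x \notin F, dr x \notin D, [disjoint D & F],
          leaf (D :|: F) x y & F' == [set dinv (dr x)]]
  | NHyp F, [:: inr x; inl (NLin F' U)] =>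
      [&& dr x \notin F, F' == dr x |: F & U == [set dinv (dr x)]]
  | NLin F U, [::] => [disjoint F & U]
  | NLin F U, [:: inr x; inl (NTour D); inr y; inl (NLin F' U')] =>
      [&& excb x D y, dr x \notin U, F' == F & U' == dr x |: U]
  | NLin F U, [:: inr x; inl (NLin F' U')] =>
      [&& dr x \notin U, F' == F & U' == [set dinv (dr x)]]
  | _, _ => false
  end.

Definition rule_candidates n : seq (nterm * seq (nterm + letter)) :=
  [seq (p.1, val p.2) | p <- enum {: nterm * n.-tuple (nterm + letter)%type}].
Definition rules : seq (nterm * seq (nterm + letter)) :=
  [seq r <- flatten [seq rule_candidates n | n <- [:: 0; 1; 2; 4]%N] | ruleb r.1 r.2].

Lemma mem_rules A rhs : ((A, rhs) \in rules) = ruleb A rhs.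
Proof.
rewrite mem_filter; apply: andb_idr => h; rewrite /= in h.
have cand n : size rhs = n -> (A, rhs) \in rule_candidates n.
  move=> e; apply/mapP; exists (A, tcast e (in_tuple rhs)); first by rewrite mem_enum.
  by rewrite /= val_tcast.
suff sz : size rhs \in [:: 0; 1; 2; 4]%N.
  by apply/flattenP; exists (rule_candidates (size rhs)); [exact: map_f | exact: cand].
move: h {cand}; case: rhs => [|a [|b [|c [|d [|e r]]]]] //; case: A => [|D|F|F U];
  do 4?[case: a => [[|?|?|? ?]|a] //= | case: b => [[|?|?|? ?]|b] //=
       | case: c => [[|?|?|? ?]|c] //= | case: d => [[|?|?|? ?]|d] //=].
Qed.

Definition slang (w : seq letter) : Prop :=
  [\/ w = [::],
      (exists x y, [/\ w = [:: x; y], dr y = dinv (dr x), lp x = lp y & ep x != ep y]),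
      cyc_tour w
    | hyp set0 w].

Definition nlang (A : nterm) (w : seq letter) : Prop :=
  match A with
  | NStart => slang w
  | NTour D => tour D w
  | NHyp F => hyp F w
  | NLin F U => lin F U w
  end.

Definition quad (x : letter) (A : nterm) (y : letter) (B : nterm) : seq (nterm + letter) :=
  [:: inr x; inl A; inr y; inl B].

(** A rule together with a valid cut of the word into its factors. Inverting this predicate lists
    the parses that compete in the proof of determinism. *)
Inductive derive : nterm -> seq letter -> seq (nterm + letter) -> seq (seq letter) -> Prop :=
  | der_nil : derive NStart [::] [::] [::]
  | der_hyp w : hyp set0 w -> derive NStart w [:: inl (NHyp set0)] [:: w]
  | der_pair x y : dr y = dinv (dr x) -> lp x = lp y -> ep x != ep y ->
      derive NStart [:: x; y] [:: inr x; inr y] [:: [:: x]; [:: y]]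
  | der_cyc x U y V D D' : dr y = dinv (dr x) -> tour D U -> dinv (dr x) \notin D ->
      tour D' V -> dr x \notin D' -> ((D == set0) || (D' == set0) -> lp x != lp y) ->
      derive NStart (x :: U ++ y :: V) (quad x (NTour D) y (NTour D')) [:: [:: x]; U; [:: y]; V]
  | der_tour0 : derive (NTour set0) [::] [::] [::]
  | der_tour x U y V D D' : exc x D U y -> tour D' V -> dr x \notin D' ->
      derive (NTour (dr x |: D')) (x :: U ++ y :: V) (quad x (NTour D) y (NTour D'))
        [:: [:: x]; U; [:: y]; V]
  | der_hypE (F : {set dir}) x U y V D : exc x D U y -> dr x \notin F -> hyp (dr x |: F) V ->
      derive (NHyp F) (x :: U ++ y :: V) (quad x (NTour D) y (NHyp (dr x |: F)))
        [:: [:: x]; U; [:: y]; V]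
  | der_hypH (F D : {set dir}) x W y V : dr y = dinv (dr x) -> dr x \notin F -> dr x \notin D ->
      [disjoint D & F] -> leaf (D :|: F) x y -> hyp [set dinv (dr x)] W -> tour D V ->
      derive (NHyp F) (x :: W ++ y :: V) (quad x (NHyp [set dinv (dr x)]) y (NTour D))
        [:: [:: x]; W; [:: y]; V]
  | der_hypA (F : {set dir}) x W : dr x \notin F -> lin (dr x |: F) [set dinv (dr x)] W ->
      derive (NHyp F) (x :: W) [:: inr x; inl (NLin (dr x |: F) [set dinv (dr x)])] [:: [:: x]; W]
  | der_lin0 (F U : {set dir}) : [disjoint F & U] -> derive (NLin F U) [::] [::] [::]
  | der_linE F (U : {set dir}) x X y W D : exc x D X y -> dr x \notin U -> lin F (dr x |: U) W ->
      derive (NLin F U) (x :: X ++ y :: W) (quad x (NTour D) y (NLin F (dr x |: U)))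
        [:: [:: x]; X; [:: y]; W]
  | der_linS F (U : {set dir}) x W : dr x \notin U -> lin F [set dinv (dr x)] W ->
      derive (NLin F U) (x :: W) [:: inr x; inl (NLin F [set dinv (dr x)])] [:: [:: x]; W].

Local Notation symN := (symL nlang).

Lemma excbP x D U y : excb x D y -> tour D U -> exc x D U y.
Proof. by case/and3P=> /eqP ? ? ? ?; split. Qed.

Lemma matches_quad x A y B ws : matches symN (quad x A y B) ws ->
  exists U V, [/\ ws = [:: [:: x]; U; [:: y]; V], nlang A U & nlang B V].
Proof.
case: ws => [|w1 [|U [|w2 [|V [|? ?]]]]] /=; try tauto.
by move=> [-> [hU [-> [hV _]]]]; exists U, V.
Qed.

Lemma matches_pair x A ws : matches symN [:: inr x; inl A] ws ->
  exists W, ws = [:: [:: x]; W] /\ nlang A W.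
Proof.
case: ws => [|w1 [|W [|? ?]]] /=; try tauto.
by move=> [-> [hW _]]; exists W.
Qed.

Lemma ruleb_derive A rhs ws : ruleb A rhs -> matches symN rhs ws -> derive A (flatten ws) rhs ws.
Proof.
case: A => [|D0|F|F U]; case: rhs => [|a rhs] /=.
- by case: ws => // _ _; apply: der_nil.
- case: a => [[|?|F|? ?]|x] //.
    case: rhs => //= /eqP -> ; case: ws => [|w [|? ?]] /=; try tauto.
    by case=> h _; rewrite cats0; apply: der_hyp.
  case: rhs => [|[[|D|?|? ?]|y] [|[[|?|?|? ?]|y'] [|[[|D'|?|? ?]|?] [|? ?]]]] //.
    case/and4P=> /eqP ey nD nD' c /(@matches_quad x (NTour D) y' (NTour D')).
    move=> [U [V [-> tU tV]]]; rewrite /= cats0; apply: der_cyc => //; exact/implyP.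
  case/and3P=> /eqP ey /eqP el ne; case: ws => [|w1 [|w2 [|? ?]]] /=; try tauto.
  by case=> -> [-> _]; apply: der_pair.
- by move/eqP ->; case: ws => // _; apply: der_tour0.
- case: a => [[|?|?|? ?]|x] //.
  case: rhs => [|[[|D|?|? ?]|y] [|[[|?|?|? ?]|y'] [|[[|D'|?|? ?]|?] [|? ?]]]] //.
  case/and3P=> hx nD' /eqP-> /(@matches_quad x (NTour D) y' (NTour D'))[U [V [-> tU tV]]].
  by rewrite /= cats0; apply: der_tour => //; apply: excbP.
- by [].
- case: a => [[|?|?|? ?]|x] //.
  case: rhs => [|[[|D|F'|F' U]|y] [|[[|?|?|? ?]|y'] [|[[|D'|F''|? ?]|?] [|? ?]]]] //.
  + case/and3P=> hx nF /eqP-> /(@matches_quad x (NTour D) y' (NHyp _))[U [V [-> tU tV]]].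
    by rewrite /= cats0; apply: der_hypE => //; apply: excbP.
  + case/and5P=> /eqP ey nF nD dD /andP[lf /eqP->] /(@matches_quad x (NHyp _) y' (NTour D')).
    by move=> [U [V [-> tU tV]]]; rewrite /= cats0; apply: der_hypH.
  case/and3P=> nF /eqP-> /eqP-> /(@matches_pair x (NLin _ _))[W [-> lW]].
  by rewrite /= cats0; apply: der_hypA.
- by move=> dF; case: ws => // _; apply: der_lin0.
case: a => [[|?|?|? ?]|x] //.
case: rhs => [|[[|D|?|F' U']|y] [|[[|?|?|? ?]|y'] [|[[|?|?|F1 U1]|?] [|? ?]]]] //.
  case/and4P=> hx nU /eqP-> /eqP-> /(@matches_quad x (NTour D) y' (NLin _ _))[X [W [-> tX lW]]].
  by rewrite /= cats0; apply: der_linE => //; apply: excbP.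
case/and3P=> nU /eqP-> /eqP-> /(@matches_pair x (NLin _ _))[W [-> lW]].
by rewrite /= cats0; apply: der_linS.
Qed.

Lemma derive_sound A w rhs ws : derive A w rhs ws -> nlang A w.
Proof.
case=> {A w rhs ws} /=.
- exact: Or41.
- by move=> w; apply: Or44.
- by move=> x y ey el ne; apply: Or42; exists x, y.
- move=> x U y V D D' ey tU nD tV nD' c; apply: Or43; exists x, U, y, V, D, D'; split=> //.
  move=> h; apply: c; rewrite (tour_nil tU) (tour_nil tV).
  by case: h => ->; rewrite eqxx ?orbT.
- exact: tour0.
- by move=> x U y V D D' [ey tU nD lf] tV nD'; apply: tourS tU _ _ tV _.
- by move=> F x U y V D hx nF hV; apply: hypE hx nF hV.
- by move=> F D x W y V *; apply: (hypH (D := D)).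
- by move=> F x W *; apply: hypA.
- by move=> F U *; apply: lin0.
- by move=> F U x X y W D hx nU lW; apply: linE hx nU lW.
by move=> F U x W *; apply: linS.
Qed.

Lemma avoids_not_return d U y V : avoids d (U ++ y :: V) -> pos U = 1 -> dr y = d -> False.
Proof.
rewrite -cat_rcons => /avoids_prefix + U1 ed.
by rewrite -ed -cats1 pos_cat U1 mul1g -[pos _]/(ltr (dr y) * 1) mulg1 eqxx.
Qed.

(** Among the rules with a first letter, only an excursion makes the walk return through its first
    edge. A hanging start is separated from a start on the axis by the last letter of the end point.
    Excursions are cut at the first return, hanging words as in [hang_leq]. *)
Lemma derive_det A w rhs1 ws1 rhs2 ws2 :
  derive A w rhs1 ws1 -> derive A w rhs2 ws2 -> rhs1 = rhs2 /\ ws1 = ws2.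
Proof.
have exc_hang x D U y V W y' V' E : exc x D U y -> U ++ y :: V = W ++ y' :: V' ->
    hyp [set dinv (dr x)] W -> dr y' = dinv (dr x) -> tour E V' -> dr x \notin E -> False.
  move=> hx e hW ey' tV' nE; have [W1 hW1 aW] := hyp_hd hW; have ds := set11 (dinv (dr x)).
  have [ey _ _ _] := hx; apply: (@avoids_not_return (dinv (dr x)) U y V) ey.
    by rewrite e; apply: hang_avoids tV' _; rewrite ?dinvK //; [apply: aW | apply: hW1].
  exact: exc_pos hx.
have exc_step x D U y V F W : exc x D U y -> U ++ y :: V = W ->
    lin F [set dinv (dr x)] W -> False.
  move=> hx e hW; have [ey _ _ _] := hx.
  apply: (@avoids_not_return (dinv (dr x)) U y V) ey; last exact: exc_pos hx.
  by rewrite e; apply: lin_avoids hW _; rewrite inE.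
have hang_axis F x W W' y V E : W' ++ y :: V = W -> hyp [set dinv (dr x)] W' ->
    dr y = dinv (dr x) -> tour E V -> lin (dr x |: F) [set dinv (dr x)] W -> False.
  move=> e hW ey tV lW; have [W1 hW1 aW] := hyp_hd hW; have ds := set11 (dinv (dr x)).
  have [|d' hd' /negP[]] := lin_hd lW (g := ltr (dr x)) (d := dinv (dr x)) _ ds; first by rewrite ltrV.
  move: hd'; rewrite -e pos_cat pos_cons (tour_pos tV) mulg1 mulgA ey hang_hd //.
  - by case=> <-; rewrite setU11.
  - by have := aW _ ds (size W'); rewrite take_size.
  exact: hW1.
(* Both cuts happen at the same vertex. Between them the walk would step along [y1] and come back,
   which [V1] never does. *)
have hang_leq x W1 W2 y1 y2 V1 V2 D1 D2 : W1 ++ y1 :: V1 = W2 ++ y2 :: V2 ->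
    dr y1 = dinv (dr x) -> dr y2 = dinv (dr x) -> tour D1 V1 -> tour D2 V2 ->
    dr x \notin D1 -> size W2 <= size W1.
  move=> e ey1 ey2 t1 t2 n1; rewrite leqNgt; apply/negP => lt.
  have p : pos W1 = pos W2.
    apply: (mulIg (ltr (dinv (dr x)))); have := congr1 pos e.
    by rewrite !pos_cat !pos_cons ey1 ey2 (tour_pos t1) (tour_pos t2) !mulg1.
  have eW2 : W2 = W1 ++ y1 :: take (size W2 - size W1).-1 V1.
    rewrite -[LHS](take_size_cat (y2 :: V2) (erefl _)) -e take_cat ltnNge (ltnW lt) /=.
    by rewrite -{1}(prednK (n := size W2 - size W1)) ?subn_gt0.
  have : pos (y1 :: take (size W2 - size W1).-1 V1) = 1.
    by apply: (mulgI (pos W1)); rewrite mulg1 -pos_cat -eW2.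
  rewrite pos_cons ey1 => /(congr1 hd); rewrite hd_ltrM // dinvK.
  exact: tour_avoids t1 n1 _.
have hang_uniq x W1 W2 y1 y2 V1 V2 D1 D2 : W1 ++ y1 :: V1 = W2 ++ y2 :: V2 ->
    dr y1 = dinv (dr x) -> dr y2 = dinv (dr x) -> tour D1 V1 -> tour D2 V2 ->
    dr x \notin D1 -> dr x \notin D2 -> [/\ W1 = W2, y1 = y2, V1 = V2 & D1 = D2].
  move=> e ey1 ey2 t1 t2 n1 n2; have /eqP es : size W1 == size W2.
    by rewrite eqn_leq (hang_leq _ _ _ _ _ _ _ _ _ (esym e) ey2 ey1 t2 t1 n2)
      (hang_leq _ _ _ _ _ _ _ _ _ e ey1 ey2 t1 t2 n1).
  move/eqP: e; rewrite eqseq_cat // => /andP[/eqP-> /eqP[-> eV]].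
  by split=> //; apply: tour_exact t1 _; rewrite eV.
case=> {A w rhs1 ws1}.
- move=> h; inversion h as [|w hw| | | | | | | | | |]; subst => //.
  by have [/eqP] := hyp_hd hw.
- move=> w hw h; have [/eqP nw _ _] := hyp_hd hw.
  inversion h as [|w' hw'|x y ey|x U y V D D' ey tU _ tV| | | | | | | |]; subst => //.
    by case: nw; rewrite (@pos_exc x [::]).
  by case: nw; rewrite pos_exc ?(tour_pos tU) ?(tour_pos tV).
- move=> x y ey el ne h.
  inversion h as [|w' hw'|x' y' ey'|x' U y' V D D' ey' tU _ tV _ c eA [ex' ew]| | | | | | | |]; subst => //.
    by have [/eqP[]] := hyp_hd hw'; rewrite (@pos_exc x [::]).
  case: U tU ew {h} => [|? [|? ?]] // tU [eyy eV]; subst.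
  by have := c; rewrite (tour_nil tU) eqxx el eqxx => /(_ isT).
- move=> x U y V D D' ey tU nD tV nD' c h.
  inversion h as [|w' hw'|x' y' ey' el' ne' eA [ex' ew]|x' U' y' V' E E' ey' tU' nE tV' nE' c' eA [ex' ew]| | | | | | | |]; subst => //.
  + by have [/eqP[]] := hyp_hd hw'; rewrite pos_exc ?(tour_pos tU) ?(tour_pos tV).
  + case: U tU ew {h} => [|? [|? ?]] // tU [eyy eV]; subst.
    by have := c; rewrite (tour_nil tU) eqxx el' eqxx => /(_ isT).
  have [e1 e2 e3] := return_uniq ew (tour_pos tU') (tour_pos tU) ey' ey (tour_avoids tU' nE) (tour_avoids tU nD).
  by subst; rewrite (tour_exact tU tU') (tour_exact tV tV').
- by move=> h; inversion h as [| | | | |x U y V D D' hx tV nD' eD ew| | | | | |].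
- move=> x U y V D D' hx tV nD' h.
  inversion h as [| | | | |x' U' y' V' E E' hx' tV' nE' eD [ex' ew]| | | | | |]; subst.
  have [-> -> -> eV] := exc_uniq ew hx' hx; rewrite eV in tV' *.
  by rewrite (tour_exact tV tV').
- move=> F x U y V D hx nF hV h; inversion h as [| | | | | |
    F' x' U' y' V' D' hx' nF' hV' eF [ex' ew]
   |F' D' x' W y' V' ey' nF' nD' dD lf hW tV' eF [ex' ew]
   |F' x' W nF' lW eF [ex' ew]| | |]; subst.
  + by have [-> -> -> ->] := exc_uniq ew hx' hx.
  + by case: (exc_hang _ _ _ _ _ _ _ _ _ hx (esym ew) hW ey' tV' nD').
  by case: (exc_step _ _ _ _ _ _ _ hx erefl lW).
- move=> F D x W y V ey nF nD dD lf hW tV h; inversion h as [| | | | | |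
    F' x' U' y' V' D' hx' nF' hV' eF [ex' ew]
   |F' D' x' W' y' V' ey' nF' nD' dD' lf' hW' tV' eF [ex' ew]
   |F' x' W' nF' lW eF [ex' ew]| | |]; subst.
  + by case: (exc_hang _ _ _ _ _ _ _ _ _ hx' ew hW ey tV nD).
  + by have [-> -> -> ->] := hang_uniq _ _ _ _ _ _ _ _ _ ew ey' ey tV' tV nD' nD.
  by case: (hang_axis _ _ _ _ _ _ _ erefl hW ey tV lW).
- move=> F x W nF lW h; inversion h as [| | | | | |
    F' x' U' y' V' D' hx' nF' hV' eF [ex' ew]
   |F' D' x' W' y' V' ey' nF' nD' dD' lf' hW' tV' eF [ex' ew]
   |F' x' W' nF' lW' eF [ex' ew]| | |]; subst => //.
  + by case: (exc_step _ _ _ _ _ _ _ hx' erefl lW).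
  by case: (hang_axis _ _ _ _ _ _ _ erefl hW' ey' tV' lW).
- by move=> F U dF h; inversion h.
- move=> F U x X y W D hx nU lW h; inversion h as [| | | | | | | | | |
    F' U' x' X' y' W' D' hx' nU' lW' eF [ex' ew]|F' U' x' W' nU' lW' eF [ex' ew]]; subst.
  + by have [-> -> -> ->] := exc_uniq ew hx' hx.
  by case: (exc_step _ _ _ _ _ _ _ hx erefl lW').
move=> F U x W nU lW h; inversion h as [| | | | | | | | | |
    F' U' x' X' y' W' D' hx' nU' lW' eF [ex' ew]|F' U' x' W' nU' lW' eF [ex' ew]]; subst => //.
by case: (exc_step _ _ _ _ _ _ _ hx' erefl lW).
Qed.

Lemma nlang_complete A w : nlang A w -> tree_of NStart rules (inl A) w.
Proof.
have quad_tree B x U A1 y V A2 : ruleb B (quad x A1 y A2) -> tree_of NStart rules (inl A1) U ->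
    tree_of NStart rules (inl A2) V -> tree_of NStart rules (inl B) (x :: U ++ y :: V).
  rewrite -mem_rules => hr hU hV.
  have := @tree_of_rule _ _ NStart rules B _ [:: [:: x]; U; [:: y]; V] hr.
  rewrite /= cats0; apply; do ![split=> //]; exact: tree_of_letter.
have pair_tree B x A1 W : ruleb B [:: inr x; inl A1] -> tree_of NStart rules (inl A1) W ->
    tree_of NStart rules (inl B) (x :: W).
  rewrite -mem_rules => hr hW; have := @tree_of_rule _ _ NStart rules B _ [:: [:: x]; W] hr.
  by rewrite /= cats0; apply; do ![split=> //]; apply: tree_of_letter.
have nil_tree B : ruleb B [::] -> tree_of NStart rules (inl B) [::].
  by rewrite -mem_rules => hr; apply: (@tree_of_rule _ _ NStart rules B _ [::] hr).
have tour_tree D v : tour D v -> tree_of NStart rules (inl (NTour D)) v.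
  elim=> [|x U y V D1 D2 ey tU hU nD lf tV hV nD']; first by apply: nil_tree; rewrite /= eqxx.
  by apply: quad_tree hU hV; rewrite /= /excb ey eqxx nD lf nD' /=.
have exc_treeb x D U y : exc x D U y -> excb x D y.
  by case=> ey _ nD lf; rewrite /excb ey eqxx nD.
have exc_tree x D U y : exc x D U y -> tree_of NStart rules (inl (NTour D)) U.
  by case=> _ tU _ _; apply: tour_tree.
have lin_tree F U v : lin F U v -> tree_of NStart rules (inl (NLin F U)) v.
  elim=> {U v} [U dF|U x D X y W hx nU _ IH|U x W nU _ IH].
  - exact: nil_tree.
  - by apply: quad_tree (exc_tree _ _ _ _ hx) IH; rewrite /= (exc_treeb _ _ _ _ hx) nU !eqxx.
  by apply: pair_tree IH; rewrite /= nU !eqxx.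
have hyp_tree F v : hyp F v -> tree_of NStart rules (inl (NHyp F)) v.
  elim=> {F v} [F x D X y W hx nF _ IH|F D x W y V ey nF nD dD lf _ IH tV|F x W nF lW].
  - by apply: quad_tree (exc_tree _ _ _ _ hx) IH; rewrite /= (exc_treeb _ _ _ _ hx) nF !eqxx.
  - by apply: quad_tree IH (tour_tree _ _ tV); rewrite /= ey nF nD dD lf !eqxx.
  by apply: pair_tree (lin_tree _ _ _ lW); rewrite /= nF !eqxx.
case: A => [|D|F|F U] /=; [|exact: tour_tree|exact: hyp_tree|exact: lin_tree].
case=> [->|[x [y [-> ey el ne]]]|[x [U [y [V [D [D' [-> ey [tU nD] [tV nD'] c]]]]]]]|hw].
- exact: nil_tree.
- have hr : (NStart, [:: inr x; inr y]) \in rules by rewrite mem_rules /= ey el ne !eqxx.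
  apply: (@tree_of_rule _ _ NStart rules NStart _ [:: [:: x]; [:: y]] hr).
  by do ![split=> //]; apply: tree_of_letter.
- apply: quad_tree (tour_tree _ _ tU) (tour_tree _ _ tV).
  rewrite /= ey eqxx nD nD' (tour_nil tU) (tour_nil tV) /=; apply/implyP => h; apply: c.
  by case/orP: h => /eqP; auto.
have hr : (NStart, [:: inl (NHyp set0)]) \in rules by rewrite mem_rules /= eqxx.
have := @tree_of_rule _ _ NStart rules NStart _ [:: w] hr.
by rewrite /= cats0; apply; split=> //; apply: hyp_tree.
Qed.

Theorem slang_unambiguous :
  exists (m : nat) (g : cfg m #|{: letter}|), cfg_unambiguous g /\
    forall w, slang (map enum_val w) <-> cfg_language g w.
Proof.
have rule_sound A rhs ws : (A, rhs) \in rules -> matches (symL nlang) rhs ws ->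
    nlang A (flatten ws).
  by rewrite mem_rules => hr /(ruleb_derive hr); apply: derive_sound.
exists #|{: nterm}|, (grammar NStart rules); split=> [|w].
  apply: (grammar_unambiguous rule_sound) => A rhs1 rhs2 ws1 ws2.
  rewrite !mem_rules => h1 h2 m1 m2 e; apply: derive_det (ruleb_derive h1 m1) _.
  by rewrite e; apply: ruleb_derive.
exact: (@grammar_language _ _ NStart rules nlang rule_sound w nlang_complete).
Qed.

(** * The central extension *)

From mathcomp Require Import finmap.

Local Open Scope fset_scope.

Section SymmetricDifference.
Variable T : choiceType.
Implicit Types (X Y Z : {fset T}) (p : T -> bool).

Definition symd X Y := (X `\` Y) `|` (Y `\` X).

Lemma in_symd X Y e : (e \in symd X Y) = (e \in X) (+) (e \in Y).
Proof. by rewrite !inE; case: (e \in X); case: (e \in Y). Qed.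

Lemma symdA X Y Z : symd X (symd Y Z) = symd (symd X Y) Z.
Proof. by apply/fsetP => e; rewrite !in_symd addbA. Qed.
Lemma symd0 X : symd X fset0 = X.
Proof. by apply/fsetP => e; rewrite in_symd inE addbF. Qed.
Lemma sym0d X : symd fset0 X = X.
Proof. by apply/fsetP => e; rewrite in_symd inE. Qed.
Lemma symdd X : symd X X = fset0.
Proof. by apply/fsetP => e; rewrite in_symd inE addbb. Qed.

Lemma symdC X Y : symd X Y = symd Y X.
Proof. by apply/fsetP => e; rewrite !in_symd addbC. Qed.
Lemma symdKC X Y : symd Y (symd X Y) = X.
Proof. by rewrite symdC -symdA symdd symd0. Qed.
Lemma in_symd11 a b e : (e \in symd [fset a] [fset b]) = (e == a) (+) (e == b).
Proof. by rewrite in_symd !in_fset1. Qed.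

Definition parity p X := \big[addb/false]_(e <- X) p e.

Lemma parity_super p X Z : X `<=` Z ->
  parity p X = \big[addb/false]_(e <- Z) ((e \in X) && p e).
Proof.
move=> sXZ; rewrite -(big_fset_incl _ sXZ) => [|e _ /negPf-> //].
by apply: eq_big_seq => e ->.
Qed.

Lemma parity_symd p X Y : parity p (symd X Y) = parity p X (+) parity p Y.
Proof.
have s1 : symd X Y `<=` X `|` Y.
  by apply/fsubsetP => e; rewrite in_symd inE; case: (e \in X).
rewrite (parity_super p s1) (parity_super p (fsubsetUl X Y)) (parity_super p (fsubsetUr X Y)).
by rewrite -big_split /=; apply: eq_bigr => e _; rewrite in_symd andb_addl.
Qed.

Lemma parity0 p : parity p fset0 = false. Proof. by rewrite /parity big_seq_fset0. Qed.
Lemma parity1 p e : parity p [fset e] = p e. Proof. by rewrite /parity big_seq_fset1. Qed.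

Lemma eq_parity p q X : {in X, p =1 q} -> parity p X = parity q X.
Proof. exact: eq_big_seq. Qed.

Lemma parity_add p q X : parity (fun e => p e (+) q e) X = parity p X (+) parity q X.
Proof. exact: big_split. Qed.

Lemma parity_ex p X : parity p X -> exists2 e, e \in X & p e.
Proof.
move=> h; case: (boolP (has p X)) => [/hasP[e]|/hasPn n]; first by exists e.
move: h; rewrite (eq_parity (q := fun=> false)) => [|e /n/negPf//].
by rewrite /parity big1_eq.
Qed.
End SymmetricDifference.

Local Notation edge := (fgrp * bool)%type.

Definition fshift (k : fgrp) (X : {fset edge}) : {fset edge} := [fset shift k e | e in X].

Lemma shift_inj k : injective (shift k). Proof. exact: can_inj (shiftK k). Qed.

Lemma in_fshift k X e : (e \in fshift k X) = (shift k^-1 e \in X).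
Proof. by rewrite -{1}(shiftVK k e) mem_imfset //; apply: shift_inj. Qed.

Lemma fshift_symd k X Y : fshift k (symd X Y) = symd (fshift k X) (fshift k Y).
Proof. by apply/fsetP => e; rewrite !(in_fshift, in_symd). Qed.
Lemma fshiftM k l X : fshift (k * l) X = fshift k (fshift l X).
Proof. by apply/fsetP => e; rewrite !in_fshift invgM shiftM. Qed.
Lemma fshift1 X : fshift 1 X = X.
Proof. by apply/fsetP => e; rewrite in_fshift invg1 shift1. Qed.
Lemma fshift0 k : fshift k fset0 = fset0.
Proof. by apply/fsetP => e; rewrite in_fshift !inE. Qed.
Lemma fshift_1 k e : fshift k [fset e] = [fset shift k e].
Proof. by apply/fsetP => e'; rewrite in_fshift !inE (can2_eq (shiftVK k) (shiftK k)). Qed.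

Lemma parity_fshift p k X : parity p (fshift k X) = parity (fun e => p (shift k e)) X.
Proof. by rewrite /parity big_imfset //= => e e' _ _; apply: shift_inj. Qed.

Section Extension.
Variable f : fgrp -> bool.

(** The form [omega] built from it is bilinear and invariant under translation, hence a cocycle.
    Counting an [a]-edge against a [b]-edge in this order only keeps it from being symmetric, and
    commutators measure exactly the asymmetry. *)
Definition pairing (e e' : edge) := ~~ e.2 && e'.2 && f (e.1^-1 * e'.1).
Definition omega (X Y : {fset edge}) := parity (fun e => parity (pairing e) Y) X.

Lemma pairing_shift k e e' : pairing (shift k e) (shift k e') = pairing e e'.
Proof. by rewrite /pairing /= invgM -mulgA mulKg. Qed.

(** Hence switching one lamp twice in succession has no central effect, so that stepping back with
    the same switch inverts a letter. *)
Lemma pairing_diag e : pairing e e = false.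
Proof. by rewrite /pairing; case: e.2. Qed.

Lemma omega_symdl X X' Y : omega (symd X X') Y = omega X Y (+) omega X' Y.
Proof. exact: parity_symd. Qed.

Lemma omega_symdr X Y Y' : omega X (symd Y Y') = omega X Y (+) omega X Y'.
Proof. by rewrite /omega -parity_add; apply: eq_parity => e _; apply: parity_symd. Qed.

Lemma omega_shift k X Y : omega (fshift k X) (fshift k Y) = omega X Y.
Proof.
rewrite /omega parity_fshift; apply: eq_parity => e _; rewrite parity_fshift.
by apply: eq_parity => e' _; apply: pairing_shift.
Qed.

Lemma omega0 X : omega fset0 X = false. Proof. exact: parity0. Qed.
Lemma omegar0 X : omega X fset0 = false.
Proof.
rewrite /omega (eq_parity (q := fun=> false)) => [|e _]; last exact: parity0.
by rewrite /parity big1_eq.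
Qed.

Definition ecar := (fgrp * {fset edge} * bool)%type.
Definition eone : ecar := (1, fset0, false).
Definition emul (a b : ecar) : ecar :=
  (a.1.1 * b.1.1, symd a.1.2 (fshift a.1.1 b.1.2),
   a.2 (+) b.2 (+) omega a.1.2 (fshift a.1.1 b.1.2)).
Definition einv (a : ecar) : ecar :=
  (a.1.1^-1, fshift a.1.1^-1 a.1.2, a.2 (+) omega a.1.2 a.1.2).

Lemma emulA a b c : emul a (emul b c) = emul (emul a b) c.
Proof.
case: a b c => [[g X] r] [[h Y] s] [[k Z] t]; rewrite /emul /=; congr (_, _, _).
- exact: mulgA.
- by rewrite fshift_symd fshiftM symdA.
rewrite fshift_symd omega_symdr omega_symdl fshiftM omega_shift.
move: (omega X _) (omega X _) (omega Y _) => o1 o2 o3.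
by case: r; case: s; case: t; case: o1; case: o2; case: o3.
Qed.

Lemma emul1 a : emul eone a = a.
Proof. by case: a => [[g X] r]; rewrite /emul /= mul1g fshift1 sym0d omega0 addbF. Qed.

Lemma emulV a : emul (einv a) a = eone.
Proof.
case: a => [[g X] r]; rewrite /emul /= mulVg symdd omega_shift; congr (_, _, _).
by case: r; case: (omega X X).
Qed.

Definition ext_group : Defs.group := @Defs.Group ecar eone emul einv emulA emul1 emulV.

Definition ext_gen (x : letter) : ecar :=
  (ltr (dr x), if lp x then [fset edge_of 1 (dr x)] else fset0, ep x).
Definition ext_eval (w : seq letter) : ecar := foldr (fun x a => emul (ext_gen x) a) eone w.
Definition zed : ecar := (1, fset0, true).

Lemma emulr1 a : emul a eone = a.
Proof. by case: a => [[g X] r]; rewrite /emul /= mulg1 fshift0 symd0 omegar0 !addbF. Qed.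

Lemma emul_cancel a b c : emul a b = emul a c -> b = c.
Proof. by move=> e; rewrite -[b]emul1 -[c]emul1 -(emulV a) -!emulA e. Qed.

Lemma emulVr a : emul a (einv a) = eone.
Proof. by apply: (@emul_cancel (einv a)); rewrite emulA emulV emul1 emulr1. Qed.

Lemma ext_eval_cat v w : ext_eval (v ++ w) = emul (ext_eval v) (ext_eval w).
Proof. by elim: v => [|x v IH] /=; rewrite ?emul1 // IH emulA. Qed.

Lemma ext_eval_pos w : (ext_eval w).1.1 = pos w.
Proof. by elim: w => //= x w ->. Qed.

Lemma ext_eval_lit w e : (e \in (ext_eval w).1.2) = lit w e.
Proof.
elim: w e => [|x w IH] e; first by rewrite inE.
rewrite /= in_symd in_fshift IH; congr (_ (+) _); by case: (lp x); rewrite inE.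
Qed.

Lemma ext_eval_qeq v w : (ext_eval v).1 = (ext_eval w).1 <-> qeq v w.
Proof.
split=> [e|[ep el]].
  split; first by rewrite -!ext_eval_pos e.
  by move=> a; rewrite -!ext_eval_lit e.
rewrite [LHS]surjective_pairing [RHS]surjective_pairing !ext_eval_pos ep; congr (_, _).
by apply/fsetP => e; rewrite !ext_eval_lit el.
Qed.

Lemma zedC a : emul a zed = emul zed a.
Proof.
case: a => [[g X] r]; rewrite /emul /= mulg1 mul1g fshift0 fshift1 symd0 sym0d omegar0 omega0.
by rewrite !addbF addbC.
Qed.

Lemma emul_zed a : emul zed a = (a.1, ~~ a.2).
Proof. by case: a => [[g X] r]; rewrite /emul /= mul1g fshift1 sym0d omega0 addbF. Qed.

Definition flip (w : seq letter) : seq letter :=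
  if w is x :: w' then (dr x, lp x, ~~ ep x) :: w' else [::].

Lemma ext_eval_flip w : w != [::] -> ext_eval (flip w) = emul zed (ext_eval w).
Proof.
case: w => // x w _ /=; rewrite emulA emul_zed; congr (emul _ _).
Qed.

Lemma size_flip w : size (flip w) = size w. Proof. by case: w. Qed.

Lemma ext_eval_pair x y : dr y = dinv (dr x) -> lp x = lp y ->
  ext_eval [:: x; y] = (1, fset0, ep x (+) ep y).
Proof.
move=> ey el; have q : qeq [:: x; y] [::].
  by split=> [|e]; rewrite ?(@pos_exc x [::]) ?(@lit_exc x [::]) //= el addbb.
move/ext_eval_qeq: q => q; rewrite [LHS]surjective_pairing q; congr (_, _).
rewrite /= fshift0 symd0 omegar0 !addbF; case: (lp x) el => <-; last by rewrite omega0 addbF.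
rewrite fshift_1 shift_edge mulg1 /omega !parity1 ey -[ltr (dr x)]mul1g edge_flip.
by rewrite pairing_diag addbF.
Qed.

Lemma ext_gen_inj : injective ext_gen.
Proof.
move=> x y h; have ed : dr x = dr y.
  by have := congr1 (fun a => hd a.1.1) h; rewrite /= !hd_ltr => -[].
have ee : ep x = ep y := congr1 snd h.
have el : lp x = lp y.
  have /fsetP/(_ (edge_of 1 (dr x))) : (ext_gen x).1.2 = (ext_gen y).1.2 by rewrite h.
  by rewrite /= -ed; case: (lp x); case: (lp y); rewrite ?inE ?eqxx.
by move: ed el ee; case: (x) => [[? ?] ?]; case: (y) => [[? ?] ?]; rewrite /dr /lp /ep /= => -> -> ->.
Qed.

Lemma ext_gen_linv x : ext_gen (linv x) = einv (ext_gen x).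
Proof.
apply: (@emul_cancel (ext_gen x)); rewrite emulVr.
have := @ext_eval_pair x (linv x) erefl erefl; rewrite /= emulr1 => ->.
by rewrite /= addbb.
Qed.

Lemma winvK : involutive winv.
Proof.
move=> w; rewrite /winv map_rev revK -map_comp (eq_map (g := id)) ?map_id //.
by case=> [[s l] e]; rewrite /linv /= dinvK.
Qed.

Lemma lit_toggle p x y w e : dr y = dinv (dr x) -> lp x (+) lp y ->
  lit (p ++ x :: y :: winv p ++ w) e = (e == edge_of (pos p) (dr x)) (+) lit w e.
Proof.
move=> ey exy; have [pq lq] := qeq_winv (winv p); rewrite winvK in pq lq.
have := lq e; rewrite !lit_cat (@lit_exc x [::]) // lit_cat exy /= => {}lq.
rewrite (can2_eq (shiftVK (pos p)) (shiftK _)) shift_edge mulg1 -shiftM -invgM -pos_cat pq.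
rewrite invg1 shift1 addbCA; congr (_ (+) _); rewrite -[RHS]/(false (+) lit w e) -[false in RHS]lq.
by rewrite -addbA.
Qed.

Lemma ext_generated a : exists w, ext_eval w = a.
Proof.
case: a => [[g X] r].
have [u [u1 uX]] : exists u, pos u = 1 /\ forall e, lit u e = (e \in X).
  elim/fset1U_rect: X => [|e X nX [u [u1 uX]]]; first by exists [::].
  have [h [s ee]] := edge_surj e.
  pose p := [seq (t, false, false) | t <- val h] : seq letter.
  have ph : pos p = h.
    apply: val_inj; rewrite -[RHS]fmul_nil; last exact: valP h.
    by rewrite /p; elim: (val h) => //= t q <-.
  exists (p ++ (s, true, false) :: (dinv s, false, false) :: winv p ++ u); split.
    rewrite pos_cat (@pos_exc _ [::]) // pos_cat u1 mulg1.
    by have [] := qeq_winv (winv p); rewrite winvK pos_cat.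
  move=> e'; rewrite lit_toggle // uX ph -ee in_fset1U.
  by case: eqP nX => // -> /negPf->.
pose q := [seq (t, false, false) | t <- val g] : seq letter.
have pq : pos q = g.
  apply: val_inj; rewrite -[RHS]fmul_nil; last exact: valP g.
  by rewrite /q; elim: (val g) => //= t v <-.
have lq e : lit q e = false by rewrite /q; elim: (val g) e => //= t v IH e; rewrite IH.
have e1 : (ext_eval (u ++ q)).1 = (g, X).
  rewrite [LHS]surjective_pairing ext_eval_pos pos_cat u1 mul1g pq; congr (_, _).
  by apply/fsetP => e; rewrite ext_eval_lit lit_cat lq addbF uX.
have [e2|ne] := eqVneq (ext_eval (u ++ q)).2 r.
  by exists (u ++ q); rewrite [LHS]surjective_pairing e1 e2.
(* This direction yields a two-letter word of value [zed], which corrects the central component. *)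
pose s : dir := (false, false).
exists ([:: (s, false, true); (dinv s, false, false)] ++ u ++ q).
rewrite ext_eval_cat ext_eval_pair // emul_zed e1; congr (_, _).
by case: r (_.2) ne => [] [].
Qed.

Definition gen (i : 'I_#|{: letter}|) : ext_group := ext_gen (enum_val i).

Lemma eval_gen w : eval_word gen w = ext_eval (map enum_val w).
Proof. by elim: w => //= i w ->. Qed.

Lemma gen_inj : injective gen.
Proof. by move=> i j /ext_gen_inj /enum_val_inj. Qed.

Lemma gen_generates : generates gen.
Proof.
move=> a; have [w ew] := ext_generated a; exists (map enum_rank w).
by rewrite eval_gen (mapK (@enum_rankK _)).
Qed.

Lemma gen_symmetric : symmetric_gens gen.
Proof.
move=> i; exists (enum_rank (linv (enum_val i))).
by rewrite /gen enum_rankK ext_gen_linv.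
Qed.

Lemma conjugateP (a b : ext_group) :
  conjugate a b <-> exists c, emul a c = emul c b.
Proof.
split=> -[c e]; exists c.
  by rewrite -e -[gmul _ _]/(emul (einv c) (emul a c)) emulA emulVr emul1.
by rewrite -[LHS]/(emul (einv c) (emul a c)) e emulA emulV emul1.
Qed.

Lemma conjugate_qconj v w : conjugate (ext_eval v : ext_group) (ext_eval w) -> qconj v w.
Proof.
case/conjugateP=> c; have [k <-] := ext_generated c; rewrite -!ext_eval_cat => e.
by exists k; apply/ext_eval_qeq; rewrite e.
Qed.

(** A conjugacy in [Q] lifts up to [zed], which [flip] absorbs without changing the length; the
    empty word has no letter to absorb it. *)
Lemma qconj_conjugate v w : v != [::] -> qconj v w -> exists2 v',
  size v' = size v & conjugate (ext_eval v' : ext_group) (ext_eval w).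
Proof.
move=> nv [k /ext_eval_qeq e].
have [e2|ne] := eqVneq (ext_eval (v ++ k)).2 (ext_eval (k ++ w)).2.
  exists v => //; apply/conjugateP; exists (ext_eval k); rewrite -!ext_eval_cat.
  by rewrite [LHS]surjective_pairing e e2 -surjective_pairing.
exists (flip v); first exact: size_flip.
apply/conjugateP; exists (ext_eval k); rewrite ext_eval_flip // -emulA -!ext_eval_cat emul_zed.
rewrite e [RHS]surjective_pairing; congr (_, _).
by move: ne; case: (_.2); case: (_.2).
Qed.

Definition conj_geo (w : seq letter) := forall v,
  conjugate (ext_eval v : ext_group) (ext_eval w) -> size w <= size v.

Lemma conj_geodesicE w : conj_geodesic gen w <-> conj_geo (map enum_val w).
Proof.
split=> h v hv.
  have := h (map enum_rank v); rewrite !eval_gen (mapK (@enum_rankK _)) !size_map.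
  exact.
by move: hv; rewrite !eval_gen => /h; rewrite !size_map.
Qed.

Lemma conj_geo_slang w : conj_geo w <-> slang w.
Proof.
split=> [cg|].
  have qm : qmin1 w.
    by move=> v nv /(qconj_conjugate nv)[v' <- /cg].
  have [w1|nw] := eqVneq (pos w) 1; last first.
    apply: Or44; apply: (@qmin1_hyp (size w).+1 _ _ [::]) => //; first exact: tour0.
    by rewrite cats0.
  case: (tour_or_shorten w1) => [[D tw]|[w' q lt]].
    have [->|nw] := eqVneq w [::]; first exact: Or41.
    by apply: Or43; apply: qmin1_cyc_tour tw nw.
  (* A shortening is possible only to the empty word, so [w] has value 1 or [zed]. As every letter
     moves, the shortest words for [zed] have length 2. *)
  have [ew'|nw'] := eqVneq w' [::]; last first.
    by have := qm w' nw' (qconj_eq q); rewrite leqNgt lt.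
  rewrite ew' in q; move/ext_eval_qeq: q => q.
  case: (boolP (ext_eval w).2) => [e2|/negPf e2].
    have ew : ext_eval w = zed by rewrite [LHS]surjective_pairing -q e2.
    pose s : dir := (false, false).
    have : size w <= 2.
      apply: (cg [:: (s, false, true); (dinv s, false, false)]).
      by apply/conjugateP; exists eone; rewrite ext_eval_pair // ew emulr1 emul1.
    case: w w1 e2 q ew {cg qm w' ew' lt} => [|x [|y [|? ?]]] // w1 e2 q ew _.
    have ey : dr y = dinv (dr x).
      by move: w1; rewrite !pos_cons mulg1 => /mulg1_eq/(congr1 hd); rewrite ltrV => -[].
    have el : lp x = lp y.
      have := ext_eval_lit [:: x; y] (edge_of 1 (dr x)); rewrite -q inE.
      rewrite (@lit_exc x [::]) // eqxx /=.
      by case: (lp x); case: (lp y).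
    apply: Or42; exists x, y; split=> //.
    by move: e2; rewrite ext_eval_pair //=; case: (ep x); case: (ep y).
  apply: Or41; apply/nilP; rewrite /nilp -leqn0; apply: (cg [::]); apply/conjugateP.
  by exists eone; rewrite [ext_eval w]surjective_pairing -q e2.
case=> [-> //|[x [y [-> ey el ne]]]|cw|hw] v.
- rewrite ext_eval_pair // => /conjugateP[c].
  have -> : ep x (+) ep y by case: (ep x) (ep y) ne => [] [].
  rewrite -/zed zedC => e.
  have {}e : ext_eval v = zed.
    by rewrite -[LHS]emulr1 -(emulVr c) emulA e -emulA emulVr emulr1.
  by case: v e => [|z [|? ?]].
- by move/conjugate_qconj; apply: cyc_tour_min.
move/conjugate_qconj; rewrite -[w]cats0 => h; exact: (hyp_min hw tour0 h).
Qed.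

Theorem conj_geo_unambiguous : unambiguous_cfl (conj_geodesic gen).
Proof.
have [m [g [ug hg]]] := slang_unambiguous; exists m, g; split=> // w.
by rewrite conj_geodesicE conj_geo_slang.
Qed.
End Extension.

(** * The conjugacy problem *)

Definition dira : dir := (false, false).
Definition dirA : dir := (false, true).
Definition dirb : dir := (true, false).
Definition dirB : dir := (true, true).

Definition wd (u : seq dir) : fgrp := foldr (fun s g => ltr s * g) 1 u.

Lemma val_wd u : val (wd u) = fmul u [::].
Proof. by elim: u => //= s u <-. Qed.
Lemma wd_val g : wd (val g) = g.
Proof. by apply: val_inj; rewrite val_wd fmul_nil //; apply: valP. Qed.
Lemma wd_cat u v : wd (u ++ v) = wd u * wd v.
Proof. by elim: u => [|s u IH]; rewrite ?mul1g //= IH mulgA. Qed.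
Lemma pos_wd w : pos w = wd (map dr w).
Proof. by elim: w => //= x w ->. Qed.

Section Twist.
Opaque symd.
Variable phi : nat -> nat -> bool.

(* Current [a]-exponent: [p - q], truncated; [t] is the (truncated) total [a]-exponent. *)
Fixpoint tsum p q t (u : seq dir) : bool :=
  match u with
  | [::] => false
  | (true, _) :: u' => phi (p - q) t (+) tsum p q t u'
  | (false, false) :: u' => tsum p.+1 q t u'
  | (false, true) :: u' => tsum p q.+1 t u'
  end.
Definition aexp (u : seq dir) := count_mem dira u - count_mem dirA u.
Definition twist_word u := tsum 0 0 (aexp u) u.
Definition twist (g : fgrp) := twist_word (val g).

(** The counters matter only through [p - q], so a cancelling pair of letters [a] leaves the sum
    unchanged; a cancelling pair of letters [b] contributes the same bit twice. Thus [tsum] is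
    invariant under free reduction, despite the truncation. *)
Lemma tsum_shift p q t u : tsum p.+1 q.+1 t u = tsum p q t u.
Proof. by elim: u p q => //= -[[] []] u IH p q /=; rewrite ?subSS IH. Qed.

Lemma tsum_push p q t s u : tsum p q t (push s u) = tsum p q t (s :: u).
Proof.
case: u => [|r u] //=; case: eqP => // ->; case: s => [[] []] /=; rewrite ?tsum_shift //.
all: by rewrite addKb.
Qed.

Lemma tsum_fmul p q t u : tsum p q t (fmul u [::]) = tsum p q t u.
Proof.
by elim: u p q => //= s u IH p q; rewrite tsum_push; case: s => [[] []] /=; rewrite IH.
Qed.

Lemma aexp_fmul u : aexp (fmul u [::]) = aexp u.
Proof.
rewrite /aexp; have : (count_mem dira (fmul u [::]) + count_mem dirA u =
   count_mem dira u + count_mem dirA (fmul u [::]))%N; last by lia.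
elim: u => //= s u IH; rewrite /push; move: IH; case: (fmul u [::]) => [|r v] /=.
  by case: s => [[] []]; rewrite ?xpair_eqE /=; lia.
by case: s r => [[] []] [[] []] /=; rewrite /dira /dirA ?xpair_eqE /=; lia.
Qed.

Lemma twist_wd u : twist (wd u) = twist_word u.
Proof. by rewrite /twist val_wd /twist_word aexp_fmul tsum_fmul. Qed.

Definition cword n := nseq n dira ++ dirb :: nseq n dirA.

Lemma tsum_nseqa n p q t u : tsum p q t (nseq n dira ++ u) = tsum (n + p)%N q t u.
Proof. by elim: n p => //= n IH p; rewrite IH addnS. Qed.
Lemma tsum_nseqA n p q t u : tsum p q t (nseq n dirA ++ u) = tsum p (n + q)%N t u.
Proof. by elim: n q => //= n IH q; rewrite IH addnS. Qed.

Lemma twist_cword n u : twist_word (cword n ++ u) = phi n (aexp u) (+) twist_word u.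
Proof.
have -> : twist_word (cword n ++ u) = tsum 0 0 (aexp u) (cword n ++ u).
  rewrite /twist_word; congr (tsum _ _ _ _).
  by rewrite /aexp /cword !count_cat /= !count_nseq /=; lia.
rewrite /cword -catA cat_cons tsum_nseqa /= tsum_nseqA subn0 !addn0; congr (_ (+) _).
by rewrite /twist_word; elim: n => // n IH; rewrite tsum_shift.
Qed.

Lemma twist_moved n : (exists g, twist g (+) twist (wd (cword n) * g)) <-> exists t, phi n t.
Proof.
have e g : twist g (+) twist (wd (cword n) * g) = phi n (aexp (val g)).
  rewrite -{2}(wd_val g) -wd_cat twist_wd twist_cword /twist.
  by rewrite addbCA addbb addbF.
split=> [[g]|[t pt]]; first by rewrite e; exists (aexp (val g)).
exists (wd (nseq t dira)); rewrite e; suff -> : aexp (val (wd (nseq t dira))) = t by [].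
rewrite val_wd aexp_fmul /aexp !count_nseq /=; lia.
Qed.

Definition letA : letter := (dira, true, false).
Definition let0 (s : dir) : letter := (s, false, false).
Definition pword n : seq letter := map let0 (nseq n dira ++ dirB :: nseq n dirA).
(** The pair [letA], [let0 dirA] switches the [a]-edge at the current vertex and steps back, and
    [pword n] leads to [c_n^-1], so this word spells [x_n]; its [flip] spells [x_n z]. *)
Definition uword n := letA :: let0 dirA :: pword n ++ letA :: let0 dirA :: winv (pword n).

Lemma winv_pword n : winv (pword n) = map let0 (cword n).
Proof.
by rewrite /winv /pword /cword !map_cat /= !map_nseq rev_cat rev_cons !rev_nseq /= cat_rcons.
Qed.

Lemma pos_pword n : pos (pword n) = (wd (cword n))^-1.
Proof.
have [+ _] := qeq_winv (pword n); rewrite winv_pword pos_cat => /mulg1_eq <-.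
by rewrite pos_wd -map_comp map_id.
Qed.

Local Notation G := (ext_group twist).

Lemma uword_conj n : conjugate (ext_eval twist (uword n) : G) (ext_eval twist (flip (uword n))) <->
  exists t, phi n t.
Proof.
pose e1 : fgrp * bool := (1, false); pose e2 : fgrp * bool := ((wd (cword n))^-1, false).
have eX : (ext_eval twist (uword n)).1 = (1, symd [fset e1] [fset e2]).
  rewrite [LHS]surjective_pairing ext_eval_pos; congr (_, _).
    rewrite /uword (@pos_exc letA [::]) // pos_cat (@pos_exc letA [::]) //.
    by have [] := qeq_winv (winv (pword n)); rewrite winvK pos_cat.
  apply/fsetP => e; transitivity (lit (uword n) e); first exact: ext_eval_lit.
  rewrite in_symd11 /uword.
  rewrite (@lit_toggle [::] letA (let0 dirA)) // -[winv (pword n)]cats0 lit_toggle // addbF.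
  by rewrite pos_pword.
rewrite (@ext_eval_flip twist (uword n) isT) -twist_moved.
case: (ext_eval twist (uword n)) eX => X b /= ->.
rewrite emul_zed conjugateP /=; split=> [[[[k Y] r]]|[g hg]].
  rewrite /emul /= !mul1g !mulg1 fshift1 => e.
  (* Lamp sets commute, so [Y] cancels when lamps are compared: the translation part of the
     conjugator preserves the two edges. *)
  have eY : fshift k (symd [fset e1] [fset e2]) = symd [fset e1] [fset e2].
    have := congr1 (fun a => symd Y a.1.2) e.
    by rewrite /= symdKC [in RHS]symdA symdd sym0d.
  have := congr1 snd e; rewrite /= eY omega_symdl omega_symdr.
  (* An [a]-edge in the second argument pairs to zero, so only one order of [Y] and the two edges
     contributes to the commutator. *)
  have z (a : fgrp) : omega twist Y [fset (a, false)] = false.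
    rewrite /omega (eq_parity (q := fun=> false)) => [|c _]; first by rewrite /parity big1_eq.
    by rewrite parity1 /pairing /= andbF.
  rewrite !z /omega !parity1 -parity_add => h.
  have /parity_ex[c _] : parity (fun c => pairing twist e1 c (+) pairing twist e2 c) Y.
    by move: h {e}; case: b; case: r; case: (parity _ _).
  rewrite /pairing /= invg1 mul1g invgK; case: c.2 => //= h'.
  by exists c.1.
(* The conjugator is the switch of the [b]-edge at [g], which meets exactly one of the two [a]-edges
   with twist 1. *)
have h1 : omega twist (symd [fset e1] [fset e2]) [fset (g, true)].
  by rewrite omega_symdl /omega !parity1 /pairing /= invg1 mul1g invgK.
have h2 : omega twist [fset (g, true)] (symd [fset e1] [fset e2]) = false.
  by rewrite omega_symdr /omega !parity1 /pairing /=.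
move: h1 h2; move: (symd [fset e1] [fset e2]) [fset (g, true)] => X' Y h1 h2; exists (1, Y, false).
rewrite /emul /= !mul1g !fshift1 h1 h2; congr (_, _, _); last by case: b.
exact: symdC.
Qed.

Lemma pickle_word k (u : seq 'I_k) : choice.pickle u = code (map (@nat_of_ord k) u).
Proof. by []. Qed.

Lemma pickle_words k (u v : seq 'I_k) : choice.pickle (u, v) = code [:: choice.pickle u; choice.pickle v].
Proof. by []. Qed.

(** * Computability of the reduction *)

Section Reduction.
Variable rk : letter -> nat.

(** Words are coded from right to left, by consing onto the code of the rest; no concatenation of
    codes has to be computed. *)
Definition arm_code n s m := iter n (ccons (rk (let0 dira)))
  (ccons (rk (let0 s)) (iter n (ccons (rk (let0 dirA))) m)).
Definition body_code n := ccons (rk (let0 dirA)) (arm_code n dirB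
  (ccons (rk letA) (ccons (rk (let0 dirA)) (arm_code n dirb 0)))).
Definition pair_code n := ccons (ccons (rk letA) (body_code n))
  (ccons (ccons (rk (dira, true, true)) (body_code n)) 0).

Lemma iter_ccons n x l : iter n (ccons (rk x)) (code l) = code (map rk (nseq n x) ++ l).
Proof. by elim: n => // n IH; rewrite iterS IH -code_cons. Qed.

Lemma arm_codeE n s l :
  arm_code n s (code l) = code (map rk (map let0 (nseq n dira ++ s :: nseq n dirA)) ++ l).
Proof.
rewrite /arm_code iter_ccons -code_cons iter_ccons; congr (code _).
by rewrite !map_cat !map_cons !map_nseq -catA.
Qed.

Lemma body_codeE n : body_code n = code (map rk (behead (uword n))).
Proof.
rewrite /body_code -[0]/(code [::]) arm_codeE -!code_cons arm_codeE -code_cons; congr (code _).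
rewrite cats0 /uword winv_pword.
rewrite -[behead _]/(let0 dirA :: pword n ++ letA :: let0 dirA :: map let0 (cword n)).
by rewrite [in RHS]map_cons [in RHS]map_cat.
Qed.

Lemma pair_codeE n : pair_code n = code [:: code (map rk (uword n)); code (map rk (flip (uword n)))].
Proof. by rewrite /pair_code body_codeE -[0]/(code [::]) -!code_cons. Qed.

Lemma computable_pair_code : computable1 pair_code.
Proof.
rewrite /pair_code /body_code /arm_code.
move: (rk letA) (rk (let0 dira)) (rk (let0 dirA)) (rk (let0 dirb)) (rk (let0 dirB)) (rk _) => r1 r2 r3 r4 r5 r6.
comp.
Qed.
End Reduction.

Lemma conj_undecidable : (forall c, ~ forall n, ((exists t, phi n t) /\ reval c [:: n] 1) \/
  (~ (exists t, phi n t) /\ reval c [:: n] 0)) -> ~ decidable_pred (conj_problem (gen twist)).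
Proof.
move=> und [c hc].
pose rk x := nat_of_ord (enum_rank (x : letter)); have [cF hF] := computable_pair_code rk.
have F_pickle n : pair_code rk n = choice.pickle (map enum_rank (uword n), map enum_rank (flip (uword n))).
  by rewrite pickle_words !pickle_word -!map_comp pair_codeE.
apply: (und (RComp c [:: cF])) => n.
have ev b : reval c [:: pair_code rk n] b -> reval (RComp c [:: cF]) [:: n] b.
  by apply: ev_comp; apply: evs_cons (hF [:: n] erefl) (evs_nil _).
have := hc (map enum_rank (uword n), map enum_rank (flip (uword n))).
rewrite -F_pickle /conj_problem [fst _]/fst [snd _]/snd !eval_gen !(mapK (@enum_rankK _)).
by case=> -[/uword_conj h /ev]; [left | right].
Qed.
End Twist.

(** * The word problem *)

Lemma computable_table d (s : seq nat) : computable1 (nth d s).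
Proof.
elim: s => [|x s IH].
  by apply: (computable_ext (F := fun=> d)) (computable_const _ _) => xs _; rewrite nth_nil.
apply: (computable_ext (F := fun xs => ifn (nth 0 xs 0 == 0%N) x (nth d s (nth 0 xs 0).-1))).
  by move=> xs _; case: (nth 0 xs 0).
apply: computable_if; [comp | comp |].
by apply: computable_app1 IH _; comp.
Qed.

Definition lt0 : letter := let0 dira.
Definition letter_of (n : nat) : letter := nth lt0 (enum {: letter}) n.

(** The algorithm receives letters as ranks in a finite type, so any function of a letter is a
    finite table. *)
Lemma computable_letter_of (g : letter -> nat) : computable1 (fun n => g (letter_of n)).
Proof.
apply: computable_ext (computable_table (g lt0) (map g (enum {: letter}))) => xs _.
set n := nth 0 xs 0; have [lt|ge] := ltnP n (size (enum {: letter})); first by rewrite (nth_map lt0).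
by rewrite /letter_of [in RHS]nth_default // nth_default // size_map.
Qed.

Definition lampb n := lp (letter_of n).
Definition epsb n := ep (letter_of n).
Definition genb n := (dr (letter_of n)).1.
Definition dirab n := dr (letter_of n) == dira.
Definition dirAb n := dr (letter_of n) == dirA.
Definition headn n : nat := (dr (letter_of n)).2.
Definition dcode (s : dir) : nat := (s.1 + 2 * s.2)%N.
Definition dirn n := dcode (dr (letter_of n)).
Definition dirVn n := dcode (dinv (dr (letter_of n))).

Lemma dcode_inj : injective dcode. Proof. by move=> [[] []] [[] []]. Qed.

Lemma computable_lampb : computable1 (fun n => lampb n : nat).
Proof. exact: (computable_letter_of (fun x => lp x)). Qed.
Lemma computable_epsb : computable1 (fun n => epsb n : nat).
Proof. exact: (computable_letter_of (fun x => ep x)). Qed.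
Lemma computable_genb : computable1 (fun n => genb n : nat).
Proof. exact: (computable_letter_of (fun x => (dr x).1)). Qed.
Lemma computable_dirab : computable1 (fun n => dirab n : nat).
Proof. exact: (computable_letter_of (fun x => dr x == dira)). Qed.
Lemma computable_dirAb : computable1 (fun n => dirAb n : nat).
Proof. exact: (computable_letter_of (fun x => dr x == dirA)). Qed.
Lemma computable_headn : computable1 headn.
Proof. exact: (computable_letter_of (fun x => (dr x).2)). Qed.
Lemma computable_dirn : computable1 dirn.
Proof. exact: (computable_letter_of (fun x => dcode (dr x))). Qed.
Lemma computable_dirVn : computable1 dirVn.
Proof. exact: (computable_letter_of (fun x => dcode (dinv (dr x)))). Qed.
#[local] Hint Resolve computable_lampb computable_epsb computable_genb computable_dirab
  computable_dirAb computable_headn computable_dirn computable_dirVn : compdb.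

(** The stack codes the inverse of the current position: there the latest letter comes first, so a
    step of free reduction only touches the head. *)
Definition spush c r := ifn ((r != 0%N) && (chd r == dirn c)) (ctl r) (ccons (dirVn c) r).
Definition stk W i := nat_rect (fun=> nat) 0 (fun j r => spush (cnth W j) r) i.
(** The moment at which the walk stands at the vertex naming the edge of letter [i]: before the
    crossing, or after it for an inverse generator. *)
Definition vi W i := (i + headn (cnth W i))%N.
Definition eqe W i j := (stk W (vi W i) == stk W (vi W j)) &&
  ((genb (cnth W i) : nat) == (genb (cnth W j) : nat)).
Definition na W i j := bsum j (fun l => (i <= l) && dirab (cnth W l)).
Definition nA W i j := bsum j (fun l => (i <= l) && dirAb (cnth W l)).

Lemma computable_spush : computable2 spush.
Proof. rewrite /spush; comp. Qed.
#[local] Hint Resolve computable_spush : compdb.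

Lemma computable_stk : computable2 stk.
Proof.
apply: (computable_rec (K := fun xs => nth 0 xs 1) (B := fun=> 0%N)
  (S := fun xs j r => spush (cnth (nth 0 xs 0) j) r)); comp.
Qed.
#[local] Hint Resolve computable_stk : compdb.

Lemma computable_vi : computable2 vi.
Proof. rewrite /vi; comp. Qed.
#[local] Hint Resolve computable_vi : compdb.

Lemma computable_eqe : computable3 (fun W i j => eqe W i j : nat).
Proof. rewrite /eqe; comp. Qed.
Lemma computable_na : computable3 na.
Proof. rewrite /na; comp. Qed.
Lemma computable_nA : computable3 nA.
Proof. rewrite /nA; comp. Qed.
#[local] Hint Resolve computable_eqe computable_na computable_nA : compdb.

Section WordProblem.
Variable phi : nat -> nat -> bool.
Hypothesis computable_phi : computable2 (fun n t => phi n t : nat).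
#[local] Hint Resolve computable_phi : compdb.

(** The twist of the segment between the moments [i] and [j], computed on the unreduced word, which
    is legitimate because the twist is invariant under free reduction. *)
Definition fidx W i j := odd (bsum j (fun l => (i <= l) && (genb (cnth W l) &&
  phi (na W i l - nA W i l) (na W i j - nA W i j)))).

Lemma computable_fidx : computable3 (fun W i j => fidx W i j : nat).
Proof. rewrite /fidx; comp. Qed.
#[local] Hint Resolve computable_fidx : compdb.

(** Only edges crossed by the word can be lit, so finitely many parities have to be tested. *)
Definition wp_lit W := ball (csize W) (fun i =>
  ~~ odd (bsum (csize W) (fun j => lampb (cnth W j) && eqe W j i))).
(** As letters are appended one at a time, bilinearity makes the central component collect one
    pairing for each two switches [i < j], besides the bits of the letters. *)
Definition wp_zed W := odd (bsum (csize W) (fun j => epsb (cnth W j)) +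
  bsum (csize W) (fun j => bsum j (fun i => lampb (cnth W i) && (lampb (cnth W j) &&
    (~~ genb (cnth W i) && (genb (cnth W j) && fidx W (vi W i) (vi W j))))))).
Definition wp W := (stk W (csize W) == 0%N) && (wp_lit W && ~~ wp_zed W).

Lemma computable_wp : computable1 (fun W => wp W : nat).
Proof. rewrite /wp /wp_lit /wp_zed; comp. Qed.

Local Notation f := (twist phi).

(** * Correctness of the algorithm for the word problem *)

Section Correctness.
Variables (w : seq letter) (W : nat).
Hypothesis sizeW : csize W = size w.
Hypothesis nthW : forall i, i < size w -> letter_of (cnth W i) = nth lt0 w i.

Local Notation x_ := (nth lt0 w).
Definition edge_at i := edge_of (pos (take i w)) (dr (x_ i)).

Lemma pos_takeS i : i < size w -> pos (take i.+1 w) = pos (take i w) * ltr (dr (x_ i)).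
Proof. by move=> lt; rewrite (take_nth lt0) // -cats1 pos_cat pos_cons mulg1. Qed.

Lemma stkE i : i <= size w -> stk W i = code (map dcode (val (pos (take i w))^-1)).
Proof.
elim: i => [|i IH] lt; first by rewrite take0.
rewrite pos_takeS // invgM ltrV -[stk W i.+1]/(spush (cnth W i) (stk W i)) IH 1?ltnW //.
rewrite /spush /dirn /dirVn nthW // code_eq0 chd_code ctl_code.
rewrite -[val (ltr _ * _)]/(push (dinv (dr (x_ i))) (val (pos (take i w))^-1)).
case: (val (pos (take i w))^-1) => [|t u]; first by rewrite /ifn /= -code_cons.
rewrite /push dinvK /ifn [nth _ _ _]/= [map _ _ != _]/= (inj_eq dcode_inj).
by case: eqP => //= _; rewrite -code_cons.
Qed.

Lemma stk_eq i j : i <= size w -> j <= size w ->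
  (stk W i == stk W j) = (pos (take i w) == pos (take j w)).
Proof.
move=> li lj; rewrite !stkE // (inj_eq code_inj) (inj_eq (inj_map dcode_inj)).
by rewrite -[_ == _]/((pos (take i w))^-1 == (pos (take j w))^-1) eqg_inv.
Qed.

Lemma vi_leq i : i < size w -> vi W i <= size w.
Proof. by move=> lt; rewrite /vi /headn nthW //; case: (dr _).2; rewrite ?addn1 ?addn0 // ltnW. Qed.

Lemma edge_atE i : i < size w -> edge_at i = (pos (take (vi W i) w), genb (cnth W i)).
Proof.
move=> lt; rewrite /edge_at /edge_of /vi /headn /genb nthW //.
by case: (dr _).2; rewrite ?addn1 ?addn0 // pos_takeS.
Qed.

Lemma eqeE i j : i < size w -> j < size w -> eqe W i j = (edge_at i == edge_at j).
Proof.
move=> li lj; rewrite /eqe stk_eq ?vi_leq // !edge_atE // xpair_eqE.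
by congr (_ && _); case: (genb _); case: (genb _).
Qed.

Lemma odd_bsumS n g : odd (bsum n.+1 g) = odd (bsum n g) (+) odd (g n).
Proof. by rewrite -oddD. Qed.

Lemma lit_bsum n e : n <= size w ->
  lit (take n w) e = odd (bsum n (fun j => lp (x_ j) && (e == edge_at j))).
Proof.
elim: n => [|n IH] lt; first by rewrite take0.
rewrite (take_nth lt0) // -cats1 lit_cat IH 1?ltnW // odd_bsumS; congr (_ (+) _).
rewrite /= addbF oddb (can2_eq (shiftVK (pos (take n w))) (shiftK _)) shift_edge mulg1.
by [].
Qed.

Lemma parity_bsum p n : n <= size w ->
  parity p (ext_eval f (take n w)).1.2 = odd (bsum n (fun j => lp (x_ j) && p (edge_at j))).
Proof.
elim: n => [|n IH] lt; first by rewrite take0 parity0.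
rewrite (take_nth lt0) // -cats1 ext_eval_cat odd_bsumS -IH 1?ltnW // oddb.
rewrite -[(emul _ _ _).1.2]/(symd (ext_eval f (take n w)).1.2
   (fshift (ext_eval f (take n w)).1.1 (ext_eval f [:: x_ n]).1.2)).
rewrite parity_symd ext_eval_pos; congr (_ (+) _).
have -> : (ext_eval f [:: x_ n]).1.2 = if lp (x_ n) then [fset edge_of 1 (dr (x_ n))]%fset else fset0.
  by rewrite /= fshift0 symd0.
case: (lp (x_ n)); last by rewrite fshift0 parity0.
by rewrite fshift_1 parity1 shift_edge mulg1.
Qed.

Lemma eval_bsum n : n <= size w ->
  (ext_eval f (take n w)).2 = odd (bsum n (fun j => ep (x_ j)) +
    bsum n (fun j => bsum j (fun i => lp (x_ i) && (lp (x_ j) && pairing f (edge_at i) (edge_at j))))).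
Proof.
elim: n => [|n IH] lt; first by rewrite take0.
rewrite (take_nth lt0) // -cats1 ext_eval_cat oddD !odd_bsumS.
rewrite -[(emul _ _ _).2]/((ext_eval f (take n w)).2 (+) (ext_eval f [:: x_ n]).2 (+)
  omega f (ext_eval f (take n w)).1.2 (fshift (ext_eval f (take n w)).1.1 (ext_eval f [:: x_ n]).1.2)).
rewrite IH 1?ltnW // oddD ext_eval_pos.
have -> : (ext_eval f [:: x_ n]).2 = ep (x_ n) by rewrite /= fshift0 omegar0 !addbF.
have -> : (ext_eval f [:: x_ n]).1.2 = if lp (x_ n) then [fset edge_of 1 (dr (x_ n))]%fset else fset0.
  by rewrite /= fshift0 symd0.
have -> : omega f (ext_eval f (take n w)).1.2 (fshift (pos (take n w))
    (if lp (x_ n) then [fset edge_of 1 (dr (x_ n))]%fset else fset0)) =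
  odd (bsum n (fun i => lp (x_ i) && (lp (x_ n) && pairing f (edge_at i) (edge_at n)))).
  rewrite -(parity_bsum (fun e => lp (x_ n) && pairing f e (edge_at n))) 1?ltnW //.
  apply: eq_parity => e _; case: (lp (x_ n)); last by rewrite fshift0 parity0.
  by rewrite fshift_1 parity1 shift_edge mulg1.
rewrite oddb.
by case: (odd _); case: (odd _); case: (ep _); case: (odd _).
Qed.

Lemma eq_bsum n (g h : nat -> nat) : (forall j, j < n -> g j = h j) -> bsum n g = bsum n h.
Proof.
elim: n => // n IH e; rewrite -[LHS]/(bsum n g + g n)%N -[RHS]/(bsum n h + h n)%N.
by rewrite (e n) // IH // => j lt; apply: e; apply: ltnW.
Qed.

Lemma tsum_rcons p q t v s : tsum phi p q t (rcons v s) =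
  tsum phi p q t v (+) (s.1 && phi (p + count_mem dira v - (q + count_mem dirA v)) t).
Proof.
elim: v p q => [|r v IH] p q; first by case: s => [[] []]; rewrite /= ?addn0 ?addbF.
by case: r => [[] []] /=; rewrite IH ?addbA /dira /dirA ?xpair_eqE /=;
  congr (_ (+) (_ && phi _ _)); lia.
Qed.

Definition seg i j := map dr (drop i (take j w)).

Lemma seg_small i j : j <= i -> seg i j = [::].
Proof. by move=> le; rewrite /seg drop_oversize // size_take; case: ltnP => // ?; lia. Qed.

Lemma segS i j : i <= j -> j < size w -> seg i j.+1 = rcons (seg i j) (dr (x_ j)).
Proof.
move=> le lt; rewrite /seg (take_nth lt0) // -cats1 drop_cat size_takel; last exact: ltnW.
have [_|ge] := ltnP i j; first by rewrite map_cat cats1.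
have -> : i = j by lia.
by rewrite subnn drop0 drop_oversize // size_take_min geq_minl.
Qed.

Lemma naE i j : j <= size w -> na W i j = count_mem dira (seg i j).
Proof.
elim: j => [|j IH] lt; first by rewrite seg_small.
rewrite -[LHS]/(na W i j + ((i <= j) && dirab (cnth W j)))%N IH; last exact: ltnW.
have [le|le] := leqP i j; last by rewrite addn0 !seg_small // ltnW.
by rewrite segS // -cats1 count_cat /= addn0 /dirab nthW.
Qed.

Lemma nAE i j : j <= size w -> nA W i j = count_mem dirA (seg i j).
Proof.
elim: j => [|j IH] lt; first by rewrite seg_small.
rewrite -[LHS]/(nA W i j + ((i <= j) && dirAb (cnth W j)))%N IH; last exact: ltnW.
have [le|le] := leqP i j; last by rewrite addn0 !seg_small // ltnW.
by rewrite segS // -cats1 count_cat /= addn0 /dirAb nthW.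
Qed.

Lemma fidxE i j : j <= size w -> fidx W i j = twist_word phi (seg i j).
Proof.
move=> lj; rewrite /fidx naE // nAE // -/(aexp (seg i j)) /twist_word.
move: (aexp _) => t; elim: j lj => [|j IH] lt; first by rewrite seg_small.
rewrite odd_bsumS IH ?oddb; last exact: ltnW.
have [le|le] := leqP i j; last by rewrite addbF !seg_small // ltnW.
rewrite segS // tsum_rcons !add0n /genb nthW // naE ?nAE //; exact: ltnW.
Qed.

(** The quotient of two positions is spelled by the letters in between, so the twist in the pairing
    is that of a segment. *)
Lemma pairingE i j : i < j -> j < size w -> pairing f (edge_at i) (edge_at j) =
  ~~ genb (cnth W i) && (genb (cnth W j) && fidx W (vi W i) (vi W j)).
Proof.
move=> lt lj; have li := ltn_trans lt lj.
have le : vi W i <= vi W j by rewrite /vi /headn; case: (dr _).2; lia.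
rewrite !edge_atE // /pairing /= -andbA fidxE ?vi_leq //; congr (_ && (_ && _)).
rewrite -twist_wd -pos_wd; congr (twist _ _); apply: (mulgI (pos (take (vi W i) w))).
by rewrite mulVKg -pos_cat -{1}(take_takel w le) cat_take_drop.
Qed.

Lemma wp_zedE : wp_zed W = (ext_eval f w).2.
Proof.
rewrite -(take_size w) eval_bsum // /wp_zed sizeW; congr (odd (_ + _)).
  by apply: eq_bsum => j lt; rewrite /epsb nthW.
apply: eq_bsum => j lj; apply: eq_bsum => i li.
by rewrite /lampb !nthW ?pairingE // (ltn_trans li).
Qed.

Lemma wp_litP : reflect (lit w =1 fun=> false) (wp_lit W).
Proof.
have e i : i < size w -> odd (bsum (csize W) (fun j => lampb (cnth W j) && eqe W j i)) =
    lit w (edge_at i).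
  move=> li; rewrite -[in RHS](take_size w) lit_bsum // sizeW; congr (odd _).
  by apply: eq_bsum => j lj; rewrite /lampb nthW // eqeE // eq_sym.
apply: (iffP (ballP _ _)) => [h a|h i li]; last by rewrite e ?h // -sizeW.
have [g [s ->]] := edge_surj a; apply/negP => hl; have [p [x [q [ew ep]]]] := lit_split hl.
have lp : size p < size w by rewrite ew size_cat /= addnS ltnS leq_addr.
have := h (size p); rewrite e // [X in (_ < X) -> _]sizeW => /(_ lp).
suff <- : edge_of g s = edge_at (size p) by rewrite hl.
by rewrite ep /edge_at ew take_size_cat // nth_cat ltnn subnn.
Qed.

Lemma wpP : reflect (ext_eval f w = eone) (wp W).
Proof.
have sz : (stk W (csize W) == 0%N) = (pos w == 1).
  by rewrite sizeW -[0%N]/(stk W 0) stk_eq // take_size take0.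
rewrite /wp sz wp_zedE; apply: (iffP and3P) => [[/eqP p1 /wp_litP l0 z0]|e].
  have q : qeq w [::] by [].
  move/(ext_eval_qeq f): q => q; rewrite [LHS]surjective_pairing q; congr (_, _).
  exact: negbTE.
split; last by rewrite e.
  by rewrite -(ext_eval_pos f) e.
by apply/wp_litP => a; rewrite -(ext_eval_lit f) e inE.
Qed.
End Correctness.

Theorem word_problem_decidable : decidable_pred (word_problem (gen f)).
Proof.
have [c hc] := computable_wp; exists c => u.
have := hc [:: choice.pickle u] erefl; rewrite pickle_word.
set W := code _; pose w := map enum_val u.
have sW : csize W = size w by rewrite csize_code !size_map.
have nW i : i < size w -> letter_of (cnth W i) = nth lt0 w i.
  rewrite size_map => lt; rewrite cnth_code; case: u lt @W @w sW => // i0 u0; set u := i0 :: u0.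
  move=> lt W w _; rewrite (nth_map i0) // (nth_map i0) // /letter_of.
  by rewrite -enum_val_nth.
by case: (wpP sW nW) => h /= r; [left | right]; rewrite /word_problem eval_gen.
Qed.
End WordProblem.

Local Close Scope fset_scope.
Local Close Scope group_scope.

Theorem mainTheorem1 :
  exists (G : group) (k : nat) (s : 'I_k -> G),
    [/\ injective s /\ generates s /\ symmetric_gens s,
        decidable_pred (word_problem s),
        ~ decidable_pred (conj_problem s)
      & unambiguous_cfl (conj_geodesic s)].
Proof.
(* For [phi := halts] the number [t] is a certificate: its validity is decidable, its existence is
   not. *)
exists (ext_group (twist halts)), #|{: letter}|, (@gen (twist halts)); split.
- split; [exact: gen_inj | split; [exact: gen_generates | exact: gen_symmetric]].
- exact: word_problem_decidable computable_halts.
- exact: conj_undecidable halting_undecidable.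
exact: conj_geo_unambiguous.
Qed.
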